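(* Consider the Shifted Boundary Method (SBM) discretisation of the Stokes problem on a family of meshes indexed by the mesh size $h$, with the spaces $V_h,Q_h$, the forms $a,b_1,b_2$ (built with the elementwise polynomial extrapolation $\mathbf{u}^F$ for trial functions and the first-order Taylor extension $\mathbf{v}^T$ for test functions) and the norms $\|\cdot\|_a,\|\cdot\|_Q$ described in the context. Assume: (1) there are $c_d>0$ and $\zeta>0$, independent of $h$, such that $\|\mathbf{d}(\tilde{\mathbf{x}})\|\le c_d\,h_T\hat h_T^{\zeta}$ for every $\tilde{\mathbf{x}}$ on the surrogate boundary $\Gamma'$, where $T$ is the active element whose face contains $\tilde{\mathbf{x}}$; (2) the Nitsche penalty satisfies $\alpha\le c_\alpha\,2\mu\,h_T^{-1}$ on each face of $T$ in $\Gamma'$, with $c_\alpha>0$ independent of $h$. Let $\hat h_{\tilde\Gamma_D}=\max\{\hat h_T:\partial T\cap\Gamma'\ne\emptyset\}$. Then there exist a constant $C>0$ independent of $h$ and, in the symmetric-gradient case $\boldsymbol{\nabla}_s=\varepsilon$, a threshold $\hat h_0>0$ independent of $h$, such that, with $\varepsilon_h=C\,\hat h_{\tilde\Gamma_D}^{\zeta}$, $$|a(\mathbf{u}_h,\mathbf{v}_h)-a(\mathbf{v}_h,\mathbf{u}_h)|\le\varepsilon_h\,\|\mathbf{u}_h\|_a\|\mathbf{v}_h\|_a,$$ $$|b_1(\mathbf{v}_h,q_h)-b_2(\mathbf{v}_h,q_h)|\le\varepsilon_h\,\|\mathbf{v}_h\|_a\|q_h\|_Q$$ for all $\mathbf{u}_h,\mathbf{v}_h\in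 V_h$ and $q_h\in Q_h$, on every mesh of the family satisfying $\hat h_{\tilde\Gamma_D}\le\hat h_0$ in the symmetric-gradient case, and on every mesh of the family, without such a restriction, in the regular-gradient case $\boldsymbol{\nabla}_s=\frac12\nabla$.
   Context: **Geometry.** $\Omega\subset\mathbb{R}^d$ is a bounded domain covered by a shape-regular family of background meshes of quadrilaterals/hexahedra that need not fit the boundary. The active elements are those lying inside $\Omega$; their union is the surrogate domain $\Omega'$ (also written $\tilde\Omega$). $\Gamma'\subset\partial\Omega'$ is the surrogate boundary: the union of the element faces which replace the embedded Dirichlet boundary $\Gamma_D$; its outward unit normal is $\mathbf{n}'$. Each $\tilde{\mathbf{x}}\in\Gamma'$ is mapped to its closest-point projection on the true boundary, and $\mathbf{d}(\tilde{\mathbf{x}})$ is the vector from $\tilde{\mathbf{x}}$ to that projection. $h_T$ is the diameter of an element $T$, $h=\max_T h_T$, $l(\tilde\Omega)$ is a characteristic length of $\Omega'$ (e.g. its diameter), $\hat h_T=h_T/l(\tilde\Omega)$ (with $\hat h_T\le1$). $\langle\cdot,\cdot\rangle$ denotes the $L^2(\Gamma')$ inner product. **Spaces and extensions.** $V_h\subset[H^1(\Omega')]^d$ is a space of continuous, elementwise polynomial velocities of fixed degree, $Q_h\subset L^2(\Omega')$ a space of (continuous or discontinuous) elementwise polynomial pressures of fixed degree. For $\tilde{\mathbf{x}}\in\Gamma'$ on a face of the active element $T$, $\mathbf{u}^F(\tilde{\mathbf{x}})=\mathbf{u}|_T(\tilde{\mathbf{x}}+\mathbf{d}(\tilde{\mathbf{x}}))$,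 where the polynomial $\mathbf{u}|_T$ is continued outside $T$ as a polynomial, and $\mathbf{v}^T=\mathbf{v}+(\nabla\mathbf{v})\mathbf{d}$ on $\Gamma'$, with $(\nabla\mathbf{v})_{ij}=\partial_jv_i$ taken from $T$. **Forms.** $\mu>0$ is the constant viscosity, $\alpha>0$ the Nitsche penalty. $\boldsymbol{\nabla}_s$ is either the symmetric gradient $\varepsilon(\mathbf{u})=\frac12(\nabla\mathbf{u}+\nabla\mathbf{u}^T)$ or the regular gradient $\frac12\nabla\mathbf{u}$ (the same choice throughout). Then $$a(\mathbf{u},\mathbf{v})=\int_{\Omega'}2\mu\,\boldsymbol{\nabla}_s\mathbf{u}:\nabla\mathbf{v}\,dx-\langle2\mu(\boldsymbol{\nabla}_s\mathbf{u})\mathbf{n}',\mathbf{v}\rangle-\langle2\mu(\boldsymbol{\nabla}_s\mathbf{v})\mathbf{n}',\mathbf{u}^F\rangle+\langle\alpha\,\mathbf{u}^F,\mathbf{v}^T\rangle,$$ $$b_1(\mathbf{v},q)=-\int_{\Omega'}(\nabla\cdot\mathbf{v})q\,dx+\langle\mathbf{n}'\cdot\mathbf{v},q\rangle,\qquad b_2(\mathbf{v},q)=-\int_{\Omega'}(\nabla\cdot\mathbf{v})q\,dx+\langle\mathbf{n}'\cdot\mathbf{v}^F,q\rangle.$$ **Norms.** $\|q\|_Q=\|q/\sqrt{2\mu}\|_{L^2(\Omega')}$. $\|\cdot\|_a$ is the energy norm of the SBM–Stokes analysis of Atallah, Canuto and Scovazzi (2020) on $V_h$; it is equivalent (not necessarily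 uniformly in $h$) to the $H^1$-norm on $V_h$ and has the viscous seminorm and the Taylor-extended trace among its constituents: for all $\mathbf{v}\in V_h$, $\sqrt{2\mu}\,\|\varepsilon(\mathbf{v})\|_{L^2(\Omega')}\le\|\mathbf{v}\|_a$ (in the regular-gradient case $\sqrt{2\mu}\,\|\nabla\mathbf{v}\|_{L^2(\Omega')}\le\|\mathbf{v}\|_a$) and $\|(2\mu/h_T)^{1/2}\mathbf{v}^T\|_{L^2(\Gamma')}\le\|\mathbf{v}\|_a$, with $h_T$ taken facewise. *)

(* Defs.v *)
From HB Require Import structures.
From mathcomp Require Import all_boot all_order all_algebra.
From mathcomp Require Import -(notations) mpoly.
From mathcomp Require Import all_classical all_reals all_analysis.
Set Implicit Arguments.
Unset Strict Implicit.
Unset Printing Implicit Defensive.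
Import Order.TTheory GRing.Theory Num.Theory numFieldNormedType.Exports.
Local Open Scope classical_set_scope.
Local Open Scope ring_scope.

(* n-dimensional Lebesgue measure, carried by n.-tuple R (which has a product
   sigma-algebra in the library, unlike 'rV[R]_n): the product of n copies of
   the one-dimensional Lebesgue measure. *)
Section lebesgue_tuple.
Context {R : realType}.
Local Notation RR := (measurableTypeR R).
Local Open Scope ereal_scope.

Definition tuple_cons n (p : RR * n.-tuple RR) : n.+1.-tuple RR :=
  [tuple of p.1 :: p.2].

Lemma measurable_tuple_cons n : measurable_fun [set: _] (@tuple_cons n).
Proof. exact: measurable_cons. Qed.

Section step.
Variables (n : nat) (m : {sigma_finite_measure set (n.-tuple RR) -> \bar R}).

Definition lebesgue_cons (A : set (n.+1.-tuple RR)) : \bar R :=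
  (@lebesgue_measure R \x m) (@tuple_cons n @^-1` A).

Let preim_cons_meas (A : set (n.+1.-tuple RR)) :
  measurable A -> measurable (@tuple_cons n @^-1` A).
Proof.
by move=> mA; rewrite -[X in measurable X]setTI; exact: measurable_tuple_cons.
Qed.

Let lebesgue_cons0 : lebesgue_cons set0 = 0.
Proof. by rewrite /lebesgue_cons preimage_set0 measure0. Qed.

Let lebesgue_cons_ge0 A : 0 <= lebesgue_cons A.
Proof. exact: measure_ge0. Qed.

Let lebesgue_cons_sigma_additive : semi_sigma_additive lebesgue_cons.
Proof.
move=> F mF tF mUF; rewrite /lebesgue_cons preimage_bigcup.
apply: measure_semi_sigma_additive.
- by move=> k; exact: preim_cons_meas.
- apply/trivIsetP => /= i j _ _ ij; rewrite -preimage_setI.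
  by move/trivIsetP : tF => /(_ _ _ _ _ ij) ->//; rewrite preimage_set0.
- by rewrite -preimage_bigcup; exact: preim_cons_meas.
Qed.

HB.instance Definition _ := isMeasure.Build _ _ _ lebesgue_cons
  lebesgue_cons0 lebesgue_cons_ge0 lebesgue_cons_sigma_additive.

Let uncons (t : n.+1.-tuple RR) : RR * n.-tuple RR :=
  (thead t, [tuple of behead t]).

Let tuple_consK : cancel (@tuple_cons n) uncons.
Proof. by case=> x t; rewrite /uncons /tuple_cons; congr (_, _); apply: val_inj. Qed.

Let measurable_uncons : measurable_fun [set: _] uncons.
Proof.
apply/measurable_fun_pairP; split; last exact: measurable_behead.
exact: measurable_tnth.
Qed.

Let lebesgue_cons_sigma_finite : sigma_finite [set: _] lebesgue_cons.
Proof.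
have /sigma_finiteP[F [TF ndF Foo]] := sigma_finiteT (@lebesgue_measure R).
have /sigma_finiteP[G [TG ndG Goo]] := sigma_finiteT m.
exists (fun k => uncons @^-1` (F k `*` G k)).
  rewrite -preimage_bigcup (_ : \bigcup_k (F k `*` G k) = setT)//.
  rewrite -setXTT TF TG; apply/seteqP; split=> [[x y] [k _ [/= Fx Gy]]|].
    by split; exists k.
  move=> [x y] [[/= k _ Fx] [/= l _ Gy]]; exists (maxn k l) => //; split.
  - by move: x Fx; exact/subsetPset/ndF/leq_maxl.
  - by move: y Gy; exact/subsetPset/ndG/leq_maxr.
move=> k; have [mF Fk] := Foo k; have [mG Gk] := Goo k; split.
  rewrite -[X in measurable X]setTI; apply: measurable_uncons => //.
  exact: measurableX.
rewrite /lebesgue_cons (_ : _ @^-1` _ = F k `*` G k).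
  by rewrite product_measure1E// lte_mul_pinfty// ge0_fin_numE.
by rewrite -comp_preimage (_ : uncons \o _ = id)//; apply/funext/tuple_consK.
Qed.

HB.instance Definition _ := Measure_isSigmaFinite.Build _ _ _ lebesgue_cons
  lebesgue_cons_sigma_finite.

End step.

Fixpoint lebesgue_tuple n : {sigma_finite_measure set (n.-tuple RR) -> \bar R} :=
  match n with
  | 0%N => \d_([tuple] : 0.-tuple RR)
  | n'.+1 => lebesgue_cons (lebesgue_tuple n')
  end.

Lemma lebesgue_tuple_box n (A : 'I_n -> set RR) :
  (forall i, measurable (A i)) ->
  lebesgue_tuple n [set t | forall i, A i (tnth t i)] =
  \prod_(i < n) @lebesgue_measure R (A i).
Proof.
elim: n A => [|n IHn] A mA.
  by rewrite big_ord0 /= diracE mem_set// => -[].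
rewrite big_ord_recl -IHn// -product_measure1E//=; last first.
  rewrite (_ : [set t | _] = \bigcap_(i in [set: 'I_n])
      (tnth (T := RR))^~ i @^-1` A (lift ord0 i)); last first.
    by apply/seteqP; split => t /= H i; [move=> _; exact: H|exact: H].
  apply: fin_bigcap_measurable; first by apply: (@finite_finset 'I_n [set: _]).
  by move=> i _; rewrite -[X in measurable X]setTI; exact: measurable_tnth.
rewrite /lebesgue_cons; congr ((_ \x _)%E _); apply/seteqP; split => -[x t] /=.
  move=> H; split; first exact: (H ord0).
  by move=> i; have := H (lift ord0 i); rewrite tnthS.
move=> [Hx Ht] i; have [->|[j ->]] : i = ord0 \/ exists j, i = lift ord0 j.
  by case: (unliftP ord0 i) => [j ->|->]; [right; exists j|left].
- exact: Hx.
- by rewrite tnthS.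
Qed.

End lebesgue_tuple.

Section euclidean.
Variable R : realType.

Definition rv_of_tuple n (t : n.-tuple R) : 'rV[R]_n := \row_i tnth t i.

Definition rv_integral n (A : set 'rV[R]_n) (f : 'rV[R]_n -> R) : R :=
  Rintegral (lebesgue_tuple n) [set t | A (rv_of_tuple t)]
    (fun t => f (rv_of_tuple t)).

Definition dot n (x y : 'rV[R]_n) : R := \sum_i x 0 i * y 0 i.

(* The library norm on 'rV[R]_n is the max norm. *)
Definition enorm n (x : 'rV[R]_n) : R := Num.sqrt (dot x x).

Definition frob n (A B : 'M[R]_n) : R := \sum_i \sum_j A i j * B i j.

Definition diam n (A : set 'rV[R]_n) : R :=
  sup [set r | exists x y, [/\ A x, A y & r = enorm (x - y)]].

Definition bdry n (A : set 'rV[R]_n) : set 'rV[R]_n := closure A `\` A°.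

Definition bounded_domain n (A : set 'rV[R]_n) : Prop :=
  [/\ A !=set0, open A, connected A & bounded_set A].

End euclidean.

(* Quadrilaterals (d = 2) and hexahedra (d = 3), given by their 2^d vertices:
   the vertex V c is the image of the corner c of the reference cube, and the
   element is the image of [0,1]^d under the d-linear interpolant of V.  Faces
   of hexahedra may be curved (bilinear). *)
Section element.
Variables (R : realType) (d : nat).
Implicit Types (V : {ffun 'I_d -> bool} -> 'rV[R]_d) (j : 'I_d) (s : bool).

Definition ref_cube : set 'rV[R]_d := [set x | forall i, 0 <= x 0 i <= 1].

Definition ref_face j s : set 'rV[R]_d :=
  [set x | ref_cube x /\ x 0 j = s%:R].

Definition ref_map V (x : 'rV[R]_d) : 'rV[R]_d :=
  \sum_(c : {ffun 'I_d -> bool})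
    (\prod_i (if c i then x 0 i else 1 - x 0 i)) *: V c.

Definition elt V : set 'rV[R]_d := ref_map V @` ref_cube.

Definition elt_face V j s : set 'rV[R]_d := ref_map V @` ref_face j s.

(* Row r of [jacobian f x] is the partial derivative of f along axis r.
   J^-1 e_j is orthogonal to every row of J = jacobian (ref_map V) x except
   row j, and has inner product 1 with row j, which points outwards on the
   face x_j = 1 and inwards on x_j = 0; see [outer_normalP]. *)
Definition outer_normal V j s (x : 'rV[R]_d) : 'rV[R]_d :=
  let m := (-1) ^+ (~~ s) *: (col j (invmx (jacobian (ref_map V) x)))^T in
  (enorm m)^-1 *: m.

Lemma outer_normalP V j s x (J := jacobian (ref_map V) x) :
  J \in unitmx ->
  [/\ enorm (outer_normal V j s x) = 1,
      forall r, r != j -> dot (row r J) (outer_normal V j s x) = 0 &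
      0 < (-1) ^+ (~~ s) * dot (row j J) (outer_normal V j s x)].
Proof.
move=> Ju; set n := outer_normal V j s x.
pose w : 'rV[R]_d := (col j (invmx J))^T.
have dotw r : dot (row r J) w = (r == j)%:R.
  have -> : dot (row r J) w = (J *m invmx J) r j.
    by rewrite !mxE; apply: eq_bigr => k _; rewrite !mxE.
  by rewrite mulmxV// mxE.
have w0 : w != 0.
  apply/eqP => we; have := dotw j; rewrite we eqxx /dot big1.
    by move/esym/eqP; rewrite oner_eq0.
  by move=> k _; rewrite [X in _ * X]mxE mulr0.
have dotZ (y z : 'rV[R]_d) a : dot y (a *: z) = a * dot y z.
  by rewrite /dot mulr_sumr; apply: eq_bigr => k _; rewrite mxE mulrCA.
have dotZl (y z : 'rV[R]_d) a : dot (a *: y) z = a * dot y z.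
  by rewrite /dot mulr_sumr; apply: eq_bigr => k _; rewrite mxE mulrA.
have ww : 0 < dot w w.
  have ge0 k : 0 <= w 0 k * w 0 k by rewrite -expr2 sqr_ge0.
  rewrite lt_neqAle sumr_ge0// andbT; apply: contra w0 => /eqP/esym/eqP.
  rewrite psumr_eq0// => /allP h; apply/eqP/rowP => k; rewrite [RHS]mxE.
  by have /eqP/eqP := h k (mem_index_enum _); rewrite mulf_eq0 orbb => /eqP.
have sgn : (-1) ^+ (~~ s) * (-1) ^+ (~~ s) = 1 :> R.
  by rewrite -expr2 sqrr_sign.
have nE : n = ((enorm w)^-1 * (-1) ^+ (~~ s)) *: w.
  rewrite /n /outer_normal -/J -/w scalerA; congr (_ ^-1 * _ *: _).
  by rewrite /enorm dotZl dotZ mulrA sgn mul1r.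
have ew : 0 < enorm w by rewrite sqrtr_gt0.
split.
- have dwE : dot w w = enorm w ^+ 2 by rewrite sqr_sqrtr// ltW.
  rewrite {1}/enorm nE dotZl dotZ mulrA mulrACA sgn mulr1 -invfM -expr2 dwE.
  by rewrite mulVf ?sqrtr1// expf_neq0// lt0r_neq0.
- by move=> r rj; rewrite nE dotZ dotw (negPf rj) mulr0.
- by rewrite nE dotZ dotw eqxx mulr1 mulrCA sgn mulr1 invr_gt0.
Qed.

Definition face_param j s (y : d.-1.-tuple R) : 'rV[R]_d :=
  \row_i (if unlift j i is Some k then tnth y k else s%:R).

Definition face_cube : set (d.-1.-tuple R) :=
  [set y | forall k, 0 <= tnth y k <= 1].

(* Surface integral over a face of the function x |-> g n x, where n is the
   outward unit normal at x; the density is the square root of the Gram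
   determinant of the tangent vectors of the parametrisation. *)
Definition face_integral V j s (g : 'rV[R]_d -> 'rV[R]_d -> R) : R :=
  Rintegral (lebesgue_tuple d.-1) face_cube (fun y =>
    let x := face_param j s y in
    let B := row' j (jacobian (ref_map V) x) in
    g (outer_normal V j s x) (ref_map V x) * Num.sqrt (\det (B *m B^T))).

End element.
Arguments ref_cube {R d}.
Arguments ref_face {R d}.
Arguments face_cube {R d}.
Arguments face_param {R d}.

(* Polynomial fields on R^d; evaluating them off an element is the polynomial
   continuation of the restriction to that element. *)
Section fields.
Variables (R : realType) (d : nat).
Implicit Types (p : mpoly d R) (v : {ffun 'I_d -> mpoly d R}) (x : 'rV[R]_d).

Definition pev p x : R := meval (fun i => x 0 i) p.

Definition vev v x : 'rV[R]_d := \row_i pev (v i) x.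

Definition vgrad v x : 'M[R]_d := \matrix_(i, j) pev (mderiv j (v i)) x.

Definition vdiv v x : R := \sum_i pev (mderiv i (v i)) x.

Definition symgrad v x : 'M[R]_d := 2^-1 *: (vgrad v x + (vgrad v x)^T).

(* [sym] selects the symmetric gradient, [~~ sym] half the regular one. *)
Definition visc_grad (sym : bool) v x : 'M[R]_d :=
  if sym then symgrad v x else 2^-1 *: vgrad v x.

Definition extF (delta : 'rV[R]_d -> 'rV[R]_d) v x : 'rV[R]_d :=
  vev v (x + delta x).

(* Vectors are rows, so (grad v) d is written d *m (grad v)^T. *)
Definition extT (delta : 'rV[R]_d -> 'rV[R]_d) v x : 'rV[R]_d :=
  vev v x + delta x *m (vgrad v x)^T.

End fields.

(* Piecewise polynomial fields on a mesh with N elements. *)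
Definition velocity (R : realType) (d N : nat) :=
  {ffun 'I_N -> {ffun 'I_d -> mpoly d R}}.
Definition pressure (R : realType) (d N : nat) := {ffun 'I_N -> mpoly d R}.

(* All data attached to one mesh.  A face (T, (j, s)) is the image of the
   reference face x_j = s of the element T. *)
Record sbm (R : realType) (d : nat) := SBM {
  nelt : nat;
  vtx : 'I_nelt -> {ffun 'I_d -> bool} -> 'rV[R]_d;
  active : {set 'I_nelt};
  sfaces : {set 'I_nelt * ('I_d * bool)};       (* faces forming Gamma' *)
  delta : 'rV[R]_d -> 'rV[R]_d;                 (* the distance vector d *)
  clen : R;                                     (* l(Omega') *)
  penalty : 'I_nelt * ('I_d * bool) -> 'rV[R]_d -> R;   (* alpha *)
  Vh : set (velocity R d nelt);
  Qh : set (pressure R d nelt);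
  norm_a : velocity R d nelt -> R }.

Arguments delta {R d} s _.
Arguments penalty {R d} s _ _.
Arguments Vh {R d} s _.
Arguments Qh {R d} s _.
Arguments norm_a {R d} s _.

Section discretisation.
Variables (R : realType) (d : nat) (M : sbm R d).
Local Notation face := ('I_(nelt M) * ('I_d * bool))%type.
Local Notation V := (velocity R d (nelt M)).
Local Notation Q := (pressure R d (nelt M)).

Definition cell (T : 'I_(nelt M)) : set 'rV[R]_d := elt (vtx T).

Definition face_set (F : face) : set 'rV[R]_d :=
  elt_face (vtx F.1) F.2.1 F.2.2.

Definition surrogate_dom : set 'rV[R]_d := \bigcup_(T in [set` active M]) cell T.

Definition surrogate_bdry : set 'rV[R]_d :=
  \bigcup_(F in [set` sfaces M]) face_set F.

Definition hT (T : 'I_(nelt M)) : R := diam (cell T).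

Definition hhat (T : 'I_(nelt M)) : R := hT T / clen M.

Definition hhat_bdry : R :=
  \big[Num.max/0]_(T in active M |
      `[< bdry (cell T) `&` surrogate_bdry !=set0 >]) hhat T.

(* The integrands on Omega' and Gamma' are defined element by element (and
   multivalued on the skeleton), so integrals are sums over elements and faces. *)
Definition bulk (f : 'I_(nelt M) -> 'rV[R]_d -> R) : R :=
  \sum_(T in active M) rv_integral (cell T) (f T).

Definition surf (g : face -> 'rV[R]_d -> 'rV[R]_d -> R) : R :=
  \sum_(F in sfaces M) face_integral (vtx F.1) F.2.1 F.2.2 (g F).

Definition form_a (mu : R) (sym : bool) (u v : V) : R :=
  bulk (fun T x => 2 * mu * frob (visc_grad sym (u T) x) (vgrad (v T) x))
  - surf (fun F n x => dot ((2 * mu) *: (n *m (visc_grad sym (u F.1) x)^T))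
                           (vev (v F.1) x))
  - surf (fun F n x => dot ((2 * mu) *: (n *m (visc_grad sym (v F.1) x)^T))
                           (extF (delta M) (u F.1) x))
  + surf (fun F n x => dot (penalty M F x *: extF (delta M) (u F.1) x)
                           (extT (delta M) (v F.1) x)).

Definition form_b1 (v : V) (q : Q) : R :=
  - bulk (fun T x => vdiv (v T) x * pev (q T) x)
  + surf (fun F n x => dot n (vev (v F.1) x) * pev (q F.1) x).

Definition form_b2 (v : V) (q : Q) : R :=
  - bulk (fun T x => vdiv (v T) x * pev (q T) x)
  + surf (fun F n x => dot n (extF (delta M) (v F.1) x) * pev (q F.1) x).

Definition norm_Q (mu : R) (q : Q) : R :=
  Num.sqrt (bulk (fun T x => (pev (q T) x / Num.sqrt (2 * mu)) ^+ 2)).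

Definition norm_H1 (v : V) : R :=
  Num.sqrt (bulk (fun T x => dot (vev (v T) x) (vev (v T) x)
                             + frob (vgrad (v T) x) (vgrad (v T) x))).

Definition norm_grad (v : V) : R :=
  Num.sqrt (bulk (fun T x => frob (vgrad (v T) x) (vgrad (v T) x))).

Definition norm_symgrad (v : V) : R :=
  Num.sqrt (bulk (fun T x => frob (symgrad (v T) x) (symgrad (v T) x))).

Definition norm_traceT (mu : R) (v : V) : R :=
  Num.sqrt (surf (fun F n x =>
    dot (Num.sqrt (2 * mu / hT F.1) *: extT (delta M) (v F.1) x)
        (Num.sqrt (2 * mu / hT F.1) *: extT (delta M) (v F.1) x))).

(* Non-overlapping nondegenerate elements covering Omega; hanging nodes are
   allowed. *)
Definition background_mesh (Omega : set 'rV[R]_d) : Prop :=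
  [/\ forall T : 'I_(nelt M), {in ref_cube &, injective (ref_map (vtx T))},
      forall T T' : 'I_(nelt M), T != T' -> (cell T)° `&` (cell T')° = set0 &
      Omega `<=` \bigcup_T cell T].

(* Shape regularity with constant sigma: the differential D of every reference
   map satisfies |D| <= sigma h_T and |D^-1| <= sigma / h_T on the reference
   cube. *)
Definition shape_regular (sigma : R) : Prop :=
  forall (T : 'I_(nelt M)) (x w : 'rV[R]_d), ref_cube x ->
    let Dw := w *m jacobian (ref_map (vtx T)) x in
    enorm Dw <= sigma * hT T * enorm w /\
    hT T * enorm w <= sigma * enorm Dw.

(* The active elements are those inside Omega; Gamma' consists of faces of
   active elements lying on the boundary of Omega', and each of its points x is
   mapped to a closest point x + delta x of GammaD. The projection need not be
   unique, so the measurability of the selected delta is required. *)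
Definition surrogate_geometry (Omega GammaD : set 'rV[R]_d) : Prop :=
  [/\ forall T : 'I_(nelt M), T \in active M <-> cell T `<=` closure Omega,
      forall F : face, F \in sfaces M ->
        F.1 \in active M /\ face_set F `<=` bdry surrogate_dom,
      forall x, surrogate_bdry x -> GammaD (x + delta M x) /\
        forall y, GammaD y -> enorm (delta M x) <= enorm (y - x),
      forall (F : face) (i : 'I_d), F \in sfaces M ->
        measurable_fun (face_cube : set (d.-1.-tuple (measurableTypeR R)))
          (fun y => delta M (ref_map (vtx F.1)
                               (face_param F.2.1 F.2.2 y)) 0 i) &
      0 < clen M /\ forall T : 'I_(nelt M), T \in active M -> hT T <= clen M].

Definition nitsche_penalty : Prop :=
  forall F : face, F \in sfaces M ->
    (forall x, face_set F x -> 0 < penalty M F x) /\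
    measurable_fun (face_cube : set (d.-1.-tuple (measurableTypeR R)))
      (fun y => penalty M F (ref_map (vtx F.1)
                             (face_param F.2.1 F.2.2 y))).

(* Fields carry one polynomial per element; those of inactive elements play no
   role and are normalised to 0.  Degrees are total degrees, msize being one
   more than the degree. *)
Definition velocity_space (k : nat) : Prop :=
  [/\ Vh M 0,
      forall (c : R) (u v : V), Vh M u -> Vh M v -> Vh M (c *: u + v),
      forall (v : V) T, Vh M v -> T \notin active M -> v T = 0,
      forall (v : V) T i, Vh M v -> (msize (v T i) <= k.+1)%N &
      forall (v : V) T T' x, Vh M v -> T \in active M -> T' \in active M ->
        cell T x -> cell T' x -> vev (v T) x = vev (v T') x].

Definition pressure_space (k : nat) : Prop :=
  [/\ Qh M 0,
      forall (c : R) (p q : Q), Qh M p -> Qh M q -> Qh M (c *: p + q),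
      forall (q : Q) T, Qh M q -> T \notin active M -> q T = 0 &
      forall (q : Q) T, Qh M q -> (msize (q T) <= k.+1)%N].

(* A norm on V_h, equivalent to the H^1 norm with mesh-dependent constants,
   that bounds the viscous seminorm and the Taylor-extended trace. *)
Definition energy_norm (mu : R) (sym : bool) : Prop :=
  [/\ forall u v : V, Vh M u -> Vh M v ->
        norm_a M (u + v) <= norm_a M u + norm_a M v,
      forall (c : R) (v : V), Vh M v -> norm_a M (c *: v) = `|c| * norm_a M v,
      exists c1 c2 : R, [/\ 0 < c1, 0 < c2 & forall v : V, Vh M v ->
        c1 * norm_H1 v <= norm_a M v /\ norm_a M v <= c2 * norm_H1 v],
      forall v : V, Vh M v ->
        Num.sqrt (2 * mu) * (if sym then norm_symgrad v else norm_grad v)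
          <= norm_a M v &
      forall v : V, Vh M v -> norm_traceT mu v <= norm_a M v].

Definition distance_bound (c_d zeta : R) : Prop :=
  forall (F : face) (x : 'rV[R]_d), F \in sfaces M -> face_set F x ->
    enorm (delta M x) <= c_d * hT F.1 * hhat F.1 `^ zeta.

Definition penalty_bound (mu c_alpha : R) : Prop :=
  forall (F : face) (x : 'rV[R]_d), F \in sfaces M -> face_set F x ->
    penalty M F x <= c_alpha * (2 * mu) / hT F.1.

End discretisation.

(* Main.v *)
Require Import Defs.
From HB Require Import structures.
From mathcomp Require Import all_boot all_order all_algebra.
From mathcomp Require Import -(notations) mpoly.
From mathcomp Require Import perm polyrcf.
From mathcomp Require Import all_classical all_reals all_analysis.
From mathcomp Require Import measurable_realfun.
From mathcomp Require Import ring lra.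
Set Implicit Arguments.
Unset Strict Implicit.
Unset Printing Implicit Defensive.
Import Order.TTheory GRing.Theory Num.Theory numFieldNormedType.Exports.
Local Open Scope classical_set_scope.
Local Open Scope ring_scope.

(** The bulk part of a is symmetric, so a(u,v) - a(v,u) is a sum over the faces
    of Gamma'.  On each face the consistency terms combine into the defects
    u^F - u and v^F - v tested against viscous tractions, and the penalty terms,
    after the symmetric part (u^T, v^T) has cancelled, into u^F - u^T and
    v^F - v^T tested against v^T and u^T.  By the mean value theorem along the
    distance vector each defect is, up to a constant, at most |d| times a bound
    G of the gradient near the face, and |d| <= c_d h hhat^zeta.  Likewise
    b1 - b2 is the defect v - v^F tested against q.  Everything thus reduces to
    estimates on one element T of size h, with constants that depend on the
    dimension, the shape regularity, the polynomial degrees, c_d and c_alpha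
    only:

    - Inverse estimate ([elt_inverse]): a polynomial and its gradient, in a
      neighbourhood of T of size proportional to h, are bounded by the mean
      square of the polynomial on T.  The element contains a box of side
      proportional to h ([inner_box]), and on a box a polynomial is controlled by
      its values on a grid ([seppoly_grid]) and is large on a fixed fraction of
      the box when it is large somewhere ([seppoly_L2]).

    - Area element ([density_bounds]): the area element of a face, relative to
      the unit cube, lies between constant multiples of h^(d-1).

    - Gradient bound ([grad_control]): h^d G^2 is bounded by the local energy,
      the integral of the squared viscous gradient over T plus 1/h times that of
      |v^T|^2 over the face.  For the regular gradient this is the inverse
      estimate.  For the symmetric gradient it is a local Korn inequality
      ([korn_local]): v differs from a rigid motion by a multiple of h times its
      symmetric gradient, and a rigid motion is determined by its trace on a
      face, since a skew matrix that vanishes along a hyperplane vanishes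
      ([skew_small]).  As v^T differs from the trace by (grad v) d, the rotation
      reappears with the factor hhat^zeta and has to be absorbed, and this is
      why the symmetric case has a threshold.

    With h^(d-1) for the area, the powers of h cancel ([local_a_bound],
    [local_b_bound]).  Cauchy-Schwarz over the faces of Gamma' then gives the
    energy norms: multiplied by 2 mu, the local energies add up to at most
    2d + 1 times the squared norm ([sum_energy]). *)

(** * Polynomials in one variable and their values at nodes *)

Section poly1.
Variable R : realType.
Implicit Types (q : {poly R}) (m r t : R).

Lemma poly_lip q (L t u : R) :
  (forall s, Num.min t u <= s <= Num.max t u -> `|q^`().[s]| <= L) ->
  `|q.[t] - q.[u]| <= L * `|t - u|.
Proof.
wlog tu : t u / t < u => [H|].
  have [->|] := eqVneq t u; first by rewrite !subrr normr0 mulr0.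
  rewrite neq_lt => /orP[tu|ut]; first exact: H.
  by rewrite minC maxC distrC (distrC t); exact: H.
rewrite (min_idPl (ltW tu)) (max_idPr (ltW tu)) => hL.
have [c /itvP ctu E] := poly_mvt q tu.
rewrite distrC E normrM (distrC t); apply: ler_wpM2r => //.
by apply: hL; rewrite !ctu.
Qed.

(** The denominator k + 1 leaves room in [0, 1] for an interval of length
    1 / (k + 1) to the right of each of the k + 1 nodes. *)
Definition node k (i : nat) : R := i%:R / k.+1%:R.

Lemma node_itv k i : (i <= k)%N -> 0 <= node k i <= 1.
Proof.
move=> ik; rewrite /node divr_ge0//= ler_pdivrMr ?ltr0n// mul1r ler_nat.
exact: leq_trans ik _.
Qed.

Lemma node_succ k i : (i <= k)%N -> node k i + k.+1%:R^-1 <= 1.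
Proof.
move=> ik; rewrite /node -{2}[k.+1%:R^-1]mul1r -mulrDl ler_pdivrMr ?ltr0n// mul1r.
by rewrite natr1 ler_nat.
Qed.

(** Newton interpolation as an induction: subtracting the value at the last node
    and dividing by the linear factor lowers the degree and keeps the values at
    the other nodes bounded; the derivative follows by the product rule. *)
Lemma poly_bound_nodes (delta r : R) n : 0 < delta -> 0 <= r -> exists2 C : R, 1 <= C &
  forall (z : nat -> R) q m, 
    (forall i, (i <= n)%N -> `|z i| <= r) ->
    (forall i j, (i < j)%N -> (j <= n)%N -> delta <= `|z i - z j|) ->
    (size q <= n.+1)%N -> (forall i, (i <= n)%N -> `|q.[z i]| <= m) ->
    forall t, `|t| <= r -> `|q.[t]| <= C * m /\ `|q^`().[t]| <= C * m.
Proof.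
move=> d0 r0; elim: n => [|n [C C1 IH]].
  exists 1 => // z q m _ _ /size1_polyC -> qm t _; rewrite derivC !hornerC.
  have := qm 0%N isT; rewrite hornerC normr0 mul1r => qm'; split=> //.
  exact: le_trans qm'.
have C0 : 0 <= C by exact: le_trans C1.
exists (1 + (2 * r + 1) * (C * (2 / delta))).
  by rewrite lerDl !mulr_ge0 ?addr_ge0 ?mulr_ge0 ?invr_ge0// ltW.
move=> z q m zr zd sq qm t tr.
have m0 : 0 <= m by apply: le_trans (qm 0%N isT).
have /factor_theorem[p pE] : root (q - q.[z n.+1]%:P) (z n.+1).
  by rewrite rootE !hornerE subrr.
have qE : q = p * ('X - (z n.+1)%:P) + q.[z n.+1]%:P by rewrite -pE subrK.
have sp : (size p <= n.+1)%N.
  have [->|p0] := eqVneq p 0; first by rewrite size_poly0.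
  have : (size (q - q.[z n.+1]%:P)%R <= n.+2)%N.
    rewrite (leq_trans (size_polyD _ _))// geq_max sq size_polyN.
    by rewrite (leq_trans (size_polyC_leq1 _)).
  by rewrite pE size_Mmonic ?monicXsubC// size_XsubC addn2.
have pm i : (i <= n)%N -> `|p.[z i]| <= 2 / delta * m.
  move=> ni; have := zd i n.+1 ni (leqnn _); set w := z i - _ => wd.
  have w0 : 0 < `|w| by exact: lt_le_trans wd.
  have -> : p.[z i] = (q.[z i] - q.[z n.+1]) / w.
    rewrite [in q.[z i]]qE !hornerE addrK mulfK//.
    by rewrite -normr_gt0.
  rewrite normrM normfV ler_pdivrMr// (@le_trans _ _ (2 * m))//.
    rewrite (le_trans (ler_normB _ _))// mulr2n mulrDl mul1r lerD// qm//.
    exact: leqW.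
  rewrite (_ : 2 / delta * m * `|w| = (2 * m) * (`|w| / delta)); last by ring.
  by rewrite ler_peMr ?mulr_ge0// ler_pdivlMr// mul1r.
have [||ht hdt] := IH z p (2 / delta * m) _ _ sp pm t tr.
- by move=> i ni; apply: zr; exact: leqW.
- by move=> i j ij jn; apply: zd => //; exact: leqW.
have M0 : 0 <= C * (2 / delta * m) by rewrite !mulr_ge0 ?invr_ge0// ltW.
have tz : `|t - z n.+1| <= 2 * r.
  by rewrite (le_trans (ler_normB _ _))// mulr2n mulrDl mul1r lerD// zr.
have zm : `|q.[z n.+1]| <= m by exact: qm.
set K := C * (2 / delta * m) in ht hdt M0.
set B := (1 + _) * m; have BE : B = m + 2 * r * K + K by rewrite /B /K; ring.
clearbody B.
have hprod : `|t - z n.+1| * `|p^`().[t]| <= 2 * r * K by rewrite ler_pM.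
have hprod0 : `|t - z n.+1| * `|p.[t]| <= 2 * r * K by rewrite ler_pM.
split.
  rewrite [in q.[t]]qE !hornerE (le_trans (ler_normD _ _))// normrM mulrC.
  by lra.
rewrite qE derivD derivM derivXsubC derivC addr0 !hornerE ?(subr0, mulr1, addr0) (le_trans (ler_normD _ _))//.
by rewrite normrM mulrC; lra.
Qed.

End poly1.

(** * Functions polynomial in each coordinate *)

Section coordinates.
Variables (R : realType) (n : nat).
Implicit Types (x y : 'rV[R]_n) (f : 'rV[R]_n -> R).

Definition upd x (l : 'I_n) (t : R) : 'rV[R]_n :=
  \row_i (if i == l then t else x 0 i).

Lemma upd_id x l : upd x l (x 0 l) = x.
Proof. by apply/rowP => i; rewrite mxE; case: eqP => [->|]. Qed.

Lemma updE x l t i : upd x l t 0 i = if i == l then t else x 0 i.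
Proof. by rewrite mxE. Qed.

Lemma upd_upd x l t u : upd (upd x l t) l u = upd x l u.
Proof. by apply/rowP => i; rewrite !mxE; case: eqP. Qed.

(** The path from x to y that changes one coordinate at a time stays in the box. *)
Lemma coord_lip (A : 'I_n -> set R) f (L : R) : 0 <= L ->
  (forall x l t, (forall i, A i (x 0 i)) -> A l t ->
    `|f (upd x l t) - f x| <= L * `|t - x 0 l|) ->
  forall x y, (forall i, A i (x 0 i)) -> (forall i, A i (y 0 i)) ->
    `|f y - f x| <= L * \sum_i `|y 0 i - x 0 i|.
Proof.
move=> L0 fL x y Ax Ay.
pose h (s : seq 'I_n) : 'rV[R]_n := \row_i (if i \in s then y 0 i else x 0 i).
have Ah s i : A i (h s 0 i) by rewrite mxE; case: ifP.
have hs s : `|f (h s) - f x| <= L * \sum_(i <- s) `|y 0 i - x 0 i|.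
  elim: s => [|i s IH].
    rewrite big_nil mulr0 (_ : h [::] = x) ?subrr ?normr0//.
    by apply/rowP => i; rewrite mxE.
  rewrite big_cons mulrDr (_ : h (i :: s) = upd (h s) i (y 0 i)); last first.
    by apply/rowP => j; rewrite !mxE inE; case: (j =P i) => [->|].
  rewrite (le_trans (ler_distD (f (h s)) _ _))// lerD//.
  rewrite (le_trans (fL _ _ _ _ _))// ler_wpM2l// mxE.
  by case: ifP => _; rewrite ?subrr ?normr0.
have hy : h (index_enum 'I_n) = y.
  by apply/rowP => i; rewrite mxE mem_index_enum.
by have := hs (index_enum 'I_n); rewrite hy.
Qed.

(** Only this much of polynomiality is used to bound a function by its values
    on a grid: it is inherited by restrictions to faces and composition with
    multilinear maps, for which no polynomial needs to be written down. *)
Definition seppoly k f := forall x l,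
  exists2 q : {poly R}, (size q <= k.+1)%N & forall t, f (upd x l t) = q.[t].

End coordinates.

Section grid.
Variables (R : realType) (k : nat).

Let delta : R := k.+1%:R^-1.
Let delta0 : 0 < delta. Proof. by rewrite invr_gt0 ltr0n. Qed.

Lemma node_dist i j : (i < j)%N -> delta <= `|node R k i - node R k j|.
Proof.
move=> ij; rewrite distrC /node -mulrBl -natrB 1?ltnW// ger0_norm//.
by rewrite -{1}[delta]mul1r ler_wpM2r ?invr_ge0// ler1n subn_gt0.
Qed.

Lemma node_norm (r : R) i : 1 <= r -> (i <= k)%N -> `|node R k i| <= r.
Proof.
move=> r1 ik; have /andP[? ?] := node_itv R ik.
by rewrite ger0_norm// (le_trans _ r1).
Qed.

Definition grid n (g : {ffun 'I_n -> 'I_k.+1}) : 'rV[R]_n :=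
  \row_i node R k (g i).

(** The coordinates are freed from the grid one after another, each at the cost
    of the constant in one variable. *)
Lemma seppoly_grid n (r : R) : 1 <= r -> exists2 C : R, 1 <= C &
  forall (f : 'rV[R]_n -> R) (m : R), seppoly k f -> (forall g, `|f (grid g)| <= m) ->
  forall x : 'rV[R]_n, (forall i, `|x 0 i| <= r) ->
    [/\ `|f x| <= C * m,
        forall l t, `|t| <= r -> `|f (upd x l t) - f x| <= C * m * `|t - x 0 l| &
        forall l (q : {poly R}), (size q <= k.+1)%N ->
          (forall t, f (upd x l t) = q.[t]) -> `|q^`().[x 0 l]| <= C * m].
Proof.
move=> r1; have r0 : 0 <= r by exact: le_trans r1.
have [C C1 HC] := @poly_bound_nodes R delta r k delta0 r0.
have {}HC (q : {poly R}) (m : R) : (size q <= k.+1)%N ->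
    (forall i, (i <= k)%N -> `|q.[node R k i]| <= m) ->
    forall t, `|t| <= r -> `|q.[t]| <= C * m /\ `|q^`().[t]| <= C * m.
  apply: HC => [i ik|i j ij jk]; first exact: node_norm.
  exact: node_dist.
have C0 : 0 <= C by exact: le_trans C1.
have Cn l : 1 <= C ^+ l by exact: exprn_ege1.
exists (C ^+ n.+1) => // f m fk fm x xr.
have m0 : 0 <= m by apply: le_trans (fm [ffun=> ord0]).
(* the first l coordinates are free and the others are nodes *)
have key l : (l <= n)%N -> forall x : 'rV[R]_n, (forall i, `|x 0 i| <= r) ->
    (forall i : 'I_n, (l <= i)%N -> exists j : 'I_k.+1, x 0 i = node R k j) ->
    `|f x| <= C ^+ l * m.
  elim: l => [|l IH] ln {xr}x xr xn.
    have /choice[g gP] : forall i, exists j : 'I_k.+1, x 0 i = node R k j.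
      by move=> i; exact: xn.
    rewrite (_ : x = grid (finfun g)) ?mul1r//.
    by apply/rowP => i; rewrite mxE ffunE gP.
  pose i0 := Ordinal ln; have [q sq qf] := fk x i0.
  have qi i : (i <= k)%N -> `|q.[node R k i]| <= C ^+ l * m.
    move=> ik; rewrite -qf; apply: IH; first exact: ltnW.
      by move=> j; rewrite updE; case: ifP => // _; exact: node_norm.
    move=> j lj; rewrite updE; case: ifP => ji.
      have ik' : (i < k.+1)%N by [].
      by exists (Ordinal ik').
    by apply: xn; rewrite ltn_neqAle lj andbT eq_sym; apply: contraFN ji => /eqP ji;
      apply/eqP/val_inj.
  have [+ _] := HC _ _ sq qi (x 0 i0) (xr i0).
  by rewrite -qf upd_id mulrA -exprS.
have fb (y : 'rV[R]_n) : (forall i, `|y 0 i| <= r) -> `|f y| <= C ^+ n * m.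
  by move=> yr; apply: key => // i; rewrite leqNgt ltn_ord.
have dq l (q : {poly R}) : (size q <= k.+1)%N ->
    (forall t, f (upd x l t) = q.[t]) ->
    forall s, `|s| <= r -> `|q^`().[s]| <= C ^+ n.+1 * m.
  move=> sq qf s sr; have qi i : (i <= k)%N -> `|q.[node R k i]| <= C ^+ n * m.
    move=> ik; rewrite -qf; apply: fb => j; rewrite updE; case: ifP => // _.
    exact: node_norm.
  by have [_] := HC _ _ sq qi s sr; rewrite exprS mulrA.
split.
- by rewrite (le_trans (fb _ xr))// ler_wpM2r// exprS ler_peMl// exprn_ge0.
- move=> l t tr; have [q sq qf] := fk x l.
  rewrite -{2}(upd_id x l) !qf; apply: poly_lip => s /andP[s1 s2].
  apply: dq sq qf _ _; rewrite ler_norml; apply/andP; split.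
    rewrite (le_trans _ s1)// le_min; move: tr (xr l).
    by rewrite !ler_norml => /andP[-> _] /andP[-> _].
  rewrite (le_trans s2)// ge_max; move: tr (xr l).
  by rewrite !ler_norml => /andP[_ ->] /andP[_ ->].
- by move=> l q sq qf; exact: dq sq qf _ (xr l).
Qed.

End grid.

(** * Lower bounds for integrals over boxes *)

Section mono.
Local Open Scope ereal_scope.
Context d (T : measurableType d) (R : realType).
Variable mu : {measure set T -> \bar R}.
Import HBNNSimple.

(** A nonnegative integral is a supremum over simple functions, hence monotone
    for arbitrary domains such as the images of the reference cube. *)
Lemma le_integral_ge0 (A B : set T) (f g : T -> \bar R) :
  (forall x, A x -> 0 <= f x) -> (forall x, B x -> 0 <= g x) ->
  (forall x, A x -> B x /\ f x <= g x) ->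
  \int[mu]_(x in A) f x <= \int[mu]_(x in B) g x.
Proof.
move=> f0 g0 fg; rewrite !ge0_integralE//; apply: ereal_sup_le.
move=> _ [h /= hf <-]; exists h => //= x.
rewrite (le_trans (hf x))// !patchE; case: ifPn => [/set_mem /fg[/mem_set ->]//|_].
by case: ifPn => // /set_mem/g0.
Qed.

End mono.

Section box_measure.
Variables (R : realType) (n : nat).
Local Notation RR := (measurableTypeR R).

Definition tbox (lo hi : 'I_n -> R) : set (n.-tuple RR) :=
  [set t | forall i, lo i <= tnth t i <= hi i].

Let tboxE lo hi : tbox lo hi = [set t | forall i, [set` `[lo i, hi i]] (tnth t i)].
Proof. by apply/seteqP; split => t /= H i; have := H i; rewrite in_itv. Qed.

Lemma measurable_tbox lo hi : measurable (tbox lo hi).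
Proof.
have mI i : measurable ([set` `[lo i, hi i]] : set RR) by exact: measurable_itv.
rewrite (_ : tbox lo hi = \bigcap_(i in [set: 'I_n])
    (tnth (T := RR))^~ i @^-1` [set` `[lo i, hi i]]).
  apply: fin_bigcap_measurable; first by apply: (@finite_finset 'I_n [set: _]).
  move=> i _; rewrite -[X in measurable X]setTI; exact: measurable_tnth.
rewrite tboxE; apply/seteqP; split => t /= H i; last exact: H.
by move=> _; exact: H.
Qed.

Lemma lebesgue_tbox lo hi : (forall i, lo i <= hi i) ->
  lebesgue_tuple n (tbox lo hi) = (\prod_i (hi i - lo i))%:E.
Proof.
move=> lh; rewrite tboxE.
rewrite (@lebesgue_tuple_box R n (fun i => [set` `[lo i, hi i]])); last first.
  by move=> i; exact: measurable_itv.
rewrite -prodEFin; apply: eq_bigr => i _.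
rewrite lebesgue_measure_itv/= lte_fin; have := lh i.
by rewrite le_eqVlt => /orP[/eqP ->|->]; rewrite ?ltxx ?subrr.
Qed.

(** The bounds from above exclude an infinite integral, which would be read as
    the real number 0. *)
Lemma Rintegral_ge_box (D : set (n.-tuple RR)) (g : n.-tuple RR -> R)
    (lo hi p : 'I_n -> R) (rho c B : R) : 0 <= c -> 0 <= rho ->
  (forall t, D t -> 0 <= g t <= B /\ tbox lo hi t) ->
  (forall t, tbox p (fun i => p i + rho) t -> D t /\ c <= g t) ->
  c * rho ^+ n <= Rintegral (lebesgue_tuple n) D g.
Proof.
move=> c0 rho0 DB pD; set mu := lebesgue_tuple n.
pose P := tbox p (fun i => p i + rho).
have IP : (\int[mu]_(x in P) (cst c%:E) x)%E = (c * rho ^+ n)%:E.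
  rewrite integral_cst; last exact: measurable_tbox.
  rewrite EFinM; congr (_ * _)%E; apply: etrans (lebesgue_tbox _) _ => [i|].
    by rewrite lerDl.
  by under eq_bigr do rewrite addrC addKr; rewrite prodr_const card_ord.
have g0 t : D t -> 0 <= g t by move=> /DB[/andP[]].
have lower : ((c * rho ^+ n)%:E <= \int[mu]_(x in D) (g x)%:E)%E.
  rewrite -IP; apply: le_integral_ge0 => t; rewrite ?lee_fin//; first exact: g0.
  exact: pD.
have lohi : forall i, lo i <= hi i.
  pose t0 : n.-tuple RR := [tuple p i | i < n].
  have [t0D _] : D t0 /\ c <= g t0.
    by apply: pD => i; rewrite tnth_mktuple lexx lerDl.
  by move=> i; have [_ /(_ i)/andP[/le_trans + ?]] := DB _ t0D; exact.
have upper : (\int[mu]_(x in D) (g x)%:E < +oo)%E.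
  apply: (@le_lt_trans _ _ (\int[mu]_(x in tbox lo hi) (cst `|B|%:E) x)%E).
    apply: le_integral_ge0 => t; rewrite ?lee_fin//; first exact: g0.
    by move=> /DB[/andP[_ gB] ?]; split=> //; rewrite (le_trans gB)// ler_norm.
  rewrite integral_cst; last exact: measurable_tbox.
  apply: (@le_lt_trans _ _ (`|B|%:E * (\prod_i (hi i - lo i))%:E)%E).
    by rewrite -(lebesgue_tbox lohi).
  by rewrite -EFinM ltry.
rewrite /Rintegral -lee_fin fineK// ge0_fin_numE; first exact: upper.
by apply: integral_ge0 => t /g0.
Qed.

End box_measure.

Section L2.
Variables (R : realType) (k : nat).

Lemma size_comp_affine (q : {poly R}) (b c : R) : (size q <= k.+1)%N ->
  (size (q \Po (b *: 'X + c%:P)) <= k.+1)%N.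
Proof.
move=> sq; have [->|q0] := eqVneq q 0; first by rewrite comp_poly0 size_poly0.
rewrite (leq_trans (size_comp_poly_leq _ _))// ltnS -[k]muln1 leq_mul//.
  by rewrite -ltnS prednK// size_poly_gt0.
rewrite -subn1 leq_subLR (leq_trans (size_polyD _ _))// geq_max.
rewrite (leq_trans (size_scale_leq _ _)) ?size_polyX//.
by rewrite (leq_trans (size_polyC_leq1 _)).
Qed.

Lemma upd_affine n (a x : 'rV[R]_n) (s : R) l t :
  a + s *: upd x l t = upd (a + s *: x) l (s * t + a 0 l).
Proof.
apply/rowP => i.
by rewrite !mxE; case: eqP => [->|_] //; rewrite addrC.
Qed.

Lemma seppoly_affine n (f : 'rV[R]_n -> R) (a : 'rV[R]_n) (s : R) :
  seppoly k f -> seppoly k (fun x => f (a + s *: x)).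
Proof.
move=> fk x l; have [q sq qf] := fk (a + s *: x) l.
exists (q \Po (s *: 'X + (a 0 l)%:P)); first exact: size_comp_affine.
by move=> t; rewrite horner_comp !hornerE -qf upd_affine.
Qed.

(** Next to a grid point where |f| is maximal, the Lipschitz bound keeps |f| above
    half of its maximum on a box whose side is a fixed fraction of s; this bounds
    the integral below without a change of variables.  The weight w carries
    factors such as 1 / (2 mu) through the integral. *)
Lemma seppoly_L2 n (r : R) : 1 <= r -> exists2 C : R, 0 < C &
  forall (f : 'rV[R]_n -> R) (a : 'rV[R]_n) (s w B : R) (lo hi : 'I_n -> R)
    (D : set (n.-tuple R)) (g : n.-tuple R -> R),
  seppoly k f -> 0 < s -> 0 <= w ->
  (forall t, D t -> 0 <= g t <= B /\ tbox lo hi t) ->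
  (forall t : n.-tuple R, (forall i, a 0 i <= tnth t i <= a 0 i + s) ->
     D t /\ w * f (rv_of_tuple t) ^+ 2 <= g t) ->
  forall x : 'rV[R]_n, (forall i, `|x 0 i - a 0 i| <= r * s) ->
  w * f x ^+ 2 * s ^+ n <= C * Rintegral (lebesgue_tuple n) D g /\
  forall l (q : {poly R}), (size q <= k.+1)%N ->
    (forall t, f (upd x l t) = q.[t]) ->
    w * (s * q^`().[x 0 l]) ^+ 2 * s ^+ n <= C * Rintegral (lebesgue_tuple n) D g.
Proof.
move=> r1; have [C C1 HC] := @seppoly_grid R k n r r1.
have C0 : 0 < C by exact: lt_le_trans C1.
(* moving by rho in every coordinate changes f by at most half its maximum *)
pose rho : R := (2 * C * n.+1%:R * k.+1%:R)^-1.
have rho0 : 0 < rho by rewrite invr_gt0 !mulr_gt0.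
exists (C ^+ 2 * 4 / rho ^+ n); first by rewrite !mulr_gt0 ?invr_gt0 ?exprn_gt0.
move=> f a s w B lo hi D g fk s0 w0 DB boxD x xr.
pose F (y : 'rV[R]_n) := f (a + s *: y).
have Fk : seppoly k F by exact: seppoly_affine.
pose G := [arg max_(i > [ffun=> ord0] : {ffun 'I_n -> 'I_k.+1}) `|F (grid R i)|]%O.
have GP (g' : {ffun 'I_n -> 'I_k.+1}) : `|F (grid R g')| <= `|F (grid R G)|.
  by rewrite /G; case: arg_maxP => // i _; exact.
pose m : R := `|F (grid R G)|; rewrite -/m in GP.
have xE : x = a + s *: (s^-1 *: (x - a)).
  by rewrite scalerA divff ?gt_eqF// scale1r addrC subrK.
have [fx _ dfx] : [/\ `|f x| <= C * m, True &
    forall l (q : {poly R}), (size q <= k.+1)%N ->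
      (forall t, f (upd x l t) = q.[t]) -> `|s * q^`().[x 0 l]| <= C * m].
  have [|Fx _ dFx] := HC F m Fk GP (s^-1 *: (x - a)); last first.
    split => //; first by rewrite xE.
    move=> l q sq qf.
    have := dFx l (q \Po (s *: 'X + (a 0 l)%:P)) (size_comp_affine _ _ sq).
    rewrite /F deriv_comp derivD derivZ derivX derivC addr0 !hornerE horner_comp !hornerE.
    have -> : s * (s^-1 *: (x - a)) 0 l + a 0 l = x 0 l.
      by rewrite !mxE mulrA divff ?gt_eqF// mul1r subrK.
    rewrite /= mulr1 [_ * s]mulrC; apply => t.
    by rewrite upd_affine -xE qf horner_comp !hornerE.
  move=> i; rewrite !mxE normrM ger0_norm ?invr_ge0 ?(ltW s0)// mulrC ler_pdivrMr//.
have rhok : rho <= k.+1%:R^-1.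
  rewrite /rho invfM ler_piMl ?invr_ge0//.
  rewrite invf_le1 ?mulr_gt0//; have : (1 : R) <= n.+1%:R by rewrite ler1n.
  by nra.
have sub (y : 'rV[R]_n) : (forall i, node R k (G i) <= y 0 i <= node R k (G i) + rho) ->
    (forall i, 0 <= y 0 i <= 1) /\ m / 2 <= `|F y|.
  move=> yG; have y01 i : 0 <= y 0 i <= 1.
    have /andP[h1 h2] := yG i.
    have := @node_succ R k (G i) (ltn_ord (G i)); have /andP[h3 _] := @node_itv R k (G i) (ltn_ord (G i)).
    by rewrite (le_trans h3 h1)/= => h4; rewrite (le_trans h2)// (le_trans _ h4)// lerD2l.
  split => //.
  have m0 : 0 <= m by exact: normr_ge0.
  have lip : `|F y - F (grid R G)| <= C * m * \sum_i `|y 0 i - grid R G 0 i|.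
    apply: (@coord_lip R n (fun _ => [set t : R | 0 <= t <= 1])) => /=.
    - by rewrite mulr_ge0// ltW.
    - move=> z l t z01 /andP[t0 t1]; have [|_ + _] := HC F m Fk GP z _; last apply.
        by move=> i; have /andP[? ?] := z01 i; rewrite ger0_norm// (le_trans _ r1).
      by rewrite ger0_norm// (le_trans _ r1).
    - by move=> i; rewrite mxE node_itv//; rewrite -ltnS.
    - by [].
  have sumle : \sum_i `|y 0 i - grid R G 0 i| <= n%:R * rho.
    rewrite (_ : n%:R * rho = \sum_(i < n) rho); last first.
      by rewrite sumr_const card_ord mulr_natl.
    apply: ler_sum => i _; have /andP[h1 h2] := yG i.
    by rewrite mxE ger0_norm ?subr_ge0// lerBlDl.
  have Crho : C * (n%:R * rho) <= 1 / 2.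
    have -> : C * (n%:R * rho) = (n%:R / n.+1%:R) / k.+1%:R / 2.
      rewrite /rho; field.
      by rewrite !nat1r !pnatr_eq0/= gt_eqF.
    have : (n%:R / n.+1%:R : R) <= 1 by rewrite ler_pdivrMr// mul1r ler_nat.
    have : 0 <= (n%:R / n.+1%:R : R) by rewrite divr_ge0.
    have : k.+1%:R^-1 <= 1 :> R by rewrite invf_le1// ler1n.
    have : 0 <= k.+1%:R^-1 :> R by rewrite invr_ge0.
    move: (n%:R / _) (k.+1%:R^-1) => u v v0 v1 u0 u1.
    rewrite [leLHS]mulrC [leRHS]mulrC ler_pM2l ?invr_gt0//.
    by rewrite -[leRHS]mulr1 ler_pM.
  have Cm : `|F y - F (grid R G)| <= m / 2.
    rewrite (le_trans lip)// (@le_trans _ _ (m * (C * (n%:R * rho))))//.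
      by rewrite [C * m]mulrC -mulrA ler_wpM2l// ler_wpM2l// ltW.
    by rewrite -[m / 2]mulr1 -mulrA; apply: ler_wpM2l => //; lra.
  have : m <= `|F y| + `|F y - F (grid R G)|.
    rewrite /m -[in leLHS](subKr (F y) (F (grid R G))).
    exact: ler_normB.
  by lra.
have rhos : 0 <= rho * s by rewrite ltW// mulr_gt0.
have := @Rintegral_ge_box R n D g lo hi (fun i => a 0 i + s * node R k (G i))
  (rho * s) (w * (m / 2) ^+ 2) B _ rhos DB.
rewrite mulr_ge0 ?sqr_ge0// => /(_ isT) H.
have {}H : w * (m / 2) ^+ 2 * (rho * s) ^+ n <= Rintegral (lebesgue_tuple n) D g.
  apply: H => t tb; pose y := s^-1 *: (rv_of_tuple t - a).
  have tE : rv_of_tuple t = a + s *: y.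
    by rewrite scalerA divff ?gt_eqF// scale1r addrC subrK.
  have tyE i : tnth t i = a 0 i + s * y 0 i.
    by have := congr1 (fun v : 'rV_n => v 0 i) tE; rewrite !mxE.
  have [|y01 Fy] := sub y.
    move=> i; have := tb i; rewrite tyE -addrA lerD2l ler_pM2l// => /andP[-> h]/=.
    by move: h; rewrite lerD2l [rho * s]mulrC -mulrDr ler_pM2l.
  have [|Dt gt] := boxD t.
    move=> i; have /andP[h1 h2] := y01 i; rewrite tyE lerDl lerD2l.
    by rewrite mulr_ge0 ?(ltW s0)//= ler_piMr// ltW.
  split => //; apply: le_trans gt; apply: ler_wpM2l => //.
  rewrite tE -/(F y) -[leRHS]real_normK ?num_real// lerXn2r ?nnegrE//.
  by rewrite divr_ge0// /m normr_ge0.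
have rn : rho ^+ n != 0 by rewrite expf_neq0// gt_eqF.
suff main v : `|v| <= C * m ->
    w * v ^+ 2 * s ^+ n <= C ^+ 2 * 4 / rho ^+ n * Rintegral (lebesgue_tuple n) D g.
  by split => [|l q sq qf]; apply: main => //; exact: dfx.
move=> vm; apply: le_trans (ler_wpM2l _ H); last first.
  by rewrite !mulr_ge0 ?invr_ge0 ?exprn_ge0 ?(ltW rho0)// ltW.
have -> : C ^+ 2 * 4 / rho ^+ n * (w * (m / 2) ^+ 2 * (rho * s) ^+ n) =
    w * (C * m) ^+ 2 * s ^+ n by rewrite [(rho * s) ^+ n]exprMn; field.
apply: ler_wpM2r; first by rewrite exprn_ge0// ltW.
apply: ler_wpM2l => //; rewrite -[leLHS]real_normK ?num_real//.
by rewrite lerXn2r// ?nnegrE// (le_trans _ vm).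
Qed.

End L2.

(** * Polynomial fields along lines *)

Section polynomial_fields.
Variables (R : realType) (d : nat).
Implicit Types (p : mpoly d R) (x w : 'rV[R]_d).

Lemma mpoly_ring_ind (P : mpoly d R -> Prop) :
  (forall c, P (mpolyC d c)) -> (forall i, P (mpolyX R (mnm1 i))) ->
  (forall p q, P p -> P q -> P (p + q)) -> (forall p q, P p -> P q -> P (p * q)) ->
  forall p, P p.
Proof.
move=> PC PX PD PM p; rewrite (mpolyE p).
apply: (big_ind P) => // [|m _]; first by rewrite -(mpolyC0 d R).
rewrite -mul_mpolyC; apply: (PM) => //; rewrite mpolyXE_id.
apply: (big_ind P) => // [|i _]; first by rewrite -(mpolyC1 d R).
elim: (m i) => [|e IH]; first by rewrite expr0 -(mpolyC1 d R).
by rewrite exprS; exact: PM.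
Qed.

Lemma msize_mderiv k i p : (msize p <= k)%N -> (msize (mderiv i p) <= k)%N.
Proof.
move=> pk; rewrite msizeE; apply/bigmax_leqP_seq => m mp _.
rewrite (leq_trans _ pk)// ltnW// (leq_trans _ (@msize_mdeg_lt _ _ _ (mnm_add m (mnm1 i)) _))//.
  by rewrite mdegD mdeg1 addn1.
move: mp; rewrite !mcoeff_msupp mcoeff_mderiv; apply: contraNN => /eqP ->.
by rewrite mul0rn.
Qed.

(** Restriction to a line, through which differentiation in several variables
    becomes that of polynomials in one variable. *)
Definition line p x w : {poly R} :=
  mmap (@polyC R) (fun i => (x 0 i)%:P + w 0 i *: 'X) p.

Lemma horner_line p x w t : (line p x w).[t] = pev p (x + t *: w).
Proof.
rewrite /line /mmap /pev mevalE horner_sum; apply: eq_bigr => m _.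
rewrite hornerM hornerC /mmap1 horner_prod; congr (_ * _).
by apply: eq_bigr => i _; rewrite horner_exp !hornerE !mxE [w 0 i * t]mulrC.
Qed.

Lemma size_line k p x w : (msize p <= k.+1)%N -> (size (line p x w) <= k.+1)%N.
Proof.
move=> pk; apply: (leq_trans (size_sum _ _ _)); apply/bigmax_leqP_seq => m mp _.
rewrite (leq_trans (size_polyMleq _ _))// (leq_trans _ (leq_trans (msize_mdeg_lt mp) pk))//.
rewrite mdegE -subn1 leq_subLR (leq_trans (leq_add (size_polyC_leq1 _) (leqnn _)))// leq_add2l.
apply: (big_ind2 (fun (q : {poly R}) e => (size q <= e.+1)%N)).
- by rewrite size_poly1.
- move=> q1 e1 q2 e2 h1 h2; rewrite (leq_trans (size_polyMleq _ _))//.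
  by rewrite -subn1 leq_subLR (leq_trans (leq_add h1 h2))// addSn addnS.
move=> i _; rewrite (leq_trans (size_poly_exp_leq _ _))// ltnS -[leqRHS]mul1n leq_mul2r.
apply/orP; right; rewrite -subn1 leq_subLR (leq_trans (size_polyD _ _))// geq_max.
rewrite (leq_trans (size_polyC_leq1 _))//=.
by rewrite (leq_trans (size_scale_leq _ _))// size_polyX.
Qed.

Lemma deriv_line p x w : (line p x w)^`() = \sum_i w 0 i *: line (mderiv i p) x w.
Proof.
pose h := fun i => (x 0 i)%:P + w 0 i *: 'X : {poly R}.
have lE q : line q x w = mmap (@polyC R) h q by [].
have l0 : line 0 x w = 0 by rewrite lE mmap0.
have lD q1 q2 : line (q1 + q2) x w = line q1 x w + line q2 x w.
  by rewrite !lE mmapD.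
have lM q1 q2 : line (q1 * q2) x w = line q1 x w * line q2 x w.
  by rewrite !lE; exact: rmorphM.
elim/mpoly_ring_ind: p => [c|i|p q hp hq|p q hp hq].
- rewrite lE mmapC derivC big1// => i _.
  by rewrite mderivC l0 scaler0.
- rewrite lE mmapX mmap1U /h derivD derivC add0r derivZ derivX.
  rewrite (bigD1 i)//= mderivX mnmE eqxx big1 => [|j ji].
    rewrite addr0 (_ : mnm_sub _ _ = mnm0) ?mpolyX0; last first.
      by apply/mnmP => j; rewrite mnmE subnn mnm0E.
    by rewrite scale1r lE rmorph1.
  by rewrite mderivX mnmE eq_sym (negPf ji) scale0r l0 scaler0.
- rewrite lD derivD hp hq -big_split/=; apply: eq_bigr => i _.
  by rewrite mderivD lD scalerDr.
- rewrite lM derivM hp hq mulr_suml mulr_sumr -big_split/=.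
  apply: eq_bigr => i _; rewrite mderivM lD !lM scalerDr.
  by rewrite -scalerAl -scalerAr.
Qed.

Lemma horner_deriv_line p x w t :
  (line p x w)^`().[t] = \sum_i w 0 i * pev (mderiv i p) (x + t *: w).
Proof.
rewrite deriv_line horner_sum; apply: eq_bigr => i _.
by rewrite hornerZ horner_line.
Qed.

(** Mean value theorem for p minus a linear function; A is going to be 0 or the
    gradient at x. *)
Lemma pev_taylor1 p x w (A : 'I_d -> R) (L : R) :
  (forall t i, 0 <= t <= 1 -> `|pev (mderiv i p) (x + t *: w) - A i| <= L) ->
  `|pev p (x + w) - pev p x - \sum_i w 0 i * A i| <= L * \sum_i `|w 0 i|.
Proof.
move=> AL; pose q := line p x w - (\sum_i w 0 i * A i) *: 'X.
have -> : pev p (x + w) - pev p x - \sum_i w 0 i * A i = q.[1] - q.[0].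
  by rewrite /q !hornerE !horner_line scale1r scale0r addr0; ring.
rewrite -[leRHS]mulr1 -[X in _ * X](normr1 R) -{2}[1 : R]subr0; apply: poly_lip => s.
rewrite (min_idPr ler01) (max_idPl ler01) => s01.
rewrite /q derivB derivZ derivX hornerD hornerN hornerZ hornerC mulr1.
rewrite horner_deriv_line -sumrB (le_trans (ler_norm_sum _ _ _))// mulr_sumr.
apply: ler_sum => i _; rewrite -mulrBr normrM mulrC ler_wpM2r//.
exact: AL.
Qed.

Lemma upd_line x l t : upd x l t = upd x l 0 + t *: delta_mx 0 l.
Proof.
apply/rowP => i; rewrite !mxE eqxx/= eq_sym.
by case: eqP; rewrite ?mulr1 ?add0r// mulr0 addr0.
Qed.

Lemma pev_seppoly k p : (msize p <= k.+1)%N -> seppoly k (pev p).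
Proof.
move=> pk x l; exists (line p (upd x l 0) (delta_mx 0 l)); first exact: size_line.
by move=> t; rewrite horner_line -upd_line.
Qed.

Lemma mpoly_L2 k (r : R) : 1 <= r -> exists2 C : R, 0 < C &
  forall p (a : 'rV[R]_d) (s w B : R) (lo hi : 'I_d -> R)
    (D : set (d.-tuple R)) (g : d.-tuple R -> R),
  (msize p <= k.+1)%N -> 0 < s -> 0 <= w ->
  (forall t, D t -> 0 <= g t <= B /\ tbox lo hi t) ->
  (forall t : d.-tuple R, (forall i, a 0 i <= tnth t i <= a 0 i + s) ->
     D t /\ w * pev p (rv_of_tuple t) ^+ 2 <= g t) ->
  forall x : 'rV[R]_d, (forall i, `|x 0 i - a 0 i| <= r * s) ->
  w * pev p x ^+ 2 * s ^+ d <= C * Rintegral (lebesgue_tuple d) D g /\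
  forall l, w * (s * pev (mderiv l p) x) ^+ 2 * s ^+ d <=
    C * Rintegral (lebesgue_tuple d) D g.
Proof.
move=> /(seppoly_L2 k d)[C C0 HC]; exists C => // p a s w B lo hi D g pk s0 w0 Dg gp x xr.
have [h1 h2] := HC _ a s w B lo hi D g (pev_seppoly pk) s0 w0 Dg gp x xr.
split=> // l; have := h2 l (line p (upd x l 0) (delta_mx 0 l)) (size_line _ _ pk).
rewrite horner_deriv_line -upd_line upd_id (bigD1 l)//= !mxE !eqxx mul1r big1 ?addr0.
  by apply => t; rewrite horner_line -upd_line.
by move=> i il; rewrite mxE eqxx (negPf il) mul0r.
Qed.

End polynomial_fields.

(** * The multilinear reference map *)

Section reference_map.
Variables (R : realType) (d : nat) (V : {ffun 'I_d -> bool} -> 'rV[R]_d).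
Implicit Types (x : 'rV[R]_d) (i l : 'I_d).
Local Notation F := (ref_map V).

Lemma ref_map_upd x i t : F (upd x i t) = F (upd x i 0) + t *: (F (upd x i 1) - F (upd x i 0)).
Proof.
rewrite /ref_map -sumrB scaler_sumr -big_split/=; apply: eq_bigr => c _.
rewrite -scalerBl scalerA -scalerDl; congr (_ *: _).
have E u : \prod_l (if c l then upd x i u 0 l else 1 - upd x i u 0 l) =
    (if c i then u else 1 - u) * \prod_(l | l != i) (if c l then x 0 l else 1 - x 0 l).
  rewrite (bigD1 i)//= updE eqxx; congr (_ * _); apply: eq_bigr => l li.
  by rewrite updE (negPf li).
by rewrite !E; case: (c i); ring.
Qed.

Lemma differentiable_bigsum (I : Type) (s : seq I) (f : I -> 'rV[R]_d -> 'rV[R]_d) x :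
  (forall j, differentiable (f j) x) ->
  differentiable (fun y => \sum_(i <- s) f i y) x.
Proof.
move=> df; elim: s => [|a s IH].
  rewrite (_ : (fun _ => _) = cst 0); first exact: differentiable_cst.
  by apply/funext => y; rewrite big_nil.
rewrite (_ : (fun _ => _) = f a + (fun y => \sum_(j <- s) f j y)).
  exact: differentiableD.
by apply/funext => y; rewrite big_cons.
Qed.

Lemma differentiable_bigprod (I : Type) (s : seq I) (f : I -> 'rV[R]_d -> R) x :
  (forall j, differentiable (f j) x) ->
  differentiable (fun y => \prod_(i <- s) f i y) x.
Proof.
move=> df; elim: s => [|a s IH].
  rewrite (_ : (fun _ => _) = cst 1); first exact: differentiable_cst.
  by apply/funext => y; rewrite big_nil.
rewrite (_ : (fun _ => _) = f a * (fun y => \prod_(j <- s) f j y)).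
  exact: differentiableM.
by apply/funext => y; rewrite big_cons.
Qed.

Lemma differentiable_ref_map x : differentiable F x.
Proof.
apply: differentiable_bigsum => c; apply: differentiableZl.
apply: differentiable_bigprod => i; case: (c i) => /=; first exact: differentiable_coord.
rewrite (_ : (fun _ => _) = cst 1 + - (fun y : 'rV[R]_d => y 0 i : R)); last first.
  by apply/funext.
apply: differentiableD; first exact: differentiable_cst.
apply: differentiableN.
exact: differentiable_coord.
Qed.

(** The map is affine along each axis, so this difference of two values is the
    partial derivative, see [row_jacobian]. *)
Definition slope x i : 'rV[R]_d := F (upd x i 1) - F (upd x i 0).

Lemma row_jacobian x i : row i (jacobian F x) = slope x i.
Proof.
rewrite rowE -deriveEjacobian; last exact: differentiable_ref_map.
rewrite /derive /slope; set D := F _ - F _; apply: cvg_lim => //.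
apply: (@cvg_near_cst _ _ D); near=> h.
have h0 : h != 0 by near: h; exact: nbhs_dnbhs_neq.
rewrite /= (_ : h *: delta_mx 0 i + x = upd x i (x 0 i + h)); last first.
  apply/rowP => j; rewrite !mxE eqxx/= eq_sym.
  by case: eqP => [->|_]; rewrite ?mulr1 ?mulr0 ?add0r// addrC.
rewrite -[in X in _ - X](upd_id x i) !(ref_map_upd _ _ (_ + _)) (ref_map_upd x i (x 0 i)).
rewrite -/D opprD addrACA subrr add0r -scalerBl addrC addKr scalerA mulVf//.
by rewrite scale1r.
Unshelve. all: by end_near. Qed.

Lemma slope_upd x i t : slope (upd x i t) i = slope x i.
Proof. by rewrite /slope !upd_upd. Qed.

Lemma ref_map_step x i t : F (upd x i t) - F x = (t - x 0 i) *: slope x i.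
Proof.
rewrite -[in X in _ - X](upd_id x i) (ref_map_upd x i t) (ref_map_upd x i (x 0 i)).
by rewrite -/(slope x i) opprD addrACA subrr add0r -scalerBl.
Qed.

(** Second differences are symmetric: the variation of one slope is a difference
    of values of another, so bounds on slopes are Lipschitz bounds as well. *)
Lemma slope_step x i l t : i != l ->
  slope (upd x l t) i - slope x i =
  (t - x 0 l) *: (slope (upd x i 1) l - slope (upd x i 0) l).
Proof.
move=> il; have comm s : upd (upd x l t) i s = upd (upd x i s) l t.
  apply/rowP => j; rewrite !updE; case: (j =P i) => [->|//].
  by rewrite (negPf il).
have xl s : upd x i s 0 l = x 0 l by rewrite updE eq_sym (negPf il).
have E s : F (upd (upd x i s) l t) = F (upd x i s) + (t - x 0 l) *: slope (upd x i s) l.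
  by rewrite -(xl s) -ref_map_step addrC subrK.
have addK4 (A a B b : 'rV[R]_d) : A + a - (B + b) - (A - B) = a - b.
  by rewrite [- (B + b)]opprD addrACA [X in X - _]addrC addrK.
by rewrite [slope (upd x l t) i]/slope [slope x i]/slope !comm !E addK4 -scalerBr.
Qed.

End reference_map.

(** * Shape-regular elements *)

Section enorm_theory.
Variables (R : realType) (d : nat).
Implicit Types x y : 'rV[R]_d.

Lemma dotxx_ge0 x : 0 <= dot x x.
Proof. by apply: sumr_ge0 => i _; rewrite -expr2 sqr_ge0. Qed.

Lemma enorm_ge0 x : 0 <= enorm x. Proof. exact: sqrtr_ge0. Qed.

Lemma sqr_enorm x : enorm x ^+ 2 = dot x x.
Proof. by rewrite sqr_sqrtr// dotxx_ge0. Qed.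

Lemma le_coord_enorm x i : `|x 0 i| <= enorm x.
Proof.
rewrite -(@ler_pXn2r _ 2)// ?nnegrE ?enorm_ge0// sqr_enorm real_normK ?num_real//.
rewrite /dot (bigD1 i)//= -expr2 lerDl sumr_ge0// => j _.
by rewrite -expr2 sqr_ge0.
Qed.

Lemma enorm_le_sum x : enorm x <= \sum_i `|x 0 i|.
Proof.
have s0 : 0 <= \sum_i `|x 0 i| by exact: sumr_ge0.
rewrite -(@ler_pXn2r _ 2)// ?nnegrE ?enorm_ge0// sqr_enorm expr2 mulr_suml.
apply: ler_sum => i _; rewrite -expr2 -real_normK ?num_real// expr2.
by rewrite ler_wpM2l// (bigD1 i)//= lerDl sumr_ge0.
Qed.

Lemma enorm_delta i : enorm (delta_mx 0 i : 'rV[R]_d) = 1.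
Proof.
rewrite /enorm /dot (bigD1 i)//= !mxE !eqxx mulr1 big1 ?addr0 ?sqrtr1// => j ji.
by rewrite !mxE (negPf ji) andbF mul0r.
Qed.

Lemma mx_norm_le x e : 0 <= e -> (`|x| <= e) <-> (forall i, `|x 0 i| <= e).
Proof.
move=> e0; rewrite [`|x|]mx_normrE; split.
  by move=> /bigmax_leP[_ h] i; exact: (h (0, i)).
by move=> h; apply: bigmax_le => // -[j i] _; rewrite ord1.
Qed.

End enorm_theory.

(* Makes row vectors a complete normed module, for the fixed point theorem. *)
HB.instance Definition _ (R : realType) d :=
  Uniform_isComplete.Build 'rV[R]_d (@mx_complete _ _ _).

Section shape_regular_element.
Variables (R : realType) (d : nat) (V : {ffun 'I_d -> bool} -> 'rV[R]_d).
Variables (sigma h : R).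
Local Notation F := (ref_map V).
Local Notation J := (jacobian F).
Implicit Types (x y : 'rV[R]_d).

Definition regular_elt := forall x w, ref_cube x ->
  enorm (w *m J x) <= sigma * h * enorm w /\ h * enorm w <= sigma * enorm (w *m J x).

Hypotheses (sigma0 : 0 < sigma) (h0 : 0 < h) (reg : regular_elt).

Let subE (a b : 'rV[R]_d) k : (a - b) 0 k = a 0 k - b 0 k.
Proof. by rewrite !mxE. Qed.

Let scaleE c (a : 'rV[R]_d) k : (c *: a) 0 k = c * a 0 k.
Proof. by rewrite mxE. Qed.

Lemma slope_bound x i k : ref_cube x -> `|slope V x i 0 k| <= sigma * h.
Proof.
move=> xc; rewrite -row_jacobian rowE (le_trans (le_coord_enorm _ _))//.
by have [+ _] := reg (delta_mx 0 i) xc; rewrite enorm_delta mulr1.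
Qed.

Lemma ref_cube_upd x i t : ref_cube x -> 0 <= t <= 1 -> ref_cube (upd x i t).
Proof. by move=> xc t01 j; rewrite updE; case: ifP. Qed.

Lemma ref_map_lip x y k : ref_cube x -> ref_cube y ->
  `|F y 0 k - F x 0 k| <= sigma * h * \sum_i `|y 0 i - x 0 i|.
Proof.
apply: (@coord_lip R d (fun _ => [set t | 0 <= t <= 1]) (fun x => F x 0 k)).
  by rewrite mulr_ge0 ?ltW.
move=> {}x l t xc t01; have := congr1 (fun v : 'rV_d => v 0 k) (ref_map_step V x l t).
rewrite subE scaleE => ->.
by rewrite normrM mulrC ler_wpM2r// slope_bound.
Qed.

Lemma jacobian_unit x : ref_cube x -> J x \in unitmx.
Proof.
move=> xc; rewrite -row_free_unit; apply: inj_row_free => w wJ.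
have [_] := reg w xc; rewrite wJ.
have -> : enorm (0 : 'rV[R]_d) = 0.
  by rewrite /enorm /dot big1 ?sqrtr0// => i _; rewrite mxE mul0r.
rewrite mulr0 pmulr_rle0// => w0; apply/rowP => i; rewrite mxE; apply/eqP.
by rewrite -normr_le0 (le_trans (le_coord_enorm _ _)).
Qed.

Lemma invmx_jacobian_bound x i k : ref_cube x -> `|invmx (J x) i k| <= sigma / h.
Proof.
move=> xc; rewrite ler_pdivlMr// mulrC.
rewrite (@le_trans _ _ (h * enorm (row i (invmx (J x)))))//.
  rewrite ler_pM2l// (le_trans _ (le_coord_enorm _ k))//.
  by rewrite [row i _ 0 k]mxE.
have [_] := reg (row i (invmx (J x))) xc.
rewrite -row_mul mulVmx ?jacobian_unit// row1 enorm_delta mulr1.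
exact.
Qed.

Lemma slope_lip x y i k : ref_cube x -> ref_cube y ->
  `|slope V y i 0 k - slope V x i 0 k| <= 2 * sigma * h * \sum_l `|y 0 l - x 0 l|.
Proof.
apply: (@coord_lip R d (fun _ => [set t | 0 <= t <= 1]) (fun x => slope V x i 0 k)).
  by rewrite !mulr_ge0 ?ltW.
move=> {}x l t xc t01; have [<-|il] := eqVneq i l.
  by rewrite slope_upd subrr normr0 !mulr_ge0 ?(ltW sigma0) ?(ltW h0).
have := congr1 (fun v : 'rV_d => v 0 k) (slope_step V x t il).
rewrite subE scaleE => ->.
rewrite normrM mulrC ler_wpM2r//.
rewrite subE (le_trans (ler_normB _ _))//.
rewrite -mulrA mulrDl mul1r lerD// slope_bound//; apply: ref_cube_upd => //.
  by rewrite lexx ler01.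
by rewrite lexx ler01.
Qed.

Definition cube_mid : 'rV[R]_d := const_mx (2^-1).

Lemma cube_mid_in : ref_cube cube_mid.
Proof. by move=> i; rewrite mxE invr_ge0 ler0n invf_le1// ler1n. Qed.

Let r : R := (2 + 4 * sigma ^+ 2 * d.+1%:R ^+ 3)^-1.

(** r is a radius, in reference coordinates, on which the derivative stays close
    to that at the centre; dividing it by 2 sigma (d + 1) gives the radius, in
    units of h, of a box that is certain to be reached. *)
Definition inner_radius : R := r / (2 * sigma * d.+1%:R).

Let den0 : 0 < 2 + 4 * sigma ^+ 2 * d.+1%:R ^+ 3.
Proof. by rewrite addr_gt0// !mulr_gt0// exprn_gt0. Qed.

Let r0 : 0 < r. Proof. by rewrite invr_gt0. Qed.

Lemma inner_radius_gt0 : 0 < inner_radius.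
Proof. by rewrite divr_gt0 ?mulr_gt0. Qed.

Let r2 : r <= 2^-1.
Proof. by rewrite /r lef_pV2 ?posrE// lerDl !mulr_ge0 ?exprn_ge0 ?ltW. Qed.

Let rq : 2 * sigma ^+ 2 * d.+1%:R ^+ 3 * r <= 2^-1.
Proof.
rewrite ler_pdivrMr//; move: (d.+1%:R : R) => N.
have -> : 2^-1 * (2 + 4 * sigma ^+ 2 * N ^+ 3) = 1 + 2 * sigma ^+ 2 * N ^+ 3.
  by field.
by rewrite lerDr.
Qed.

Lemma coord_ball x : `|x - cube_mid| <= r -> ref_cube x /\ forall i, `|x 0 i - cube_mid 0 i| <= r.
Proof.
move=> /(mx_norm_le _ (ltW r0)) xr.
have {}xr i : `|x 0 i - cube_mid 0 i| <= r by have := xr i; rewrite !mxE.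
split=> // i; have := xr i; rewrite mxE ler_norml => /andP[h1 h2].
by apply/andP; split; move: r2 h1 h2; lra.
Qed.

Lemma sum_le_const (f : 'I_d -> R) (e : R) : 0 <= e -> (forall i, f i <= e) ->
  \sum_i f i <= d.+1%:R * e.
Proof.
move=> e0 fe; rewrite (@le_trans _ _ (\sum_(i < d) e))//; first exact: ler_sum.
by rewrite sumr_const card_ord -[e *+ d]mulr_natl ler_wpM2r// ler_nat.
Qed.

(** Newton's iteration from the centre with the frozen derivative there is a
    contraction of a ball of fixed radius, because the derivative is Lipschitz
    with constant proportional to h. *)
Lemma inner_box y : (forall k, `|y 0 k - F cube_mid 0 k| <= inner_radius * h) ->
  elt V y.
Proof.
move=> yc; pose B := invmx (J cube_mid); pose N := d.+1%:R : R.
have N0 : 0 <= N by exact: ler0n.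
have B_bound i k : `|B i k| <= sigma / h by exact/invmx_jacobian_bound/cube_mid_in.
have sh0 : 0 <= sigma / h by rewrite divr_ge0 ?ltW.
have vB (v : 'rV[R]_d) e i : 0 <= e -> (forall k, `|v 0 k| <= e) ->
    `|(v *m B) 0 i| <= N * (e * (sigma / h)).
  move=> e0 ve; rewrite mxE (le_trans (ler_norm_sum _ _ _))//.
  apply: sum_le_const => [|k]; first by rewrite mulr_ge0.
  by rewrite normrM ler_pM.
pose E x : 'rV[R]_d := F x - x *m J cube_mid.
have E_lip x z e k : 0 <= e -> `|x - cube_mid| <= r -> `|z - cube_mid| <= r ->
    (forall i, `|z 0 i - x 0 i| <= e) ->
    `|E z 0 k - E x 0 k| <= 2 * sigma * h * (N * r) * (N * e).
  move=> e0 /coord_ball[xc xr] /coord_ball[zc zr] ze.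
  pose A i := [set t : R | 0 <= t <= 1 /\ `|t - cube_mid 0 i| <= r].
  have L0 : 0 <= 2 * sigma * h * (N * r) by rewrite !mulr_ge0 ?ltW.
  rewrite (le_trans (@coord_lip R d A (fun x => E x 0 k) _ L0 _ x z _ _))//; last 1 first.
  - by apply: ler_wpM2l => //; exact: sum_le_const.
  - move=> w l t wA [t01 _].
    have wc : ref_cube w by move=> i; have [] := wA i.
    have -> : E (upd w l t) 0 k - E w 0 k =
        (t - w 0 l) * (slope V w l 0 k - slope V cube_mid l 0 k).
      have updD : upd w l t = w + (t - w 0 l) *: delta_mx 0 l.
        apply/rowP => i; rewrite !mxE eqxx/=; case: eqP => [->|_].
          by rewrite mulr1 addrC subrK.
        by rewrite mulr0 addr0.
      have EE : E (upd w l t) - E w =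
          (t - w 0 l) *: (slope V w l - slope V cube_mid l).
        have alg (P X Y Q : 'rV[R]_d) : P - (X + Y) - (Q - X) = P - Q - Y.
          by apply/rowP => i; rewrite !mxE; ring.
        rewrite /E [in X in _ - X *m _]updD mulmxDl -scalemxAl -rowE row_jacobian.
        by rewrite alg ref_map_step -scalerBr.
      by have := congr1 (fun v : 'rV_d => v 0 k) EE; rewrite !(subE, scaleE).
    rewrite normrM mulrC ler_wpM2r// (le_trans (slope_lip _ _ cube_mid_in wc))//.
    apply: ler_wpM2l; first by rewrite !mulr_ge0 ?ltW.
    by apply: sum_le_const => [|i]; [exact: ltW|have [] := wA i].
pose U : set 'rV[R]_d := closed_ball_ (@Num.norm _ _) cube_mid r.
have UE x : U x <-> `|x - cube_mid| <= r by rewrite /U /closed_ball_/= distrC.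
pose G x : 'rV[R]_d := x + (y - F x) *m B.
have GE x z : G z - G x = - ((E z - E x) *m B).
  rewrite /G /E !mulmxBl -!mulmxA mulmxV ?jacobian_unit//; last exact: cube_mid_in.
  rewrite !mulmx1; set a := z; set b := _ *m B; set c := _ *m B; set e := _ *m B.
  by rewrite !opprB !opprD !opprK; apply/rowP => i; rewrite !mxE; ring.
have G_lip x z : `|x - cube_mid| <= r -> `|z - cube_mid| <= r ->
    `|G z - G x| <= 2^-1 * `|z - x|.
  move=> xr zr; apply/mx_norm_le => [|i]; first by rewrite mulr_ge0 ?invr_ge0.
  have ze j : `|z 0 j - x 0 j| <= `|z - x|.
    by have /(mx_norm_le _ (normr_ge0 (z - x)))/(_ j) := lexx `|z - x|; rewrite !mxE.
  rewrite GE [X in `|X|]mxE normrN (le_trans (vB _ (2 * sigma * h * (N * r) * (N * `|z - x|)) _ _ _))//.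
  - by rewrite !mulr_ge0 ?(ltW sigma0) ?(ltW h0) ?(ltW r0).
  - by move=> k; rewrite subE; exact: E_lip.
  rewrite (_ : N * _ = (2 * sigma ^+ 2 * N ^+ 3 * r) * `|z - x|).
    by rewrite ler_wpM2r.
  by field; rewrite gt_eqF.
have Gc : `|G cube_mid - cube_mid| <= r / 2.
  rewrite /G addrAC subrr add0r; apply/mx_norm_le => [|i]; first by rewrite divr_ge0 ?ltW.
  rewrite (le_trans (vB _ (inner_radius * h) _ _ _))//.
  - by rewrite mulr_ge0// ltW// inner_radius_gt0.
  - by move=> k; have := yc k; rewrite !mxE.
  rewrite /inner_radius -/N (_ : N * _ = r / 2)//; field.
  by rewrite !gt_eqF//= /N ltr0n.
have GU : set_fun U U G.
  move=> x /UE xr; apply/UE; rewrite (le_trans (ler_distD (G cube_mid) _ _))//.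
  rewrite [r]splitr lerD//.
  rewrite (le_trans (G_lip _ _ _ xr))// ?subrr ?normr0 ?(ltW r0)//.
  by rewrite mulrC ler_wpM2r ?invr_ge0.
have [|||p /UE pU] := @banach_fixed_point R 'rV[R]_d U (mkfun GU).
- exists (2^-1)%:nng; split; first by rewrite /= invf_lt1// ltr1n.
  by move=> [x z] [/= /UE xU /UE zU]; exact: G_lip.
- exact: closed_closed_ball_.
- by exists cube_mid; apply/UE; rewrite subrr normr0 ltW.
move=> pE; have {}pE : p = p + (y - F p) *m B by exact: pE.
have [pc _] := coord_ball pU.
exists p => //; apply/esym/eqP; rewrite -subr_eq0; apply/eqP.
have : (y - F p) *m B = 0 by apply: (addrI p); rewrite addr0 -pE.
move=> /(congr1 (mulmx^~ (J cube_mid))); rewrite -mulmxA mulVmx ?mulmx1 ?mul0mx//.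
exact/jacobian_unit/cube_mid_in.
Qed.

End shape_regular_element.

(** * The area density of a face *)

Section face_density.
Variables (R : realType) (d : nat).

Lemma det_bound n (A : 'M[R]_n) (m : R) : (forall i k, `|A i k| <= m) ->
  `|\det A| <= n`!%:R * m ^+ n.
Proof.
move=> Am; rewrite /determinant (le_trans (ler_norm_sum _ _ _))//.
rewrite (@le_trans _ _ (\sum_(s : {perm 'I_n}) m ^+ n))//.
  apply: ler_sum => s _; rewrite normrM normrX normrN1 expr1n mul1r normr_prod.
  rewrite -[in leRHS](card_ord n) -prodr_const; apply: ler_prod => i _.
  by rewrite normr_ge0 Am.
by rewrite sumr_const -[in leLHS]mulr_natl card_Sn.
Qed.

(** The squared area element of the face x_j = s is a minor of J J^T, hence
    an entry of its adjugate. *)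
Lemma gram_minor (J : 'M[R]_d) j : J \in unitmx ->
  let c : 'rV[R]_d := (col j (invmx J))^T in
  Num.sqrt (\det (row' j J *m (row' j J)^T)) = `|\det J| * enorm c.
Proof.
move=> Ju c; have dJ : \det J \is a GRing.unit by rewrite -unitmxE.
have -> : row' j J *m (row' j J)^T = row' j (col' j (J *m J^T)).
  by apply/matrixP => i k; rewrite !mxE; apply: eq_bigr => l _; rewrite !mxE.
have cof : \det (row' j (col' j (J *m J^T))) = (\adj (J *m J^T)) j j.
  by rewrite mxE /cofactor addnn -signr_odd odd_double expr0 mul1r.
have adjE : \adj (J *m J^T) = (\det J) ^+ 2 *: ((invmx J)^T *m invmx J).
  have JJ : J *m J^T *m ((invmx J)^T *m invmx J) = 1%:M.
    rewrite mulmxA -(mulmxA J) -trmx_mul mulVmx// trmx1 mulmx1.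
    by rewrite mulmxV.
  rewrite -[LHS]mulmx1 -JJ mulmxA mul_adj_mx det_mulmx det_tr -expr2.
  by rewrite mul_scalar_mx.
have -> : \det (row' j (col' j (J *m J^T))) = (\det J) ^+ 2 * dot c c.
  rewrite cof adjE mxE; congr (_ * _); rewrite mxE; apply: eq_bigr => k _.
  by rewrite !mxE.
by rewrite sqrtrM ?sqr_ge0// sqrtr_sqr.
Qed.

Definition density_const (sigma : R) : R := d`!%:R * sigma ^+ d * d%:R * sigma.

(** The factors |det J| and |col_j (J^-1)| of the area element are bounded from
    both sides through J and its inverse.  The extra factor h on rho avoids the
    exponent d - 1. *)
Lemma density_bounds (V : {ffun 'I_d -> bool} -> 'rV[R]_d) (sigma h : R) x j :
  0 < sigma -> 0 < h -> regular_elt V sigma h -> ref_cube x ->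
  let B := row' j (jacobian (ref_map V) x) in
  let rho := Num.sqrt (\det (B *m B^T)) in
  h * rho <= density_const sigma * h ^+ d /\ h ^+ d <= density_const sigma * (h * rho).
Proof.
move=> s0 h0 reg xc B rho; pose J := jacobian (ref_map V) x.
have Ju : J \in unitmx by exact: (jacobian_unit h0 reg xc).
have Jb i k : `|J i k| <= sigma * h.
  have := slope_bound reg i k xc; rewrite -row_jacobian.
  by rewrite [row i _ 0 k]mxE.
have Jib i k : `|invmx J i k| <= sigma / h by exact: (invmx_jacobian_bound h0 reg).
have := gram_minor j Ju; rewrite -/B -/rho; set c := (_^T)%R => rhoE.
have dJ := det_bound Jb; have dJi := det_bound Jib.
have cle : enorm c <= d%:R * (sigma / h).
  rewrite (le_trans (enorm_le_sum _))// (@le_trans _ _ (\sum_(i < d) sigma / h))//.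
    by apply: ler_sum => i _; rewrite !mxE.
  by rewrite sumr_const card_ord mulr_natl.
have cge : 1 <= d%:R * (sigma * h * enorm c).
  have : `|(J *m invmx J) j j| = 1 by rewrite mulmxV// mxE eqxx normr1.
  rewrite mxE => E; rewrite -[leLHS]E (le_trans (ler_norm_sum _ _ _))//.
  rewrite (@le_trans _ _ (\sum_(i < d) sigma * h * enorm c))//.
    apply: ler_sum => i _; rewrite normrM ler_pM//.
    by rewrite (le_trans _ (le_coord_enorm _ i))// !mxE.
  by rewrite sumr_const card_ord mulr_natl.
have dJge : 1 <= `|\det J| * (d`!%:R * (sigma / h) ^+ d).
  have E : `|\det J| * `|\det (invmx J)| = 1.
    by rewrite -normrM -det_mulmx mulmxV// det1 normr1.
  by rewrite -[leLHS]E ler_wpM2l.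
have e0 := enorm_ge0 c; rewrite rhoE; split.
  have -> : density_const sigma * h ^+ d =
      h * ((d`!%:R * (sigma * h) ^+ d) * (d%:R * (sigma / h))).
    by rewrite /density_const exprMn; field; rewrite gt_eqF.
  by rewrite ler_pM2l// ler_pM.
have -> : density_const sigma * (h * (`|\det J| * enorm c)) =
    h ^+ d * ((`|\det J| * (d`!%:R * (sigma / h) ^+ d)) * (d%:R * (sigma * h * enorm c))).
  rewrite /density_const [(sigma / h) ^+ d]exprMn exprVn; field.
  by rewrite expf_neq0// gt_eqF.
by rewrite ler_peMr ?exprn_ge0 ?(ltW h0)// -[leLHS]mulr1 ler_pM.
Qed.

End face_density.

(** * Bounded measurable functions on the reference face *)

Section measurability.
Context dsp (T : measurableType dsp) (R : realType) (D : set T).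
Implicit Types f : T -> R.

Lemma measurable_inv_nneg f : measurable_fun D f -> (forall y, D y -> 0 <= f y) ->
  measurable_fun D (fun y => (f y)^-1).
Proof.
move=> mf f0; apply: (eq_measurable_fun (fun y => f y `^ (-1))) => [y /set_mem Dy|].
  by rewrite powR_inv1// f0.
exact: (measurableT_comp (measurable_powR (-1)) mf).
Qed.

Lemma measurable_sqrtr f : measurable_fun D f ->
  measurable_fun D (fun y => Num.sqrt (f y)).
Proof.
move=> mf; apply: (measurableT_comp _ mf).
by apply: continuous_measurable_fun; exact: sqrt_continuous.
Qed.

Lemma measurable_det n (A : T -> 'M[R]_n) :
  (forall i k, measurable_fun D (fun y => A y i k)) ->
  measurable_fun D (fun y => \det (A y)).
Proof.
move=> mA; rewrite /determinant; apply: measurable_sum => s.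
apply: measurable_funM; first exact: measurable_cst.
by apply: measurable_prod => i _; exact: mA.
Qed.

Lemma measurable_invmx n (A : T -> 'M[R]_n) :
  (forall y, D y -> A y \in unitmx) ->
  (forall i k, measurable_fun D (fun y => A y i k)) ->
  forall i k, measurable_fun D (fun y => invmx (A y) i k).
Proof.
move=> uA mA i k; have mdet := measurable_det mA.
apply: (eq_measurable_fun (fun y =>
    (\det (A y) * (\det (A y) ^+ 2)^-1) * (\adj (A y)) i k)) => [y /set_mem Dy|].
  rewrite /invmx uA// [RHS]mxE; congr (_ * _).
  have := uA _ Dy; rewrite unitmxE unitfE => d0.
  by field.
apply: measurable_funM.
  apply: measurable_funM => //; apply: measurable_inv_nneg => [|y _].
    exact: measurable_funX.
  exact: sqr_ge0.
rewrite (_ : (fun y => _) = (fun y => (-1) ^+ (k + i) * \det (row' k (col' i (A y))))); last first.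
  by apply/funext => y; rewrite mxE.
apply: measurable_funM; first exact: measurable_cst.
apply: measurable_det => a b.
rewrite (_ : (fun y => _) = (fun y => A y (lift k a) (lift i b)))//.
by apply/funext => y; rewrite !mxE.
Qed.

End measurability.

Section face_integrals.
Variables (R : realType) (d : nat).
Local Notation RR := (measurableTypeR R).
Local Notation Y := (d.-1.-tuple RR).
Implicit Types f g : Y -> R.
Local Notation cube := (face_cube : set Y).

Lemma face_cube_tbox : cube = tbox (fun=> 0) (fun=> 1).
Proof. by apply/seteqP; split. Qed.

Lemma measurable_face_cube : measurable cube.
Proof. by rewrite face_cube_tbox; exact: measurable_tbox. Qed.

Lemma lebesgue_face_cube : lebesgue_tuple d.-1 cube = 1%E.
Proof.
rewrite face_cube_tbox lebesgue_tbox => [|_]; last exact: ler01.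
by rewrite subr0 prodr_const expr1n.
Qed.

(** The integrands on a face: integrable, and closed under ring operations, so
    that the separate integrals in the forms may be combined. *)
Definition tame f := measurable_fun cube f /\ exists M, forall y, cube y -> `|f y| <= M.

Lemma tame_cst c : tame (fun=> c).
Proof. by split; [exact: measurable_cst|exists `|c|]. Qed.

Lemma tameD f g : tame f -> tame g -> tame (fun y => f y + g y).
Proof.
move=> [mf [M fM]] [mg [N gN]]; split; first exact: measurable_funD.
by exists (M + N) => y cy; rewrite (le_trans (ler_normD _ _))// lerD ?fM ?gN.
Qed.

Lemma tameM f g : tame f -> tame g -> tame (fun y => f y * g y).
Proof.
move=> [mf [M fM]] [mg [N gN]]; split; first exact: measurable_funM.
by exists (M * N) => y cy; rewrite normrM ler_pM ?fM ?gN.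
Qed.

Lemma tameN f : tame f -> tame (fun y => - f y).
Proof.
move=> tf; rewrite (_ : (fun _ => _) = (fun y => (-1) * f y)).
  by apply: tameM => //; exact: tame_cst.
by apply/funext => y; rewrite mulN1r.
Qed.

Lemma tameB f g : tame f -> tame g -> tame (fun y => f y - g y).
Proof. by move=> tf tg; apply: tameD => //; exact: tameN. Qed.

Lemma tame_sum (I : Type) (s : seq I) (f : I -> Y -> R) :
  (forall i, tame (f i)) -> tame (fun y => \sum_(i <- s) f i y).
Proof.
move=> tf; elim: s => [|i s IH].
  rewrite (_ : (fun _ => _) = fun=> 0); first exact: tame_cst.
  by apply/funext => y; rewrite big_nil.
rewrite (_ : (fun _ => _) = fun y => f i y + \sum_(j <- s) f j y).
  exact: tameD.
by apply/funext => y; rewrite big_cons.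
Qed.

Lemma tame_pev n (p : mpoly n R) (X : Y -> 'rV[R]_n) :
  (forall i, tame (fun y => X y 0 i)) -> tame (fun y => pev p (X y)).
Proof.
move=> tX; elim/mpoly_ring_ind: p => [c|i|p q tp tq|p q tp tq].
- rewrite (_ : (fun _ => _) = fun=> c); first exact: tame_cst.
  by apply/funext => y; rewrite /pev mevalC.
- rewrite (_ : (fun _ => _) = fun y => X y 0 i)//.
  by apply/funext => y; rewrite /pev mevalXU.
- rewrite (_ : (fun _ => _) = fun y => pev p (X y) + pev q (X y)).
    exact: tameD.
  by apply/funext => y; rewrite /pev mevalD.
- rewrite (_ : (fun _ => _) = fun y => pev p (X y) * pev q (X y)).
    exact: tameM.
  by apply/funext => y; rewrite /pev mevalM.
Qed.

Definition cube_int f := Rintegral (lebesgue_tuple d.-1) cube f.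

Lemma tame_integrable f : tame f -> (lebesgue_tuple d.-1).-integrable cube (EFin \o f).
Proof.
move=> [mf [M fM]]; apply: measurable_bounded_integrable => //.
- exact: measurable_face_cube.
- by rewrite (_ : _ cube = 1%E) ?ltry//; exact: lebesgue_face_cube.
- exists M; split; first exact: num_real.
  by move=> N MN y /fM/le_trans; apply; exact: ltW.
Qed.

Lemma cube_intD f g : tame f -> tame g ->
  cube_int (fun y => f y + g y) = cube_int f + cube_int g.
Proof.
move=> tf tg; apply: RintegralD; first exact: measurable_face_cube.
  exact: tame_integrable.
exact: tame_integrable.
Qed.

Lemma cube_intB f g : tame f -> tame g ->
  cube_int (fun y => f y - g y) = cube_int f - cube_int g.
Proof.
move=> tf tg; apply: RintegralB; first exact: measurable_face_cube.
  exact: tame_integrable.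
exact: tame_integrable.
Qed.

Lemma cube_intZ c f : tame f -> cube_int (fun y => c * f y) = c * cube_int f.
Proof.
move=> tf; apply: RintegralZl; first exact: measurable_face_cube.
exact: tame_integrable.
Qed.

Lemma le_cube_int f g : tame f -> tame g -> (forall y, cube y -> f y <= g y) ->
  cube_int f <= cube_int g.
Proof.
move=> tf tg; apply: le_Rintegral; first exact: measurable_face_cube.
  exact: tame_integrable.
exact: tame_integrable.
Qed.

Lemma cube_int_cst c : cube_int (fun=> c) = c.
Proof.
rewrite /cube_int Rintegral_cst; last exact: measurable_face_cube.
rewrite (_ : _ cube = 1%E) ?mulr1//; exact: lebesgue_face_cube.
Qed.

Lemma normr_cube_int f g : tame f -> tame g -> (forall y, cube y -> `|f y| <= g y) ->
  `|cube_int f| <= cube_int g.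
Proof.
move=> tf tg fg; rewrite ler_norml -[- cube_int g]mulN1r -cube_intZ//.
rewrite !le_cube_int//; last first.
- by move=> y cy; rewrite mulN1r; have := fg y cy; rewrite ler_norml => /andP[].
- by apply: tameM => //; exact: tame_cst.
by move=> y cy; have := fg y cy; rewrite ler_norml => /andP[].
Qed.

End face_integrals.

(** * Inverse estimates on an element *)

Section element_estimates.
Variables (R : realType) (d : nat).
Implicit Types (V : {ffun 'I_d -> bool} -> 'rV[R]_d) (p P : mpoly d R).

Lemma pev_bounded p (r : R) : exists B, forall x : 'rV[R]_d,
  (forall i, `|x 0 i| <= r) -> `|pev p x| <= B.
Proof.
elim/mpoly_ring_ind: p => [c|i|p q [B pB] [C qC]|p q [B pB] [C qC]].
- by exists `|c| => x _; rewrite /pev mevalC.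
- by exists r => x xr; rewrite /pev mevalXU.
- exists (B + C) => x xr; rewrite /pev mevalD (le_trans (ler_normD _ _))//.
  by rewrite lerD ?pB ?qC.
- exists (B * C) => x xr; rewrite /pev mevalM normrM.
  by rewrite ler_pM ?pB ?qC.
Qed.

Lemma elt_near_mid V (sigma h : R) x k : 0 < sigma -> 0 < h -> regular_elt V sigma h ->
  elt V x -> `|x 0 k - ref_map V (cube_mid R d) 0 k| <= sigma * d%:R * h.
Proof.
move=> s0 h0 reg [z zc <-]; have cc := @cube_mid_in R d.
rewrite (le_trans (ref_map_lip s0 h0 reg k cc zc))//.
rewrite [sigma * d%:R * h]mulrAC ler_pM2l ?mulr_gt0//.
rewrite -[X in X%:R]card_ord -sum1_card natr_sum ler_sum// => i _.
have := zc i; rewrite mxE ler_norml => /andP[? ?].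
by apply/andP; split; lra.
Qed.

(** The integral over the element bounds the values, and the gradient, in a
    neighbourhood of size proportional to h, which may stick out of it. *)
Lemma elt_inverse (k : nat) (sigma ra : R) : 0 < sigma -> 0 <= ra ->
  exists2 C : R, 0 < C & forall V (h w : R) p P, 0 < h -> regular_elt V sigma h ->
  0 <= w -> (msize p <= k.+1)%N -> (forall x, w * pev p x ^+ 2 <= pev P x) ->
  forall x : 'rV[R]_d, (forall i, `|x 0 i - ref_map V (cube_mid R d) 0 i| <= ra * h) ->
  w * pev p x ^+ 2 * h ^+ d <= C * rv_integral (elt V) (pev P) /\
  forall l, w * (h * pev (mderiv l p) x) ^+ 2 * h ^+ d
    <= C * rv_integral (elt V) (pev P).
Proof.
move=> s0 ra0; have [c cE c0] : exists2 c, c = inner_radius d sigma & 0 < c.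
  by exists (inner_radius d sigma) => //; exact: inner_radius_gt0.
pose r := 1 + ra / (2 * c) + 1.
have r1 : 1 <= r by rewrite /r -addrA lerDl addr_ge0// divr_ge0// mulr_ge0// ltW.
have [C C0 HC] := @mpoly_L2 R d k r r1.
exists (C / (2 * c) ^+ d / Num.min 1 ((2 * c) ^+ 2)).
  by rewrite !divr_gt0// ?lt_min ?exprn_gt0 ?mulr_gt0 ?ltr01.
move=> V h w p P h0 reg w0 pk pP x xr.
pose s := 2 * c * h; have s_gt0 : 0 < s by rewrite !mulr_gt0.
pose a : 'rV[R]_d := \row_i (ref_map V (cube_mid R d) 0 i - c * h).
pose D := [set t : d.-tuple R | elt V (rv_of_tuple t)].
have P0 y : 0 <= pev P y by rewrite (le_trans _ (pP y))// mulr_ge0// sqr_ge0.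
have rvE (t : d.-tuple R) i : rv_of_tuple t 0 i = tnth t i by rewrite mxE.
pose Fc := ref_map V (cube_mid R d).
have [B PB] := pev_bounded P (\sum_i (`|Fc 0 i| + sigma * d%:R * h)).
have DB t : D t -> 0 <= pev P (rv_of_tuple t) <= B /\
    tbox (fun i => Fc 0 i - sigma * d%:R * h) (fun i => Fc 0 i + sigma * d%:R * h) t.
  move=> Dt; have near i := elt_near_mid i s0 h0 reg Dt; split.
    rewrite P0/= (le_trans (ler_norm _))// PB// => i.
    rewrite (bigD1 i)//= ler_wpDr ?sumr_ge0//.
      by move=> l _; rewrite addr_ge0// !mulr_ge0// ltW.
    rewrite -[rv_of_tuple t 0 i](subrK (Fc 0 i)) (le_trans (ler_normD _ _))//.
    by rewrite addrC lerD2l near.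
  by move=> i; have := near i; rewrite rvE ler_distl.
have boxD (t : d.-tuple R) : (forall i, a 0 i <= tnth t i <= a 0 i + s) ->
    D t /\ w * pev p (rv_of_tuple t) ^+ 2 <= pev P (rv_of_tuple t).
  move=> ta; split; last exact: pP.
  apply: (inner_box s0 h0 reg) => i; rewrite rvE ler_distl -cE.
  have := ta i; rewrite mxE -/Fc /s => /andP[h1 h2]; apply/andP; split=> //.
  by move: h2; lra.
have xa i : `|x 0 i - a 0 i| <= r * s.
  rewrite mxE opprB addrCA [c * h + _]addrC (le_trans (ler_normD _ _))//.
  have -> : r * s = ra * h + 2 * s by rewrite /r /s; field; rewrite gt_eqF.
  rewrite lerD ?xr// ger0_norm ?mulr_ge0 ?ltW// /s.
  by have := mulr_gt0 c0 h0; lra.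
set I := rv_integral _ _.
have I0 : 0 <= I by apply: Rintegral_ge0 => t _; exact: P0.
have [h1 h2] := HC p a s w B _ _ D (fun t => pev P (rv_of_tuple t)) pk s_gt0 w0 DB boxD x xa.
pose mm : R := Num.min 1 ((2 * c) ^+ 2).
have mm0 : 0 < mm by rewrite lt_min ltr01 exprn_gt0// mulr_gt0.
have ed : (2 * c) ^+ d != 0 by rewrite expf_neq0// gt_eqF// mulr_gt0.
have key X Y : 0 <= X -> X * s ^+ d <= C * I -> mm * Y <= X ->
    Y * h ^+ d <= C / (2 * c) ^+ d / mm * I.
  move=> X0 XI YX; have {}YX : Y <= X / mm by rewrite ler_pdivlMr// mulrC.
  apply: (@le_trans _ _ (X / mm * h ^+ d)).
    by rewrite ler_wpM2r// exprn_ge0// ltW.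
  have -> : X / mm * h ^+ d = X * s ^+ d / ((2 * c) ^+ d * mm).
    by rewrite /s exprMn; field; rewrite ed/= gt_eqF.
  have -> : C / (2 * c) ^+ d / mm * I = C * I / ((2 * c) ^+ d * mm).
    by field; rewrite ed/= gt_eqF.
  by rewrite ler_wpM2r// invr_ge0 mulr_ge0 ?exprn_ge0 ?mulr_ge0 ?ltW.
have X0 : 0 <= w * pev p x ^+ 2 by rewrite mulr_ge0// sqr_ge0.
split=> [|l].
  by apply: key h1 _ => //; rewrite ler_piMl// ge_min lexx.
apply: key (h2 l) _; first by rewrite mulr_ge0// sqr_ge0.
have -> : s * pev (mderiv l p) x = 2 * c * (h * pev (mderiv l p) x).
  by rewrite /s !mulrA.
rewrite mulrCA ler_wpM2l// [leRHS]exprMn ler_wpM2r ?sqr_ge0//.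
by rewrite ge_min lexx orbT.
Qed.

End element_estimates.

(** * Normal, density and traces as functions of the face parameter *)

Section face_data.
Variables (R : realType) (d : nat) (V : {ffun 'I_d -> bool} -> 'rV[R]_d).
Variables (sigma h : R) (j : 'I_d) (s : bool).
Local Notation RR := (measurableTypeR R).
Local Notation Y := (d.-1.-tuple RR).
Implicit Types (y : Y).

Lemma tame_prod (I : eqType) (r : seq I) (f : I -> Y -> R) :
  (forall i, tame (f i)) -> tame (fun y => \prod_(i <- r) f i y).
Proof.
move=> tf; elim: r => [|i r IH].
  rewrite (_ : (fun _ => _) = fun=> 1); first exact: tame_cst.
  by apply/funext => y; rewrite big_nil.
rewrite (_ : (fun _ => _) = fun y => f i y * \prod_(k <- r) f k y).
  exact: tameM.
by apply/funext => y; rewrite big_cons.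
Qed.

Lemma tame_sqrt (f : Y -> R) : tame f -> tame (fun y => Num.sqrt (f y)).
Proof.
move=> [mf [M fM]]; split; first exact: measurable_sqrtr.
exists (Num.sqrt M) => y cy; rewrite ger0_norm ?sqrtr_ge0// ler_wsqrtr//.
by rewrite (le_trans (ler_norm _))// fM.
Qed.

Lemma tame_norm (f : Y -> R) : tame f -> tame (fun y => `|f y|).
Proof.
move=> [mf [M fM]]; split; last by exists M => y cy; rewrite normr_id fM.
by apply: (measurableT_comp _ mf); exact: normr_measurable.
Qed.

Lemma tame_det n (A : Y -> 'M[R]_n) :
  (forall i k, tame (fun y => A y i k)) -> tame (fun y => \det (A y)).
Proof.
move=> tA; apply: tame_sum => u; apply: tameM; first exact: tame_cst.
by apply: tame_prod => i; exact: tA.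
Qed.

Lemma tame_ref_map (Z : Y -> 'rV[R]_d) : (forall i, tame (fun y => Z y 0 i)) ->
  forall k, tame (fun y => ref_map V (Z y) 0 k).
Proof.
move=> tZ k.
rewrite (_ : (fun _ => _) = fun y => \sum_(c : {ffun 'I_d -> bool})
    (\prod_i (if c i then Z y 0 i else 1 - Z y 0 i)) * V c 0 k); last first.
  by apply/funext => y; rewrite summxE; apply: eq_bigr => c _; rewrite mxE.
apply: tame_sum => c; apply: tameM; last exact: tame_cst.
apply: tame_prod => i; case: (c i); first exact: tZ.
by apply: tameB; [exact: tame_cst|exact: tZ].
Qed.

Lemma tame_slope (Z : Y -> 'rV[R]_d) : (forall i, tame (fun y => Z y 0 i)) ->
  forall i k, tame (fun y => slope V (Z y) i 0 k).
Proof.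
move=> tZ i k; have tU t l : tame (fun y => upd (Z y) i t 0 l).
  rewrite (_ : (fun _ => _) = fun y => if l == i then t else Z y 0 l).
    by case: (l == i); [exact: tame_cst|exact: tZ].
  by apply/funext => y; rewrite updE.
rewrite (_ : (fun _ => _) = fun y => ref_map V (upd (Z y) i 1) 0 k -
    ref_map V (upd (Z y) i 0) 0 k).
  by apply: tameB; apply: tame_ref_map => l; exact: tU.
by apply/funext => y; rewrite /slope mxE; congr (_ + _); rewrite mxE.
Qed.

Local Notation fp := (@face_param R d j s).
Local Notation J x := (jacobian (ref_map V) x).

Lemma face_param_cube y : face_cube y -> ref_cube (fp y).
Proof.
move=> cy i; rewrite mxE; case: (unlift j i) => [k|]; first exact: cy.
by case: s; rewrite /= ?lexx ?ler01.
Qed.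

Lemma tame_face_param i : tame (fun y => fp y 0 i).
Proof.
rewrite (_ : (fun _ => _) = fun y => if unlift j i is Some k then tnth y k else s%:R).
  case: (unlift j i) => [k|]; last exact: tame_cst.
  split; first by apply: measurable_funTS; exact: measurable_tnth.
  by exists 1 => y /(_ k)/andP[y0 y1]; rewrite ger0_norm.
by apply/funext => y; rewrite mxE.
Qed.

Lemma tame_face_point k : tame (fun y => ref_map V (fp y) 0 k).
Proof. exact/tame_ref_map/tame_face_param. Qed.

Lemma jacobianE x i k : J x i k = slope V x i 0 k.
Proof. by rewrite -row_jacobian [row _ _ 0 k]mxE. Qed.

Lemma tame_jacobian i k : tame (fun y => J (fp y) i k).
Proof.
rewrite (_ : (fun _ => _) = fun y => slope V (fp y) i 0 k).
  exact/tame_slope/tame_face_param.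
by apply/funext => y; rewrite jacobianE.
Qed.

Definition density y : R :=
  let B := row' j (J (fp y)) in Num.sqrt (\det (B *m B^T)).

Lemma tame_density : tame density.
Proof.
apply/tame_sqrt/tame_det => i k.
rewrite (_ : (fun _ => _) = fun y => \sum_l J (fp y) (lift j i) l * J (fp y) (lift j k) l).
  by apply: tame_sum => l; apply: tameM; exact: tame_jacobian.
by apply/funext => y; rewrite mxE; apply: eq_bigr => l _; rewrite !mxE.
Qed.

Lemma density_ge0 y : 0 <= density y. Proof. exact: sqrtr_ge0. Qed.

Lemma face_integralE (g : 'rV[R]_d -> 'rV[R]_d -> R) :
  face_integral V j s g =
  cube_int (fun y => g (outer_normal V j s (fp y)) (ref_map V (fp y)) * density y).
Proof. by []. Qed.

Hypotheses (h0 : 0 < h) (reg : regular_elt V sigma h).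

Lemma normal_le1 y k : face_cube y -> `|outer_normal V j s (fp y) 0 k| <= 1.
Proof.
move=> cy; have [<- _ _] := outer_normalP j s (jacobian_unit h0 reg (face_param_cube cy)).
exact: le_coord_enorm.
Qed.

(** The normal is bounded as a unit vector, and measurable as an algebraic
    expression in the Jacobian. *)
Lemma tame_normal k : tame (fun y => outer_normal V j s (fp y) 0 k).
Proof.
split; last by exists 1 => y; exact: normal_le1.
have minv i l : measurable_fun (face_cube : set Y) (fun y => invmx (J (fp y)) i l).
  apply: measurable_invmx => [y cy|a b]; last exact: (tame_jacobian a b).1.
  refine (jacobian_unit h0 reg (face_param_cube cy)).
pose m y : 'rV[R]_d := (-1) ^+ (~~ s) *: (col j (invmx (J (fp y))))^T.
have mm l : measurable_fun (face_cube : set Y) (fun y => m y 0 l).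
  rewrite (_ : (fun _ => _) = fun y => (-1) ^+ (~~ s) * invmx (J (fp y)) l j).
    by apply: measurable_funM; [exact: measurable_cst|exact: minv].
  by apply/funext => y; rewrite !mxE.
rewrite (_ : (fun _ => _) = fun y => (enorm (m y))^-1 * m y 0 k).
  apply: measurable_funM => //; apply: measurable_inv_nneg => [|y _]; last exact: enorm_ge0.
  apply: measurable_sqrtr; apply: measurable_sum => i.
  by apply: measurable_funM; exact: mm.
by apply/funext => y; rewrite /outer_normal -/(m y) mxE.
Qed.

Lemma face_density_bounds y : 0 < sigma -> face_cube y ->
  h * density y <= density_const d sigma * h ^+ d /\
  h ^+ d <= density_const d sigma * (h * density y).
Proof. by move=> s0 cy; exact: density_bounds (face_param_cube cy). Qed.

End face_data.

(** * Rigid motions *)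

Section rigid_motions.
Variables (R : realType) (d : nat).
Local Notation N := (d.+1%:R : R).

(** In the frame of the element a skew matrix becomes skew again, so that its
    row along the direction leaving the face is determined by the others. *)
Lemma skew_small (J W : 'M[R]_d) (j : 'I_d) (a b m : R) :
  J \in unitmx -> W^T = - W -> 0 <= m ->
  (forall i k, `|J i k| <= a) -> (forall i k, `|invmx J i k| <= b) ->
  (forall r i, r != j -> `|(J *m W) r i| <= m) ->
  forall i k, `|W i k| <= N ^+ 3 * b ^+ 2 * a * m.
Proof.
move=> Ju Wskew m0 Ja Jb JW i k; pose Y := J *m W *m J^T.
have a0 : 0 <= a by exact: le_trans (Ja i i).
have b0 : 0 <= b by exact: le_trans (Jb i i).
have Yskew r l : Y r l = - Y l r.
  have : Y^T = - Y by rewrite /Y !trmx_mul trmxK Wskew mulNmx mulmxN mulmxA.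
  by move/matrixP/(_ l r); rewrite !mxE.
have Yrow r l : r != j -> `|Y r l| <= N * (m * a).
  move=> rj; rewrite mxE (le_trans (ler_norm_sum _ _ _))//.
  apply: sum_le_const => [|i']; first by rewrite mulr_ge0.
  by rewrite normrM ler_pM// ?JW// mxE.
have Yall r l : `|Y r l| <= N * (m * a).
  have [rj|rj] := eqVneq r j; last exact: Yrow.
  have [lj|lj] := eqVneq l j; last by rewrite Yskew normrN Yrow.
  suff -> : Y r l = 0 by rewrite normr0 !mulr_ge0.
  by rewrite rj lj; have := Yskew j j; lra.
have -> : W = invmx J *m Y *m (invmx J)^T.
  rewrite /Y -!mulmxA -trmx_mul mulVmx// trmx1 mulmx1 mulmxA mulVmx//.
  by rewrite mul1mx.
have -> : N ^+ 3 * b ^+ 2 * a * m = N * (N * (b * (N * (m * a))) * b) by ring.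
have c0 : 0 <= N * (b * (N * (m * a))) by rewrite !mulr_ge0.
rewrite mxE (le_trans (ler_norm_sum _ _ _))//.
apply: sum_le_const => [|l]; first by rewrite mulr_ge0.
rewrite normrM ler_pM//; last by rewrite mxE.
rewrite mxE (le_trans (ler_norm_sum _ _ _))//.
apply: sum_le_const => [|l']; first by rewrite !mulr_ge0.
by rewrite normrM ler_pM.
Qed.

Definition sym_part (v : {ffun 'I_d -> mpoly d R}) i m : mpoly d R :=
  2^-1 *: (mderiv m (v i) + mderiv i (v m)).

Lemma pev_sym_part v i m x : pev (sym_part v i m) x = symgrad v x i m.
Proof. by rewrite /pev mevalZ mevalD !mxE. Qed.

Lemma mderiv2_sym_part (v : {ffun 'I_d -> mpoly d R}) i l m : mderiv l (mderiv m (v i)) =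
  mderiv l (sym_part v i m) + mderiv m (sym_part v i l) - mderiv i (sym_part v l m).
Proof.
rewrite !mderivZ !mderivD (mderiv_comm l m (v i)) (mderiv_comm i m (v l)).
rewrite (mderiv_comm i l (v m)) -scalerDr -scalerBr.
set a := mderiv l (mderiv m (v i)); set b := mderiv i (mderiv l (v m)).
set c := mderiv i (mderiv m (v l)).
rewrite (_ : a + b + (a + c) - (c + b) = 2%:R *: a).
  by rewrite scalerA mulVf ?scale1r// pnatr_eq0.
by rewrite scaler_nat mulr2n addrACA [c + b]addrC addrK.
Qed.

(** The symmetric gradient controls the second derivatives, hence the distance to
    the rigid motion whose rotation W is that of v at z. *)
Lemma near_rigid (v : {ffun 'I_d -> mpoly d R}) (z : 'rV[R]_d) (h ra E : R) :
  0 < h -> 0 <= ra -> 0 <= E ->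
  (forall x : 'rV[R]_d, (forall i, `|x 0 i - z 0 i| <= ra * h) -> forall i m,
     `|pev (sym_part v i m) x| <= E /\
     forall l, `|h * pev (mderiv l (sym_part v i m)) x| <= E) ->
  let W : 'M[R]_d := 2^-1 *: (vgrad v z - (vgrad v z)^T) in
  forall x : 'rV[R]_d, (forall i, `|x 0 i - z 0 i| <= ra * h) -> forall i,
    `|pev (v i) x - (pev (v i) z + \sum_m (x 0 m - z 0 m) * W i m)|
      <= (3 * N ^+ 2 * ra ^+ 2 + N * ra) * (E * h) /\
    forall m, `|pev (mderiv m (v i)) x - W i m| <= (3 * N * ra + 1) * E.
Proof.
move=> h0 ra0 E0 He W x xr i.
have N0 : 0 <= N by exact: ler0n.
have rh0 : 0 <= ra * h by rewrite mulr_ge0// ltW.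
have path (y : 'rV[R]_d) (t : R) : (forall i, `|y 0 i - z 0 i| <= ra * h) -> 0 <= t <= 1 ->
    forall i, `|(z + t *: (y - z)) 0 i - z 0 i| <= ra * h.
  move=> yr /andP[t0 t1] k; rewrite !mxE addrC addKr normrM ger0_norm//.
  by rewrite (le_trans _ (yr k))// ler_piMl.
have sumw (y : 'rV[R]_d) : (forall i, `|y 0 i - z 0 i| <= ra * h) ->
    \sum_k `|(y - z) 0 k| <= N * (ra * h).
  by move=> yr; apply: sum_le_const => // k; rewrite !mxE.
have d2 (y : 'rV[R]_d) l m k : (forall i, `|y 0 i - z 0 i| <= ra * h) ->
    `|pev (mderiv l (mderiv m (v k))) y| <= 3 * E / h.
  move=> yr; rewrite mderiv2_sym_part /pev mevalB mevalD -!/(pev _ _).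
  have e a b c : `|pev (mderiv a (sym_part v b c)) y| <= E / h.
    have [_ /(_ a)] := He y yr b c.
    by rewrite normrM (gtr0_norm h0) ler_pdivlMr// mulrC.
  rewrite (le_trans (ler_normB _ _))//.
  have -> : 3 * E / h = E / h + E / h + E / h by ring.
  by rewrite lerD ?e// (le_trans (ler_normD _ _))// lerD ?e.
have dgrad (y : 'rV[R]_d) m k : (forall i, `|y 0 i - z 0 i| <= ra * h) ->
    `|pev (mderiv m (v k)) y - pev (mderiv m (v k)) z| <= 3 * N * ra * E.
  move=> yr.
  have := @pev_taylor1 R d (mderiv m (v k)) z (y - z) (fun=> 0) (3 * E / h) _.
  rewrite [z + (y - z)]addrC subrK big1 ?subr0 => [H|l _]; last by rewrite mulr0.
  apply: (le_trans (H _)) => [t l t01|].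
    by rewrite subr0; apply: d2; exact: path.
  rewrite (@le_trans _ _ (3 * E / h * (N * (ra * h))))//.
    by rewrite ler_wpM2l ?sumw// divr_ge0 ?mulr_ge0 ?(ltW h0).
  by rewrite le_eqVlt; apply/orP; left; apply/eqP; field; rewrite gt_eqF.
have AW k m : `|pev (mderiv m (v k)) z - W k m| <= E.
  have -> : pev (mderiv m (v k)) z - W k m = pev (sym_part v k m) z.
    by rewrite pev_sym_part !mxE; field.
  by have [|//] := He z _ k m; move=> l; rewrite subrr normr0.
split; last first.
  move=> m; rewrite (le_trans (ler_distD (pev (mderiv m (v i)) z) _ _))//.
  by rewrite mulrDl mul1r lerD ?AW// dgrad.
have := @pev_taylor1 R d (v i) z (x - z) (fun m => pev (mderiv m (v i)) z)
  (3 * N * ra * E) _.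
rewrite [z + (x - z)]addrC subrK => H.
have {}H : `|pev (v i) x - pev (v i) z -
      \sum_m (x - z) 0 m * pev (mderiv m (v i)) z| <= 3 * N ^+ 2 * ra ^+ 2 * (E * h).
  apply: (le_trans (H _)) => [t l t01|]; first by apply: dgrad; exact: path.
  have -> : 3 * N ^+ 2 * ra ^+ 2 * (E * h) = 3 * N * ra * E * (N * (ra * h)) by ring.
  by rewrite ler_wpM2l ?sumw// !mulr_ge0.
set g := \sum_m _ in H.
rewrite (_ : pev (v i) x - _ = pev (v i) x - pev (v i) z - g +
    (g - \sum_m (x 0 m - z 0 m) * W i m)); last by ring.
rewrite (le_trans (ler_normD _ _))// mulrDl lerD// /g -sumrB.
rewrite (le_trans (ler_norm_sum _ _ _))//.
have -> : N * ra * (E * h) = N * (ra * h * E) by ring.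
apply: sum_le_const => [|m]; first by rewrite mulr_ge0.
by rewrite [X in X * _ - _]mxE [X in (_ + X) * _ - _]mxE -mulrBr normrM ler_pM// ?xr ?AW.
Qed.

End rigid_motions.

(** * Gradients controlled by the viscous seminorm and the trace *)

Section gradient_control.
Variables (R : realType) (d : nat).
Local Notation N := (d.+1%:R : R).
Implicit Types (V : {ffun 'I_d -> bool} -> 'rV[R]_d) (v : {ffun 'I_d -> mpoly d R}).

Lemma extTE (delta : 'rV[R]_d -> 'rV[R]_d) v x i :
  extT delta v x 0 i = pev (v i) x + \sum_m delta x 0 m * pev (mderiv m (v i)) x.
Proof.
rewrite [LHS]mxE [vev v x 0 i]mxE; congr (_ + _).
by rewrite mxE; apply: eq_bigr => m _; rewrite !mxE.
Qed.

Lemma frob_ge_entry (A : 'M[R]_d) i m : A i m ^+ 2 <= frob A A.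
Proof.
have ge0 a b : 0 <= A a b * A a b by rewrite -expr2 sqr_ge0.
rewrite /frob (bigD1 i)//= (bigD1 m)//= expr2 -addrA lerDl addr_ge0 ?sumr_ge0// => a _.
by rewrite sumr_ge0.
Qed.

Definition sqsum (f : 'I_d -> 'I_d -> mpoly d R) : mpoly d R :=
  \sum_i \sum_m f i m * f i m.

Lemma pev_sqsum f x : pev (sqsum f) x =
  frob (\matrix_(i, m) pev (f i m) x) (\matrix_(i, m) pev (f i m) x).
Proof.
rewrite /pev /sqsum /frob raddf_sum; apply: eq_bigr => i _.
by rewrite raddf_sum; apply: eq_bigr => m _; rewrite /= mevalM !mxE.
Qed.

Lemma pev_sq_symgrad v x : pev (sqsum (sym_part v)) x = frob (symgrad v x) (symgrad v x).
Proof.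
rewrite pev_sqsum (_ : \matrix_(i, m) _ = symgrad v x)//.
by apply/matrixP => i m; rewrite mxE pev_sym_part.
Qed.

Lemma pev_sq_grad v x :
  pev (sqsum (fun i m => mderiv m (v i))) x = frob (vgrad v x) (vgrad v x).
Proof. by rewrite pev_sqsum. Qed.

Lemma msize_sym_part k v i m : (forall l, (msize (v l) <= k.+1)%N) ->
  (msize (sym_part v i m) <= k.+1)%N.
Proof.
move=> vk; rewrite (leq_trans (msizeZ_le _ _))// (leq_trans (msizeD_le _ _))//.
by rewrite geq_max !msize_mderiv.
Qed.

Lemma frob_ge0 (A : 'M[R]_d) : 0 <= frob A A.
Proof. by apply: sumr_ge0 => i _; apply: sumr_ge0 => m _; rewrite -expr2 sqr_ge0. Qed.

Lemma grad_control_full (k : nat) (sigma ra : R) : 0 < sigma -> 0 <= ra ->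
  exists2 C : R, 0 < C & forall V (h : R) v, 0 < h -> regular_elt V sigma h ->
  (forall i, (msize (v i) <= k.+1)%N) ->
  forall x : 'rV[R]_d,
    (forall i, `|x 0 i - ref_map V (cube_mid R d) 0 i| <= ra * h) -> forall i m,
  pev (mderiv m (v i)) x ^+ 2 * h ^+ d
    <= C * rv_integral (elt V) (fun y => frob (vgrad v y) (vgrad v y)).
Proof.
move=> s0 ra0; have [C C0 HC] := @elt_inverse R d k sigma ra s0 ra0.
exists C => // V h v h0 reg vk x xr i m.
pose P := sqsum (fun i m => mderiv m (v i)).
have [|+ _] := HC V h 1 (mderiv m (v i)) P h0 reg ler01 (msize_mderiv _ (vk i)) _ x xr.
  move=> y; rewrite mul1r pev_sq_grad.
  by have := frob_ge_entry (vgrad v y) i m; rewrite [vgrad v y i m]mxE.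
rewrite mul1r (_ : (fun y => frob _ _) = pev P)//.
by apply/funext => y; rewrite pev_sq_grad.
Qed.

(** The parametrisation of a face as a map of row vectors, to which [seppoly]
    applies. *)
Definition face_row (j : 'I_d) (s : bool) (z : 'rV[R]_d.-1) : 'rV[R]_d :=
  \row_i (if unlift j i is Some k then z 0 k else s%:R).

Lemma face_rowE j s (y : d.-1.-tuple R) : face_param j s y = face_row j s (rv_of_tuple y).
Proof.
apply/rowP => i; rewrite !mxE; case: (unlift j i) => // k.
by rewrite mxE.
Qed.

Lemma face_row_upd j s z l t :
  face_row j s (upd z l t) = upd (face_row j s z) (lift j l) t.
Proof.
apply/rowP => i; rewrite !mxE; case: unliftP => [k ->|->].
  by rewrite (inj_eq lift_inj) mxE.
by rewrite (negPf (neq_lift _ _)).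
Qed.

Lemma face_row_cube j s (z : 'rV[R]_d.-1) : (forall l, 0 <= z 0 l <= 1) -> ref_cube (face_row j s z).
Proof.
move=> z01 i; rewrite mxE; case: (unlift j i) => [k|]; first exact: z01.
by case: s; rewrite /= ?lexx ?ler01.
Qed.

(** An affine function is multilinear in the parameters of a face. *)
Lemma seppoly_face V j s (c : R) (a : 'I_d -> R) (b : 'rV[R]_d) :
  seppoly 1 (fun z => c + \sum_m (ref_map V (face_row j s z) 0 m - b 0 m) * a m).
Proof.
move=> z l; pose p0 := upd (face_row j s z) (lift j l) 0.
exists ((c + \sum_m (ref_map V p0 0 m - b 0 m) * a m)%:P +
    (\sum_m slope V p0 (lift j l) 0 m * a m) *: 'X).
  rewrite (leq_trans (size_polyD _ _))// geq_max (leq_trans (size_polyC_leq1 _))//=.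
  by rewrite (leq_trans (size_scale_leq _ _))// size_polyX.
move=> t; rewrite !hornerE face_row_upd -[in RHS]addrA; congr (_ + _).
rewrite mulr_suml -big_split/=; apply: eq_bigr => m _.
have := ref_map_step V p0 (lift j l) t; rewrite upd_upd updE eqxx subr0.
move=> /(congr1 (fun w : 'rV_d => w 0 m)); rewrite !mxE => /eqP.
by rewrite subr_eq => /eqP ->; ring.
Qed.

(** Passes to the reference face by the lower bound on the area element. *)
Lemma cube_int_sq_le (f g rho : d.-1.-tuple R -> R) (h H K : R) :
  tame f -> tame g -> tame rho -> 0 <= H -> (forall y, f y ^+ 2 <= g y) ->
  (forall y, face_cube y -> H <= K * (h * rho y)) ->
  H * cube_int (fun y => f y ^+ 2) <= K * h * cube_int (fun y => g y * rho y).
Proof.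
move=> tf tg trho H0 fg Hrho.
have tf2 : tame (fun y => f y ^+ 2) by exact: tameM.
have tgr : tame (fun y => g y * rho y) by exact: tameM.
rewrite -!cube_intZ//; apply: le_cube_int.
- by apply: tameM => //; exact: tame_cst.
- by apply: tameM => //; exact: tame_cst.
move=> y cy; have g0 : 0 <= g y by rewrite (le_trans _ (fg y))// sqr_ge0.
apply: (@le_trans _ _ (H * g y)); first by rewrite ler_wpM2l.
have -> : K * h * (g y * rho y) = (K * (h * rho y)) * g y by ring.
by rewrite ler_wpM2r// Hrho.
Qed.

End gradient_control.

Section korn.
Variables (R : realType) (d : nat).
Local Notation N := (d.+1%:R : R).
Implicit Types (V : {ffun 'I_d -> bool} -> 'rV[R]_d) (v : {ffun 'I_d -> mpoly d R}).

Local Notation near V ra h x :=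
  (forall i, `|x 0 i - ref_map V (cube_mid R d) 0 i| <= ra * h).

Lemma face_point_near V sigma h ra x : 0 < sigma -> 0 < h -> regular_elt V sigma h ->
  sigma * d%:R <= ra -> ref_cube x -> near V ra h (ref_map V x).
Proof.
move=> s0 h0 reg sra xc i.
have := elt_near_mid i s0 h0 reg (ex_intro2 _ _ x xc erefl).
by move=> /le_trans; apply; rewrite ler_wpM2r// ltW.
Qed.

Lemma sqr_le2 (a b c : R) : `|a - b| <= c -> b ^+ 2 <= 2 * a ^+ 2 + 2 * c ^+ 2.
Proof.
move=> abc; have : (a - b) ^+ 2 <= c ^+ 2.
  rewrite -[leLHS]real_normK ?num_real// lerXn2r// ?nnegrE//.
  exact: le_trans abc.
by have := sqr_ge0 (2 * a - b); nra.
Qed.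

(** Local Korn inequality.  The face determines the rotation of the nearest
    rigid motion, and the Taylor extension is a perturbation of the trace that
    is absorbed when eps is small. *)
Lemma korn_local (k : nat) (sigma ra c_d : R) : 0 < sigma -> 0 <= c_d ->
  sigma * d%:R <= ra ->
  exists C eta : R, [/\ 0 < C, 0 < eta &
  forall V (h eps : R) (j : 'I_d) (s : bool) (delta : 'rV[R]_d -> 'rV[R]_d) v,
  0 < h -> regular_elt V sigma h -> 0 <= eps -> eps <= c_d -> eps <= eta ->
  (forall i, (msize (v i) <= k.+1)%N) ->
  (forall i, tame (fun y : d.-1.-tuple (measurableTypeR R) =>
     delta (ref_map V (face_param j s y)) 0 i)) ->
  (forall y i, face_cube y ->
     `|delta (ref_map V (face_param j s y)) 0 i| <= eps * h) ->
  forall x : 'rV[R]_d, near V ra h x -> forall i m,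
  h ^+ 2 * pev (mderiv m (v i)) x ^+ 2 * h ^+ d
    <= C * (h ^+ 2 * rv_integral (elt V) (fun y => frob (symgrad v y) (symgrad v y))
       + h * cube_int (fun y => dot (extT delta v (ref_map V (face_param j s y)))
                                    (extT delta v (ref_map V (face_param j s y)))
                                * density V j s y))].
Proof.
move=> s0 cd0 sra; have ra0 : 0 <= ra by apply: le_trans sra; rewrite mulr_ge0// ltW.
have N0 : 0 <= N by exact: ler0n.
have [C1 C10 HC1] := @elt_inverse R d k sigma ra s0 ra0.
have [C2 C20 HC2] := @seppoly_L2 R 1 d.-1 1 (lexx 1).
(* c1 and c3 bound the distance of v and of its gradient to the rigid motion, c2
   the rotation by the vertex values on the face, c7 the distance of v^T to the
   rigid motion; q measures the rotation that comes back through v^T *)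
pose c1 := 3 * N ^+ 2 * ra ^+ 2 + N * ra; pose c3 := 3 * N * ra + 1.
pose c2 := N * (N * (N ^+ 3 * sigma ^+ 2 * sigma * 2)).
pose c7 := c1 + N * c_d * c3; pose K := density_const d sigma.
have c10 : 0 <= c1 by rewrite addr_ge0 ?mulr_ge0 ?exprn_ge0.
have c30 : 0 <= c3 by rewrite addr_ge0 ?mulr_ge0.
have c20 : 0 <= c2 by rewrite !mulr_ge0 ?exprn_ge0 ?(ltW s0).
have c70 : 0 <= c7 by rewrite addr_ge0 ?mulr_ge0.
have K0 : 0 <= K by rewrite !mulr_ge0 ?exprn_ge0 ?(ltW s0).
have c1E : c1 = 3 * N ^+ 2 * ra ^+ 2 + N * ra by [].
have c2E : c2 = N * (N * (N ^+ 3 * sigma ^+ 2 * sigma * 2)) by [].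
have c3E : c3 = 3 * N * ra + 1 by [].
have c7E : c7 = c1 + N * c_d * c3 by [].
have KE : K = density_const d sigma by [].
clearbody c7 c1 c2 c3 K.
pose q := 1 + 4 * c2 ^+ 2 * C2 * N ^+ 2.
have q1 : 1 <= q by rewrite lerDl !mulr_ge0 ?sqr_ge0 ?(ltW C20).
have q0 : 0 < q by exact: lt_le_trans q1.
pose CT := 8 * c2 ^+ 2 * C2 * K; pose CE := (16 * c2 ^+ 2 * C2 * c7 ^+ 2 + 2 * c3 ^+ 2) * C1.
have CT0 : 0 <= CT by rewrite !mulr_ge0 ?sqr_ge0 ?(ltW C20).
have CE0 : 0 <= CE.
  by rewrite mulr_ge0 ?(ltW C10)// addr_ge0// !mulr_ge0 ?sqr_ge0 ?(ltW C20).
exists (1 + CT + CE), (2 * q)^-1; split.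
- by rewrite -addrA ltr_wpDr ?addr_ge0.
- by rewrite invr_gt0 mulr_gt0.
move=> V h eps j s delta v h0 reg eps0 epscd epseta vk td dle x xr i m.
set I := rv_integral _ _.
set T := cube_int _.
pose H := h ^+ d; have H0 : 0 < H by rewrite exprn_gt0.
have I0 : 0 <= I by apply: Rintegral_ge0 => t _; exact: frob_ge0.
pose E := Num.sqrt (C1 * I / H).
have E0 : 0 <= E by exact: sqrtr_ge0.
have EH : E ^+ 2 * H = C1 * I.
  by rewrite sqr_sqrtr ?divr_ge0 ?mulr_ge0 ?(ltW C10) ?(ltW H0)// divfK// gt_eqF.
have sqE u : u ^+ 2 * H <= C1 * I -> `|u| <= E.
  rewrite -EH ler_pM2r// => uE.
  by rewrite -(@ler_pXn2r _ 2)// ?nnegrE// real_normK ?num_real.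
pose z := ref_map V (cube_mid R d).
have symE (y : 'rV[R]_d) : near V ra h y -> forall a b, `|pev (sym_part v a b) y| <= E /\
    forall l, `|h * pev (mderiv l (sym_part v a b)) y| <= E.
  move=> yr a b; pose P := sqsum (sym_part v).
  have IE : I = rv_integral (elt V) (pev P).
    by congr (rv_integral _ _); apply/funext => w; rewrite pev_sq_symgrad.
  have [|e1 e2] := HC1 V h 1 (sym_part v a b) P h0 reg ler01 (msize_sym_part _ _ vk) _ y yr.
    move=> w; rewrite mul1r pev_sq_symgrad pev_sym_part.
    exact: frob_ge_entry.
  split; first by apply: sqE; move: e1; rewrite mul1r IE.
  by move=> l; apply: sqE; move: (e2 l); rewrite mul1r IE.
have := near_rigid h0 ra0 E0 symE; set W : 'M[R]_d := _ *: _ => /= rigid.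
pose Wm := \sum_a \sum_b `|W a b|.
have Wle a b : `|W a b| <= Wm.
  rewrite /Wm (bigD1 a)//= (bigD1 b)//= -addrA lerDl addr_ge0 ?sumr_ge0// => a' _.
  by rewrite sumr_ge0.
have Wm0 : 0 <= Wm by rewrite sumr_ge0// => a _; rewrite sumr_ge0.
have gradE (y : 'rV[R]_d) a b : near V ra h y -> `|pev (mderiv b (v a)) y| <= Wm + c3 * E.
  move=> yr; have [_ /(_ b) h1] := rigid y yr a.
  by rewrite -[pev _ _](subrK (W a b)) (le_trans (ler_normD _ _))// [leRHS]addrC lerD ?Wle// c3E.
pose g a (y : 'rV[R]_d) := pev (v a) z + \sum_b (y 0 b - z 0 b) * W a b.
pose bb := c1 * (E * h) + N * (eps * h * (Wm + c3 * E)).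
have bb0 : 0 <= bb by rewrite addr_ge0 ?mulr_ge0 ?addr_ge0 ?mulr_ge0 ?(ltW h0).
pose X y := ref_map V (face_param j s y).
have Xnear y : face_cube y -> near V ra h (X y).
  by move=> cy; apply: (face_point_near s0 h0 reg sra); exact: face_param_cube.
have extg y a : face_cube y -> `|extT delta v (X y) 0 a - g a (X y)| <= bb.
  move=> cy; have [h1 _] := rigid _ (Xnear y cy) a.
  rewrite extTE addrAC (le_trans (ler_normD _ _))//.
  apply: lerD; first by rewrite c1E.
  rewrite (le_trans (ler_norm_sum _ _ _))//.
  apply: sum_le_const => [|b].
    by rewrite !mulr_ge0 ?addr_ge0 ?mulr_ge0 ?(ltW h0).
  by rewrite normrM ler_pM// ?dle// gradE//; exact: Xnear.
have tX l : tame (fun y => X y 0 l) by exact: tame_face_point.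
have text a : tame (fun y => extT delta v (X y) 0 a).
  rewrite (_ : (fun _ => _) = fun y => pev (v a) (X y) +
      \sum_b delta (X y) 0 b * pev (mderiv b (v a)) (X y)).
    apply: tameD; first exact: tame_pev.
    by apply: tame_sum => b; apply: tameM; [exact: td|exact: tame_pev].
  by apply/funext => y; rewrite extTE.
have tdot : tame (fun y => dot (extT delta v (X y)) (extT delta v (X y))).
  by apply: tame_sum => a; apply: tameM; exact: text.
have trho : tame (density V j s) by exact: tame_density.
have HT a : H * cube_int (fun y => extT delta v (X y) 0 a ^+ 2) <= K * h * T.
  apply: cube_int_sq_le (ltW H0) _ _ => //.
    move=> y; rewrite /dot (bigD1 a)//= expr2 lerDl sumr_ge0// => b _.
    by rewrite -expr2 sqr_ge0.
  by move=> y cy; rewrite KE; have [] := @face_density_bounds R d V sigma h j s h0 reg y s0 cy.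
pose mm := Num.sqrt (C2 * (2 * K * h * T / H + 2 * bb ^+ 2)).
have T0 : 0 <= T.
  apply: Rintegral_ge0 => y _; rewrite mulr_ge0 ?density_ge0//.
  exact: dotxx_ge0.
have mm0 : 0 <= mm by exact: sqrtr_ge0.
have mmH : mm ^+ 2 * H = C2 * (2 * K * h * T + 2 * bb ^+ 2 * H).
  rewrite sqr_sqrtr; first by field; rewrite gt_eqF.
  by rewrite mulr_ge0 ?(ltW C20)// addr_ge0 ?mulr_ge0 ?sqr_ge0 ?invr_ge0 ?(ltW h0) ?(ltW H0).
(* the rigid motion at the vertices of the face, from its mean square there *)
have gface a (w : 'rV[R]_d.-1) : (forall l, 0 <= w 0 l <= 1) ->
    `|g a (ref_map V (face_row j s w))| <= mm.
  move=> w01; pose G (y : d.-1.-tuple R) := 2 * extT delta v (X y) 0 a ^+ 2 + 2 * bb ^+ 2.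
  have text2 : tame (fun y => extT delta v (X y) 0 a ^+ 2) by exact: tameM.
  have t2 : tame (fun y => 2 * extT delta v (X y) 0 a ^+ 2).
    by apply: tameM => //; exact: tame_cst.
  have tG : tame G by apply: tameD => //; exact: tame_cst.
  have [M GM] := tG.2.
  have DG (t : d.-1.-tuple R) : face_cube t ->
      0 <= G t <= M /\ tbox (fun=> 0) (fun=> 1) t.
    move=> ct; split; last by move=> l; exact: ct.
    rewrite (le_trans (ler_norm _) (GM _ ct)) andbT.
    by rewrite addr_ge0// mulr_ge0// sqr_ge0.
  pose G' (w : 'rV[R]_d.-1) := g a (ref_map V (face_row j s w)).
  have boxG (t : d.-1.-tuple R) :
      (forall l, (0 : 'rV[R]_d.-1) 0 l <= tnth t l <= (0 : 'rV[R]_d.-1) 0 l + 1) ->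
      face_cube t /\ 1 * G' (rv_of_tuple t) ^+ 2 <= G t.
    move=> t01; have ct : face_cube t.
      by move=> l; have := t01 l; rewrite mxE add0r.
    split => //; rewrite mul1r /G' -face_rowE; exact: sqr_le2 (extg t a ct).
  have wr l : `|w 0 l - (0 : 'rV[R]_d.-1) 0 l| <= 1 * 1.
    by rewrite mxE subr0 mulr1; have /andP[? ?] := w01 l; rewrite ger0_norm.
  have [+ _] := HC2 G' 0 1 1 M _ _ face_cube G (@seppoly_face R d V j s _ _ _)
    ltr01 ler01 DG boxG w wr.
  rewrite mul1r expr1n mulr1 => gle.
  rewrite -(@ler_pXn2r _ 2)// ?nnegrE// real_normK ?num_real//.
  rewrite -(ler_pM2r H0) mmH (le_trans (ler_wpM2r (ltW H0) gle))//.
  rewrite -[leLHS]mulrA ler_pM2l// (_ : Rintegral _ _ _ = cube_int G)//.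
  rewrite /G cube_intD//; last exact: tame_cst.
  rewrite cube_intZ// cube_int_cst mulrDl lerD2r.
  by have := HT a; lra.
pose p0 : 'rV[R]_d := face_row j s 0.
have p0c : ref_cube p0 by apply: face_row_cube => l; rewrite mxE lexx ler01.
pose J0 := jacobian (ref_map V) p0.
(* differences of the rigid motion along the edges of the face are the rows of
   J W other than row j *)
have hW : h * Wm <= c2 * mm.
  have Wb a b : `|W a b| <= N ^+ 3 * (sigma / h) ^+ 2 * (sigma * h) * (2 * mm).
    apply: (@skew_small R d J0 W j).
    - exact: (jacobian_unit h0 reg p0c).
    - by apply/matrixP => a' b'; rewrite !mxE; ring.
    - by rewrite mulr_ge0.
    - by move=> a' b'; rewrite jacobianE; exact: (slope_bound reg).
    - by move=> a' b'; exact: (invmx_jacobian_bound h0 reg).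
    move=> r b' rj.
    have [l rE] : exists l, r = lift j l.
      by move: rj; case: (unliftP j r) => [l -> _|->]; [exists l|rewrite eqxx].
    have -> : (J0 *m W) r b' = g b' (ref_map V (face_row j s (upd (0 : 'rV[R]_d.-1) l 0))) -
        g b' (ref_map V (face_row j s (upd (0 : 'rV[R]_d.-1) l 1))).
      rewrite mxE /g opprD addrACA subrr add0r -sumrB; apply: eq_bigr => a' _.
      rewrite /J0 jacobianE /slope rE !face_row_upd.
      rewrite [X in X * _]mxE [X in (_ + X) * _]mxE.
      have -> : W a' b' = - W b' a' by rewrite !mxE; ring.
      by ring.
    rewrite (le_trans (ler_normB _ _))// mulrDl mul1r.
    by rewrite lerD// gface// => l'; rewrite !mxE; case: ifP; rewrite lexx ler01.
  have Wb0 : 0 <= N ^+ 3 * (sigma / h) ^+ 2 * (sigma * h) * (2 * mm).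
    by rewrite !mulr_ge0 ?exprn_ge0 ?invr_ge0 ?(ltW s0) ?(ltW h0).
  have -> : c2 * mm = h * (N * (N * (N ^+ 3 * (sigma / h) ^+ 2 * (sigma * h) * (2 * mm)))).
    by rewrite c2E; field; rewrite gt_eqF.
  rewrite ler_pM2l//; apply: sum_le_const => [|a]; first by rewrite mulr_ge0.
  by apply: sum_le_const.
have dle' : h * `|pev (mderiv m (v i)) x| <= h * Wm + c3 * (E * h).
  rewrite (_ : h * Wm + _ = h * (Wm + c3 * E)); last by ring.
  by rewrite ler_pM2l// gradE.
(* from here on only the rotation om and the deformation e matter *)
pose om := h * Wm; pose e := E * h.
have om0 : 0 <= om by rewrite mulr_ge0// ltW.
have e0 : 0 <= e by rewrite mulr_ge0// ltW.
have eH : e ^+ 2 * H = h ^+ 2 * (C1 * I) by rewrite -EH /e; ring.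
have omle : om <= c2 * mm by exact: hW.
have dle'' : h * `|pev (mderiv m (v i)) x| <= om + c3 * e by exact: dle'.
have bble : bb <= c7 * e + N * eps * om.
  have -> : bb = (c1 + N * eps * c3) * e + N * eps * om by rewrite /bb /e /om; ring.
  by rewrite lerD2r ler_wpM2r// c7E lerD2l ler_wpM2r// ler_wpM2l.
clearbody om e bb.
have bb2 : bb ^+ 2 <= 2 * (c7 ^+ 2 * e ^+ 2) + 2 * (N ^+ 2 * eps ^+ 2 * om ^+ 2).
  apply: (@le_trans _ _ ((c7 * e + N * eps * om) ^+ 2)).
    by rewrite lerXn2r// ?nnegrE ?addr_ge0 ?mulr_ge0.
  have := sqr_ge0 (c7 * e - N * eps * om).
  by rewrite !sqrrB !sqrrD !exprMn; lra.
have eps2 : q * eps ^+ 2 <= 1 / 2.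
  have : eps ^+ 2 <= (2 * q)^-1.
    have e1 : eps <= 1.
      by rewrite (le_trans epseta)// invf_le1 ?mulr_gt0//; move: q1; lra.
    by rewrite expr2 (le_trans _ epseta)// ler_piMr.
  rewrite -(ler_pM2l q0) => /le_trans; apply.
  by rewrite le_eqVlt; apply/orP; left; apply/eqP; field; rewrite gt_eqF.
have om2 : om ^+ 2 <= c2 ^+ 2 * mm ^+ 2.
  by rewrite -exprMn lerXn2r// ?nnegrE// mulr_ge0.
have omH : om ^+ 2 * H <= c2 ^+ 2 * (C2 * (2 * K * h * T + 2 * bb ^+ 2 * H)).
  by rewrite -mmH mulrA ler_wpM2r// ltW.
have absorb : om ^+ 2 * H <= 2 * (c2 ^+ 2 * C2 * (2 * K * h * T + 4 * c7 ^+ 2 * (e ^+ 2 * H))).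
  pose Q := c2 ^+ 2 * C2; have Q0 : 0 <= Q by rewrite mulr_ge0 ?sqr_ge0// ltW.
  have b1 : Q * (bb ^+ 2 * H) <= Q * (2 * (c7 ^+ 2 * e ^+ 2) * H + 2 * (N ^+ 2 * eps ^+ 2 * om ^+ 2) * H).
    by rewrite ler_wpM2l// -mulrDl ler_wpM2r// ltW.
  have b2 : 4 * Q * (N ^+ 2 * eps ^+ 2 * om ^+ 2) * H <= 1 / 2 * (om ^+ 2 * H).
    have -> : 4 * Q * (N ^+ 2 * eps ^+ 2 * om ^+ 2) * H =
        (4 * Q * N ^+ 2 * eps ^+ 2) * (om ^+ 2 * H) by ring.
    rewrite ler_wpM2r ?mulr_ge0 ?sqr_ge0 ?(ltW H0)// (le_trans _ eps2)//.
    rewrite ler_wpM2r ?sqr_ge0// /q /Q.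
    by rewrite (_ : 4 * (c2 ^+ 2 * C2) * N ^+ 2 = 4 * c2 ^+ 2 * C2 * N ^+ 2) ?lerDr//; ring.
  move: omH b1 b2; rewrite (_ : c2 ^+ 2 * (C2 * _) = Q * (2 * K * h * T) + 2 * (Q * (bb ^+ 2 * H))); last by rewrite /Q; ring.
  rewrite -/Q; lra.
have sq : (h * pev (mderiv m (v i)) x) ^+ 2 <= 2 * om ^+ 2 + 2 * (c3 ^+ 2 * e ^+ 2).
  have : `|h * pev (mderiv m (v i)) x| <= om + c3 * e.
    by rewrite normrM (gtr0_norm h0).
  move=> le1; have : (h * pev (mderiv m (v i)) x) ^+ 2 <= (om + c3 * e) ^+ 2.
    rewrite -[leLHS]real_normK ?num_real// lerXn2r// ?nnegrE//.
    exact: le_trans le1.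
  move=> /le_trans; apply; have := sqr_ge0 (om - c3 * e).
  by rewrite !sqrrB !sqrrD !exprMn; lra.
rewrite -exprMn (le_trans (ler_wpM2r (ltW H0) sq))//.
have fin : (2 * om ^+ 2 + 2 * (c3 ^+ 2 * e ^+ 2)) * H <= CT * (h * T) + CE * (h ^+ 2 * I).
  have -> : CE * (h ^+ 2 * I) = (16 * c2 ^+ 2 * C2 * c7 ^+ 2 + 2 * c3 ^+ 2) * (e ^+ 2 * H).
    by rewrite eH /CE; ring.
  by rewrite /CT; lra.
rewrite (le_trans fin)//.
have hT0 : 0 <= h * T by rewrite mulr_ge0// ltW.
have hI0 : 0 <= h ^+ 2 * I by rewrite mulr_ge0// sqr_ge0.
have := mulr_ge0 CT0 hI0; have := mulr_ge0 CE0 hT0.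
by lra.
Qed.

End korn.

(** * Face terms of the forms *)

Section local_forms.
Variables (R : realType) (d : nat).
Local Notation N := (d.+1%:R : R).
Implicit Types (V : {ffun 'I_d -> bool} -> 'rV[R]_d) (v : {ffun 'I_d -> mpoly d R}).

(** Cauchy-Schwarz from the weighted arithmetic-geometric mean inequality; used
    for integrals and for sums. *)
Lemma le_of_amgm (x a b : R) : 0 <= a -> 0 <= b ->
  (forall t, 0 < t -> x <= (t * a ^+ 2 + b ^+ 2 / t) / 2) -> x <= a * b.
Proof.
move=> a0 b0 H; apply/ler_addgt0Pr => e e0.
pose eta := e / (1 + a + b); have s0 : 0 < 1 + a + b by rewrite -addrA ltr_wpDr ?addr_ge0.
have eta0 : 0 < eta by rewrite divr_gt0.
(* the optimal weight is b / a, and eta is there because a or b may vanish *)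
have t0 : 0 < (b + eta) / (a + eta) by rewrite divr_gt0 ?ltr_wpDl.
have ae : 0 < a + eta by rewrite ltr_wpDl.
have be : 0 < b + eta by rewrite ltr_wpDl.
have := H _ t0; move=> /le_trans; apply.
have h1 : (b + eta) / (a + eta) * a ^+ 2 <= (b + eta) * a.
  rewrite mulrAC ler_pdivrMr// -mulrA ler_pM2l// expr2 ler_wpM2l//.
  by rewrite lerDl ltW.
have h2 : b ^+ 2 / ((b + eta) / (a + eta)) <= (a + eta) * b.
  rewrite invf_div mulrA ler_pdivrMr// mulrC -mulrA ler_pM2l// expr2 ler_wpM2l//.
  by rewrite lerDl ltW.
have h3 : eta * (a + b) <= e.
  have -> : e = eta * (1 + a + b) by rewrite /eta divfK// gt_eqF.
  by rewrite ler_pM2l//; lra.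
by lra.
Qed.

Definition visc_sq (sym : bool) v x : R :=
  if sym then frob (symgrad v x) (symgrad v x) else frob (vgrad v x) (vgrad v x).

Local Notation near V ra h x :=
  (forall i, `|x 0 i - ref_map V (cube_mid R d) 0 i| <= ra * h).

(** The regular gradient needs the integral over the element alone; the trace and
    the threshold eta come from the Korn inequality of the symmetric one. *)
Lemma grad_control (sym : bool) (k : nat) (sigma ra c_d : R) : 0 < sigma ->
  0 <= c_d -> sigma * d%:R <= ra ->
  exists C eta : R, [/\ 0 < C, 0 < eta &
  forall V (h eps : R) (j : 'I_d) (s : bool) (delta : 'rV[R]_d -> 'rV[R]_d) v,
  0 < h -> regular_elt V sigma h -> 0 <= eps -> eps <= c_d -> (sym -> eps <= eta) ->
  (forall i, (msize (v i) <= k.+1)%N) ->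
  (forall i, tame (fun y : d.-1.-tuple (measurableTypeR R) =>
     delta (ref_map V (face_param j s y)) 0 i)) ->
  (forall y i, face_cube y ->
     `|delta (ref_map V (face_param j s y)) 0 i| <= eps * h) ->
  forall x : 'rV[R]_d, near V ra h x -> forall i m,
  pev (mderiv m (v i)) x ^+ 2 * h ^+ d
    <= C * (rv_integral (elt V) (visc_sq sym v) +
       face_integral V j s (fun _ x => dot (extT delta v x) (extT delta v x)) / h)].
Proof.
move=> s0 cd0 sra; have ra0 : 0 <= ra by apply: le_trans sra; rewrite mulr_ge0// ltW.
case: sym.
  have [C [eta [C0 eta0 HC]]] := korn_local k s0 cd0 sra.
  exists C, eta; split=> // V h eps j s delta v h0 reg e0 ec ee vk td dle x xr i m.
  have := HC V h eps j s delta v h0 reg e0 ec (ee isT) vk td dle x xr i m.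
  set I := rv_integral _ _; set T := cube_int _ => le1.
  rewrite -/I face_integralE -/T -(@ler_pM2l _ (h ^+ 2)) ?exprn_gt0// mulrA.
  rewrite (le_trans le1)// le_eqVlt; apply/orP; left; apply/eqP.
  by field; rewrite gt_eqF.
have [C C0 HC] := grad_control_full d k s0 ra0.
exists C, 1; split=> // V h eps j s delta v h0 reg e0 ec _ vk td dle x xr i m.
rewrite (le_trans (HC V h v h0 reg vk x xr i m))// ler_pM2l// lerDl divr_ge0 ?(ltW h0)//.
apply: Rintegral_ge0 => y _; rewrite mulr_ge0 ?density_ge0//; exact: dotxx_ge0.
Qed.

Section on_a_face.
Variables (V : {ffun 'I_d -> bool} -> 'rV[R]_d) (sigma h : R) (j : 'I_d) (s : bool).
Variables (delta : 'rV[R]_d -> 'rV[R]_d) (eps : R).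
Local Notation Y := (d.-1.-tuple (measurableTypeR R)).
Local Notation X y := (ref_map V (face_param j s y)).
Local Notation nu y := (outer_normal V j s (face_param j s y)).
Local Notation rho := (density V j s).

Hypotheses (s0 : 0 < sigma) (h0 : 0 < h) (reg : regular_elt V sigma h).
Hypotheses (eps0 : 0 <= eps).
Hypothesis (td : forall i, tame (fun y : Y => delta (X y) 0 i)).
Hypothesis (dle : forall y i, face_cube y -> `|delta (X y) 0 i| <= eps * h).

Definition grad_bound v (G : R) := forall (y : Y) t i m, face_cube y -> 0 <= t <= 1 ->
  `|pev (mderiv m (v i)) (X y + t *: delta (X y))| <= G.

Implicit Types (y : Y) (G : R).

Let tX l : tame (fun y => X y 0 l). Proof. exact: tame_face_point. Qed.

Let trho : tame rho. Proof. exact: tame_density. Qed.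

Lemma sum_delta y : face_cube y -> \sum_m `|delta (X y) 0 m| <= N * (eps * h).
Proof.
by move=> cy; apply: sum_le_const => [|m]; [rewrite mulr_ge0// ltW|exact: dle].
Qed.

Lemma grad_bound0 v G y i m : grad_bound v G -> face_cube y ->
  `|pev (mderiv m (v i)) (X y)| <= G.
Proof.
move=> Gv cy; have := Gv y 0 i m cy; rewrite scale0r addr0; apply.
by rewrite lexx ler01.
Qed.

Lemma extF_vev v G y i : grad_bound v G -> face_cube y ->
  `|extF delta v (X y) 0 i - vev v (X y) 0 i| <= G * (N * (eps * h)).
Proof.
move=> Gv cy; rewrite [extF _ _ _ 0 i]mxE [vev _ _ 0 i]mxE.
have G0 : 0 <= G by apply: le_trans (grad_bound0 i i Gv cy).
have := @pev_taylor1 R d (v i) (X y) (delta (X y)) (fun=> 0) G.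
rewrite big1 ?subr0 => [H|m _]; last by rewrite mulr0.
apply: (le_trans (H _)) => [t m t01|]; first by rewrite subr0; exact: Gv.
by rewrite ler_wpM2l// sum_delta.
Qed.

Lemma extF_extT v G y i : grad_bound v G -> face_cube y ->
  `|extF delta v (X y) 0 i - extT delta v (X y) 0 i| <= 2 * G * (N * (eps * h)).
Proof.
move=> Gv cy; rewrite extTE [extF _ _ _ 0 i]mxE opprD addrA.
have G0 : 0 <= G by apply: le_trans (grad_bound0 i i Gv cy).
have := @pev_taylor1 R d (v i) (X y) (delta (X y))
  (fun m => pev (mderiv m (v i)) (X y)) (2 * G).
move=> H; apply: (le_trans (H _)) => [t m t01|].
  rewrite (le_trans (ler_normB _ _))// mulrDl mul1r lerD//; first exact: Gv.
  exact: grad_bound0 Gv cy.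
by rewrite ler_wpM2l ?sum_delta// mulr_ge0.
Qed.

Lemma visc_grad_bound sym v G y i m : grad_bound v G -> face_cube y ->
  `|visc_grad sym v (X y) i m| <= G.
Proof.
move=> Gv cy; have e a b := grad_bound0 a b Gv cy.
have G0 : 0 <= G by apply: le_trans (e i i).
have half (a : R) : `|2^-1 * a| = `|a| / 2 by rewrite normrM ger0_norm ?invr_ge0// mulrC.
case: sym; rewrite /visc_grad /= !mxE half ler_pdivrMr// mulrDr mulr1.
  by rewrite (le_trans (ler_normD _ _))// lerD.
by rewrite (le_trans (e _ _))// lerDl.
Qed.

Lemma traction_dot mu sym v n w x :
  dot ((2 * mu) *: (n *m (visc_grad sym v x)^T)) w =
  2 * mu * \sum_i (\sum_m n 0 m * visc_grad sym v x i m) * w 0 i.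
Proof.
rewrite /dot mulr_sumr; apply: eq_bigr => i _; rewrite mxE mulrA; congr (_ * _ * _).
by rewrite mxE; apply: eq_bigr => m _; rewrite [_^T _ _]mxE.
Qed.

Lemma tame_vev v i : tame (fun y => vev v (X y) 0 i).
Proof.
rewrite (_ : (fun _ => _) = fun y => pev (v i) (X y)); first exact: tame_pev.
by apply/funext => y; rewrite mxE.
Qed.

Lemma tame_extF v i : tame (fun y => extF delta v (X y) 0 i).
Proof.
rewrite (_ : (fun _ => _) = fun y => pev (v i) (X y + delta (X y))).
  apply: tame_pev => l.
  rewrite (_ : (fun _ => _) = fun y => X y 0 l + delta (X y) 0 l).
    by apply: tameD; [exact: tX|exact: td].
  by apply/funext => y; rewrite mxE.
by apply/funext => y; rewrite mxE.
Qed.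

Lemma tame_extT v i : tame (fun y => extT delta v (X y) 0 i).
Proof.
rewrite (_ : (fun _ => _) = fun y => pev (v i) (X y) +
    \sum_b delta (X y) 0 b * pev (mderiv b (v i)) (X y)).
  apply: tameD; first exact: tame_pev.
  by apply: tame_sum => b; apply: tameM; [exact: td|exact: tame_pev].
by apply/funext => y; rewrite extTE.
Qed.

Lemma tame_traction mu sym v (w : Y -> 'rV[R]_d) : (forall i, tame (fun y => w y 0 i)) ->
  tame (fun y => dot ((2 * mu) *: (nu y *m (visc_grad sym v (X y))^T)) (w y)).
Proof.
move=> tw; rewrite (_ : (fun _ => _) = fun y => 2 * mu *
    \sum_i (\sum_m nu y 0 m * visc_grad sym v (X y) i m) * w y 0 i); last first.
  by apply/funext => y; rewrite traction_dot.
apply: tameM; first exact: tame_cst.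
apply: tame_sum => i; apply: tameM; last exact: tw.
apply: tame_sum => m; apply: tameM; first exact: (tame_normal j s h0 reg m).
case: sym; rewrite /visc_grad.
  rewrite (_ : (fun _ => _) = fun y => pev (sym_part v i m) (X y)); first exact: tame_pev.
  by apply/funext => y; rewrite pev_sym_part.
rewrite (_ : (fun _ => _) = fun y => 2^-1 * pev (mderiv m (v i)) (X y)).
  by apply: tameM; [exact: tame_cst|exact: tame_pev].
by apply/funext => y; rewrite !mxE.
Qed.

Lemma tame_dot (a b : Y -> 'rV[R]_d) : (forall i, tame (fun y => a y 0 i)) ->
  (forall i, tame (fun y => b y 0 i)) -> tame (fun y => dot (a y) (b y)).
Proof. by move=> ta tb; apply: tame_sum => i; exact: tameM. Qed.

End on_a_face.
End local_forms.

Section face_forms.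
Variables (R : realType) (d : nat).
Local Notation N := (d.+1%:R : R).
Implicit Types (v : {ffun 'I_d -> mpoly d R}).
Variables (V : {ffun 'I_d -> bool} -> 'rV[R]_d) (sigma h : R) (j : 'I_d) (s : bool).
Variables (delta : 'rV[R]_d -> 'rV[R]_d) (eps : R).
Local Notation Y := (d.-1.-tuple (measurableTypeR R)).
Local Notation X y := (ref_map V (face_param j s y)).
Local Notation nu y := (outer_normal V j s (face_param j s y)).
Local Notation rho := (density V j s).
Local Notation K := (density_const d sigma).

Hypotheses (s0 : 0 < sigma) (h0 : 0 < h) (reg : regular_elt V sigma h).
Hypotheses (eps0 : 0 <= eps).
Hypothesis (td : forall i, tame (fun y : Y => delta (X y) 0 i)).
Hypothesis (dle : forall y i, face_cube y -> `|delta (X y) 0 i| <= eps * h).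

Implicit Types (y : Y) (G : R).

Let trho : tame rho. Proof. exact: tame_density. Qed.

Definition trace_sq v := face_integral V j s (fun _ x => dot (extT delta v x) (extT delta v x)).

Lemma trace_sq_ge0 v : 0 <= trace_sq v.
Proof.
apply: Rintegral_ge0 => y _; rewrite mulr_ge0 ?density_ge0//; exact: dotxx_ge0.
Qed.

Lemma density_const_ge0 : 0 <= K.
Proof. by rewrite !mulr_ge0 ?exprn_ge0 ?(ltW s0). Qed.

Lemma int_rho_le : h * cube_int rho <= K * h ^+ d.
Proof.
rewrite -cube_intZ// -[leRHS](@cube_int_cst R d) le_cube_int//.
- by apply: tameM => //; exact: tame_cst.
- exact: tame_cst.
by move=> y cy; have [] := @face_density_bounds R d V sigma h j s h0 reg y s0 cy.
Qed.

Definition local_a (mu : R) (sym : bool) (alpha : 'rV[R]_d -> R) u v : R :=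
  - face_integral V j s (fun n x =>
      dot ((2 * mu) *: (n *m (visc_grad sym u x)^T)) (vev v x))
  - face_integral V j s (fun n x =>
      dot ((2 * mu) *: (n *m (visc_grad sym v x)^T)) (extF delta u x))
  + face_integral V j s (fun n x => dot (alpha x *: extF delta u x) (extT delta v x)).

Lemma dotZl (c : R) (a b : 'rV[R]_d) : dot (c *: a) b = c * dot a b.
Proof. by rewrite /dot mulr_sumr; apply: eq_bigr => i _; rewrite mxE mulrA. Qed.

Lemma dotC (a b : 'rV[R]_d) : dot a b = dot b a.
Proof. by apply: eq_bigr => i _; rewrite mulrC. Qed.

Lemma dotBr (a b c : 'rV[R]_d) : dot a (b - c) = dot a b - dot a c.
Proof. by rewrite /dot -sumrB; apply: eq_bigr => i _; rewrite !mxE mulrBr. Qed.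

Lemma dotBl (a b c : 'rV[R]_d) : dot (a - b) c = dot a c - dot b c.
Proof. by rewrite dotC dotBr !(dotC c). Qed.

(** The consistency terms leave the trace defects u^F - u, and in the penalty
    terms the symmetric part (u^T, v^T) cancels, leaving u^F - u^T. *)
Definition asym_integrand mu sym (alpha : 'rV[R]_d -> R) u v y : R :=
  dot ((2 * mu) *: (nu y *m (visc_grad sym u (X y))^T)) (extF delta v (X y) - vev v (X y))
  - dot ((2 * mu) *: (nu y *m (visc_grad sym v (X y))^T)) (extF delta u (X y) - vev u (X y))
  + alpha (X y) * (dot (extF delta u (X y) - extT delta u (X y)) (extT delta v (X y))
     - dot (extF delta v (X y) - extT delta v (X y)) (extT delta u (X y))).

Lemma local_a_asym mu sym alpha u v : tame (fun y => alpha (X y)) ->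
  tame (fun y => asym_integrand mu sym alpha u v y * rho y) /\
  local_a mu sym alpha u v - local_a mu sym alpha v u =
  cube_int (fun y => asym_integrand mu sym alpha u v y * rho y).
Proof.
move=> ta.
have tv w i := @tame_vev R d V j s w i.
have tF w i := @tame_extF R d V j s delta td w i.
have tT w i := @tame_extT R d V j s delta td w i.
have t1 w w' : tame (fun y => dot ((2 * mu) *: (nu y *m (visc_grad sym w (X y))^T))
    (vev w' (X y)) * rho y).
  by apply: tameM => //; exact: (tame_traction j s h0 reg mu sym w (tv w')).
have t2 w w' : tame (fun y => dot ((2 * mu) *: (nu y *m (visc_grad sym w (X y))^T))
    (extF delta w' (X y)) * rho y).
  by apply: tameM => //; exact: (tame_traction j s h0 reg mu sym w (tF w')).
have t3 w w' : tame (fun y => dot (alpha (X y) *: extF delta w (X y))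
    (extT delta w' (X y)) * rho y).
  apply: tameM => //.
  rewrite (_ : (fun _ => _) = fun y => alpha (X y) *
      dot (extF delta w (X y)) (extT delta w' (X y))).
    by apply: tameM => //; apply: tame_dot; [exact: tF|exact: tT].
  by apply/funext => y; rewrite dotZl.
pose f1 w w' y := dot ((2 * mu) *: (nu y *m (visc_grad sym w (X y))^T)) (vev w' (X y)) * rho y.
pose f2 w w' y := dot ((2 * mu) *: (nu y *m (visc_grad sym w (X y))^T)) (extF delta w' (X y)) * rho y.
pose f3 w w' y := dot (alpha (X y) *: extF delta w (X y)) (extT delta w' (X y)) * rho y.
have E : (fun y => asym_integrand mu sym alpha u v y * rho y) =
    fun y => (f2 u v y - f1 u v y) - (f2 v u y - f1 v u y) + (f3 u v y - f3 v u y).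
  apply/funext => y; rewrite /asym_integrand /f1 /f2 /f3 !dotBr !dotBl.
  rewrite !(dotZl (alpha _)) (dotC (extT delta v _) (extT delta u _)).
  move: (dot _ _) (dot _ _) (dot _ _) (dot _ _) (dot _ _) (dot _ _) (dot _ _)
    (alpha _) (rho y) => *; ring.
have tA : tame (fun y => f2 u v y - f1 u v y) by apply: tameB; [exact: t2|exact: t1].
have tB : tame (fun y => f2 v u y - f1 v u y) by apply: tameB; [exact: t2|exact: t1].
have tC : tame (fun y => f3 u v y - f3 v u y) by apply: tameB; exact: t3.
have tAB : tame (fun y => (f2 u v y - f1 u v y) - (f2 v u y - f1 v u y)) by exact: tameB.
rewrite E; split; first exact: tameD.
have tf1 w w' : tame (f1 w w') by exact: t1.
have tf2 w w' : tame (f2 w w') by exact: t2.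
have tf3 w w' : tame (f3 w w') by exact: t3.
rewrite cube_intD// cube_intB// (cube_intB (tf2 u v) (tf1 u v)).
rewrite (cube_intB (tf2 v u) (tf1 v u)) (cube_intB (tf3 u v) (tf3 v u)).
have LE w w' : local_a mu sym alpha w w' =
    - cube_int (f1 w w') - cube_int (f2 w' w) + cube_int (f3 w w') by [].
rewrite !LE; move: (cube_int (f1 u v)) (cube_int (f1 v u)) (cube_int (f2 u v))
  (cube_int (f2 v u)) (cube_int (f3 u v)) (cube_int (f3 v u)) => *.
by ring.
Qed.

Let tau v y : R := \sum_i `|extT delta v (X y) 0 i|.

Let tau_sq v y : tau v y ^+ 2 <= N * dot (extT delta v (X y)) (extT delta v (X y)).
Proof.
pose w := extT delta v (X y).
have -> : tau v y = \sum_i `|w 0 i| by [].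
rewrite expr2 mulr_suml (@le_trans _ _ (\sum_i \sum_l (w 0 i ^+ 2 + w 0 l ^+ 2) / 2))//.
  apply: ler_sum => i _; rewrite mulr_sumr; apply: ler_sum => l _.
  rewrite -(real_normK (num_real (w 0 i))) -(real_normK (num_real (w 0 l))).
  by have := sqr_ge0 (`|w 0 i| - `|w 0 l|); rewrite sqrrB; lra.
have D : \sum_i w 0 i ^+ 2 = dot w w by apply: eq_bigr => i _; rewrite expr2.
have inner i : \sum_l (w 0 i ^+ 2 + w 0 l ^+ 2) / 2 = (d%:R * w 0 i ^+ 2 + dot w w) / 2.
  by rewrite -mulr_suml big_split/= D sumr_const card_ord mulr_natl.
under eq_bigr do rewrite inner.
rewrite -mulr_suml big_split/= -mulr_sumr D sumr_const card_ord -[dot w w *+ d]mulr_natl.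
rewrite (_ : (d%:R * dot w w + d%:R * dot w w) / 2 = d%:R * dot w w); last by field.
by rewrite ler_wpM2r ?dotxx_ge0// ler_nat.
Qed.

Lemma asym_integrand_bound mu sym alpha ca u v Gu Gv y : 0 < mu -> 0 <= ca ->
  grad_bound V j s delta u Gu -> grad_bound V j s delta v Gv -> face_cube y ->
  0 <= alpha (X y) <= ca * (2 * mu) / h ->
  `|asym_integrand mu sym alpha u v y| <= 2 * mu * eps *
    (2 * N ^+ 3 * h * (Gu * Gv) + 2 * N * ca * (Gu * tau v y + Gv * tau u y)).
Proof.
move=> mu0 ca0 gu gv cy /andP[al0 ale].
have N0 : 0 <= N by exact: ler0n.
have Gge0 w G : grad_bound V j s delta w G -> 'I_d -> 0 <= G.
  by move=> gw i; apply: le_trans (grad_bound0 i i gw cy).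
have Gu0 := Gge0 u Gu gu j; have Gv0 := Gge0 v Gv gv j.
have eh0 : 0 <= eps * h by rewrite mulr_ge0// ltW.
have cons w w' Gw Gw' : grad_bound V j s delta w Gw -> grad_bound V j s delta w' Gw' ->
    `|dot ((2 * mu) *: (nu y *m (visc_grad sym w (X y))^T))
      (extF delta w' (X y) - vev w' (X y))| <= 2 * mu * eps * (N ^+ 3 * h * (Gw * Gw')).
  move=> gw gw'; have Gw0 := Gge0 w Gw gw j; have Gw0' := Gge0 w' Gw' gw' j.
  rewrite traction_dot normrM ger0_norm ?mulr_ge0 ?(ltW mu0)//.
  rewrite -[leRHS]mulrA ler_wpM2l ?mulr_ge0 ?(ltW mu0)//.
  have -> : eps * (N ^+ 3 * h * (Gw * Gw')) = N * ((N * Gw) * (Gw' * (N * (eps * h)))) by ring.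
  rewrite (le_trans (ler_norm_sum _ _ _))//; apply: sum_le_const => [|i].
    by rewrite !mulr_ge0 ?(ltW h0).
  rewrite normrM ler_pM//.
    rewrite (le_trans (ler_norm_sum _ _ _))//; apply: sum_le_const => // m.
    rewrite normrM -[leRHS]mul1r ler_pM//.
      exact: (normal_le1 j s h0 reg).
    exact: (visc_grad_bound sym i m gw cy).
  rewrite [Z in `|Z|]mxE [Z in `|_ + Z|]mxE.
  exact: (extF_vev h0 eps0 dle i gw' cy).
have pen w w' Gw : grad_bound V j s delta w Gw ->
    `|dot (extF delta w (X y) - extT delta w (X y)) (extT delta w' (X y))|
    <= 2 * Gw * (N * (eps * h)) * tau w' y.
  move=> gw; rewrite (le_trans (ler_norm_sum _ _ _))// /tau mulr_sumr.
  apply: ler_sum => i _; rewrite normrM ler_wpM2r//.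
  rewrite [Z in `|Z|]mxE [Z in `|_ + Z|]mxE.
  exact: (extF_extT h0 eps0 dle i gw cy).
rewrite /asym_integrand.
set a1 := dot _ _; set a2 := dot _ _; set a3 := dot _ _; set a4 := dot _ _.
have e1 : `|a1| <= 2 * mu * eps * (N ^+ 3 * h * (Gu * Gv)) by exact: cons.
have e2 : `|a2| <= 2 * mu * eps * (N ^+ 3 * h * (Gu * Gv)).
  by rewrite [Gu * Gv]mulrC; exact: cons.
have e3 : `|a3| <= 2 * Gu * (N * (eps * h)) * tau v y by exact: pen.
have e4 : `|a4| <= 2 * Gv * (N * (eps * h)) * tau u y by exact: pen.
have e5 : `|alpha (X y) * (a3 - a4)| <= 2 * mu * eps * (2 * N * ca * (Gu * tau v y + Gv * tau u y)).
  rewrite normrM (ger0_norm al0).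
  have -> : 2 * mu * eps * (2 * N * ca * (Gu * tau v y + Gv * tau u y)) =
      (ca * (2 * mu) / h) * (2 * Gu * (N * (eps * h)) * tau v y + 2 * Gv * (N * (eps * h)) * tau u y).
    by field; rewrite gt_eqF.
  by rewrite ler_pM// (le_trans (ler_normB _ _))// lerD.
rewrite (le_trans (ler_normD _ _))// (le_trans (lerD (ler_normB _ _) e5))//.
rewrite [leRHS]mulrDr lerD2r.
have -> : 2 * mu * eps * (2 * N ^+ 3 * h * (Gu * Gv)) =
  2 * mu * eps * (N ^+ 3 * h * (Gu * Gv)) + 2 * mu * eps * (N ^+ 3 * h * (Gu * Gv)) by ring.
by rewrite lerD.
Qed.

(** Cauchy-Schwarz on a face, whose area times h is of the order of h^d. *)
Lemma int_tau_rho v G : 0 <= G ->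
  G * cube_int (fun y => tau v y * rho y) <=
  Num.sqrt (K * h ^+ d * G ^+ 2) * Num.sqrt (N * (trace_sq v / h)).
Proof.
move=> G0; have K0 := density_const_ge0.
have ttau : tame (tau v).
  by apply: tame_sum => i; apply: tame_norm; exact: tame_extT.
have tdot : tame (fun y => dot (extT delta v (X y)) (extT delta v (X y)) * rho y).
  by apply: tameM => //; apply: tame_dot => i; exact: tame_extT.
apply: le_of_amgm; rewrite ?sqrtr_ge0// => t t0.
rewrite !sqr_sqrtr; last 2 first.
- by rewrite mulr_ge0// divr_ge0 ?trace_sq_ge0 ?(ltW h0).
- by rewrite mulr_ge0 ?sqr_ge0// mulr_ge0// exprn_ge0// ltW.
have hn : h != 0 by rewrite gt_eqF.
have tn : t != 0 by rewrite gt_eqF.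
have ttr : tame (fun y => tau v y * rho y) by exact: tameM.
have tz c (f : Y -> R) : tame f -> tame (fun y => c * f y).
  by move=> tf; apply: tameM => //; exact: tame_cst.
have tdot' := tdot.
rewrite -cube_intZ//.
apply: (@le_trans _ _ (cube_int (fun y => t * G ^+ 2 * h / 2 * rho y +
    N / (2 * t * h) * (dot (extT delta v (X y)) (extT delta v (X y)) * rho y)))).
  apply: le_cube_int.
  - exact: tz.
  - by apply: tameD; exact: tz.
  move=> y cy; have tq := tau_sq v y; set D := dot _ _ in tq *.
  rewrite (_ : _ + _ = (t * G ^+ 2 * h / 2 + N * D / (2 * t * h)) * rho y); last by ring.
  rewrite mulrA ler_wpM2r ?density_ge0//.
  have : G * tau v y <= t * G ^+ 2 * h / 2 + tau v y ^+ 2 / (2 * t * h).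
    rewrite -(@ler_pM2l _ (2 * t * h)) ?mulr_gt0//.
    have -> : 2 * t * h * (t * G ^+ 2 * h / 2 + tau v y ^+ 2 / (2 * t * h)) =
        (t * h * G) ^+ 2 + tau v y ^+ 2 by field; rewrite hn tn.
    by have := sqr_ge0 (t * h * G - tau v y); rewrite sqrrB; lra.
  move=> /le_trans; apply; rewrite lerD2l.
  by rewrite ler_wpM2r// invr_ge0 !mulr_ge0 ?(ltW t0) ?(ltW h0).
rewrite cube_intD; [|exact: tz..].
rewrite !cube_intZ//.
have Ir := int_rho_le.
have TE : cube_int (fun y => dot (extT delta v (X y)) (extT delta v (X y)) * rho y) =
  trace_sq v by [].
rewrite TE [leRHS]mulrDl lerD//.
  have -> : t * G ^+ 2 * h / 2 * cube_int rho = t * G ^+ 2 / 2 * (h * cube_int rho) by ring.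
  have -> : t * (K * h ^+ d * G ^+ 2) / 2 = t * G ^+ 2 / 2 * (K * h ^+ d) by ring.
  by rewrite ler_wpM2l// !mulr_ge0 ?sqr_ge0 ?invr_ge0 ?(ltW t0).
by rewrite le_eqVlt; apply/orP; left; apply/eqP; field; rewrite hn tn.
Qed.

(** Each term is a defect, of size eps h times a gradient, tested against a
    gradient or, with the factor 1 / h of the penalty, against v^T. *)
Lemma local_a_bound mu sym alpha ca C u v Gu Gv Eu Ev :
  0 < mu -> 0 <= ca -> 0 <= C -> 0 <= Gu -> 0 <= Gv ->
  grad_bound V j s delta u Gu -> grad_bound V j s delta v Gv ->
  tame (fun y => alpha (X y)) ->
  (forall y, face_cube y -> 0 <= alpha (X y) <= ca * (2 * mu) / h) ->
  Gu ^+ 2 * h ^+ d <= C * Eu -> Gv ^+ 2 * h ^+ d <= C * Ev ->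
  trace_sq u / h <= Eu -> trace_sq v / h <= Ev ->
  `|local_a mu sym alpha u v - local_a mu sym alpha v u| <=
  2 * mu * eps * ((2 * N ^+ 3 * K * C + 4 * N * ca * Num.sqrt (K * C * N))
     * (Num.sqrt Eu * Num.sqrt Ev)).
Proof.
move=> mu0 ca0 C0 Gu0 Gv0 gu gv ta ale GEu GEv TEu TEv.
have K0 := density_const_ge0; have N0 : 0 <= N by exact: ler0n.
have [tas ->] := local_a_asym mu sym u v ta.
have ttau w : tame (tau w).
  by apply: tame_sum => i; apply: tame_norm; exact: tame_extT.
have tz c (f : Y -> R) : tame f -> tame (fun y => c * f y).
  by move=> tf; apply: tameM => //; exact: tame_cst.
have ttr w : tame (fun y => tau w y * rho y) by exact: tameM.
have Eu0 : 0 <= Eu by apply: le_trans TEu; rewrite divr_ge0 ?trace_sq_ge0 ?(ltW h0).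
have Ev0 : 0 <= Ev by apply: le_trans TEv; rewrite divr_ge0 ?trace_sq_ge0 ?(ltW h0).
pose B y := 2 * mu * eps * (2 * N ^+ 3 * h * (Gu * Gv)) * rho y +
  (2 * mu * eps * (2 * N * ca) * Gu * (tau v y * rho y) +
   2 * mu * eps * (2 * N * ca) * Gv * (tau u y * rho y)).
have t1 : tame (fun y => 2 * mu * eps * (2 * N * ca) * Gu * (tau v y * rho y)) by exact: tz.
have t2 : tame (fun y => 2 * mu * eps * (2 * N * ca) * Gv * (tau u y * rho y)) by exact: tz.
have t3 : tame (fun y => 2 * mu * eps * (2 * N * ca) * Gu * (tau v y * rho y) +
   2 * mu * eps * (2 * N * ca) * Gv * (tau u y * rho y)) by exact: tameD.
have t4 : tame (fun y => 2 * mu * eps * (2 * N ^+ 3 * h * (Gu * Gv)) * rho y) by exact: tz.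
have tB : tame B by exact: tameD.
have main : `|cube_int (fun y => asym_integrand mu sym alpha u v y * rho y)| <= cube_int B.
  apply: normr_cube_int => // y cy; rewrite normrM (ger0_norm (density_ge0 _ _ _ _)).
  have -> : B y = 2 * mu * eps * (2 * N ^+ 3 * h * (Gu * Gv) +
      2 * N * ca * (Gu * tau v y + Gv * tau u y)) * rho y by rewrite /B; ring.
  rewrite ler_wpM2r ?density_ge0//.
  by apply: asym_integrand_bound => //; exact: ale.
rewrite (le_trans main)// /B cube_intD// cube_intD// !cube_intZ//.
have bound w G E E' : 0 <= G -> 0 <= E -> 0 <= E' -> G ^+ 2 * h ^+ d <= C * E -> trace_sq w / h <= E' ->
    G * cube_int (fun y => tau w y * rho y) <= Num.sqrt (K * C * N) * (Num.sqrt E * Num.sqrt E').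
  move=> G0 E0 E'0 GE TE; rewrite (le_trans (int_tau_rho w G0))//.
  have KC : 0 <= K * C by rewrite mulr_ge0.
  have -> : Num.sqrt (K * C * N) * (Num.sqrt E * Num.sqrt E') =
      Num.sqrt (K * C * E) * Num.sqrt (N * E').
    rewrite (sqrtrM _ KC) (sqrtrM E KC) (sqrtrM E' N0); ring.
  rewrite ler_pM ?sqrtr_ge0// ler_wsqrtr//; last by rewrite ler_wpM2l.
  by rewrite -mulrA -[leRHS]mulrA ler_wpM2l// mulrC.
have b1 := bound v Gu Eu Ev Gu0 Eu0 Ev0 GEu TEv.
have b2 := bound u Gv Ev Eu Gv0 Ev0 Eu0 GEv TEu.
have GG : Gu * Gv * h ^+ d <= C * (Num.sqrt Eu * Num.sqrt Ev).
  have H0 : 0 <= h ^+ d by rewrite exprn_ge0// ltW.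
  have -> : Gu * Gv * h ^+ d = Num.sqrt (Gu ^+ 2 * h ^+ d) * Num.sqrt (Gv ^+ 2 * h ^+ d).
    rewrite (sqrtrM _ (sqr_ge0 Gu)) (sqrtrM _ (sqr_ge0 Gv)) !sqrtr_sqr !ger0_norm//.
    rewrite mulrACA -expr2 sqr_sqrtr//.
  have -> : C * (Num.sqrt Eu * Num.sqrt Ev) = Num.sqrt (C * Eu) * Num.sqrt (C * Ev).
    by rewrite !(sqrtrM _ C0) mulrACA -expr2 sqr_sqrtr.
  by rewrite ler_pM ?sqrtr_ge0// ler_wsqrtr.
have Ir := int_rho_le.
have mue : 0 <= 2 * mu * eps by rewrite !mulr_ge0// ltW.
set S := Num.sqrt Eu * Num.sqrt Ev in b1 GG *.
have b3 : h * (Gu * Gv) * cube_int rho <= K * (C * S).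
  have -> : h * (Gu * Gv) * cube_int rho = Gu * Gv * (h * cube_int rho) by ring.
  rewrite (@le_trans _ _ (Gu * Gv * (K * h ^+ d)))// ?ler_wpM2l ?mulr_ge0//.
  by rewrite mulrCA ler_wpM2l.
rewrite [Num.sqrt Ev * _]mulrC -/S in b2.
set I1 := cube_int rho in b3 *; set I2 := cube_int _ in b1 *; set I3 := cube_int _ in b2 *.
have -> : 2 * mu * eps * (2 * N ^+ 3 * h * (Gu * Gv)) * I1 +
    (2 * mu * eps * (2 * N * ca) * Gu * I2 + 2 * mu * eps * (2 * N * ca) * Gv * I3) =
    2 * mu * eps * (2 * N ^+ 3 * (h * (Gu * Gv) * I1) + 2 * N * ca * (Gu * I2 + Gv * I3)) by ring.
rewrite ler_wpM2l// [leRHS]mulrDl lerD//.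
  have -> : 2 * N ^+ 3 * K * C * S = 2 * N ^+ 3 * (K * (C * S)) by ring.
  by rewrite ler_wpM2l// mulr_ge0// exprn_ge0.
set q := Num.sqrt (K * C * N) in b1 b2 *.
have -> : 4 * N * ca * q * S = 2 * N * ca * (q * S + q * S) by ring.
apply: ler_wpM2l; last exact: (lerD b1 b2).
by rewrite !mulr_ge0.
Qed.

(** The defect v - v^F and the pressure are both bounded pointwise, so the area of
    the face is the only integral left. *)
Lemma local_b_bound C v (q : mpoly d R) G Bq E EQ : 0 <= C -> 0 <= G ->
  grad_bound V j s delta v G -> (forall y, face_cube y -> `|pev q (X y)| <= Bq) -> 0 <= Bq ->
  G ^+ 2 * h ^+ d <= C * E -> Bq ^+ 2 * h ^+ d <= C * EQ -> 
  `|face_integral V j s (fun n x => dot n (vev v x) * pev q x) -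
    face_integral V j s (fun n x => dot n (extF delta v x) * pev q x)|
  <= eps * (N ^+ 2 * K * C * (Num.sqrt E * Num.sqrt EQ)).
Proof.
move=> C0 G0 gv qB Bq0 GE BE; rewrite !face_integralE.
have K0 := density_const_ge0; have N0 : 0 <= N by exact: ler0n.
have tq : tame (fun y => pev q (X y)) by apply: tame_pev => l; exact: tame_face_point.
have tn i := tame_normal j s h0 reg i.
have tv i := @tame_vev R d V j s v i.
have tF i := @tame_extF R d V j s delta td v i.
rewrite -cube_intB; last 2 first.
- by apply: tameM => //; apply: tameM => //; apply: tame_dot.
- by apply: tameM => //; apply: tameM => //; apply: tame_dot.
apply: (@le_trans _ _ (cube_int (fun y => N * (G * (N * (eps * h))) * Bq * rho y))).
  apply: normr_cube_int.
  - apply: tameB; apply: tameM => //; apply: tameM => //; exact: tame_dot.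
  - by apply: tameM => //; exact: tame_cst.
  move=> y cy; rewrite -mulrBl -mulrBl -dotBr !normrM (ger0_norm (density_ge0 _ _ _ _)).
  rewrite ler_wpM2r ?density_ge0// ler_pM ?qB//.
  have c0 : 0 <= G * (N * (eps * h)) by rewrite !mulr_ge0// ltW.
  rewrite (le_trans (ler_norm_sum _ _ _))//; apply: sum_le_const => // i.
  rewrite normrM -[leRHS]mul1r ler_pM//; first exact: (normal_le1 j s h0 reg).
  rewrite [Z in `|Z|]mxE [Z in `|_ + Z|]mxE distrC.
  exact: (extF_vev h0 eps0 dle i gv cy).
rewrite cube_intZ//.
have H0 : 0 <= h ^+ d by rewrite exprn_ge0// ltW.
have GB : G * Bq * h ^+ d <= C * (Num.sqrt E * Num.sqrt EQ).
  have -> : G * Bq * h ^+ d = Num.sqrt (G ^+ 2 * h ^+ d) * Num.sqrt (Bq ^+ 2 * h ^+ d).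
    rewrite (sqrtrM _ (sqr_ge0 G)) (sqrtrM _ (sqr_ge0 Bq)) !sqrtr_sqr !ger0_norm//.
    by rewrite mulrACA -expr2 sqr_sqrtr.
  have -> : C * (Num.sqrt E * Num.sqrt EQ) = Num.sqrt (C * E) * Num.sqrt (C * EQ).
    by rewrite !(sqrtrM _ C0) mulrACA -expr2 sqr_sqrtr.
  by rewrite ler_pM ?sqrtr_ge0// ler_wsqrtr.
have Ir := int_rho_le.
have -> : N * (G * (N * (eps * h))) * Bq * cube_int rho =
  eps * (N ^+ 2 * (G * Bq * (h * cube_int rho))) by ring.
rewrite ler_wpM2l//.
have -> : N ^+ 2 * K * C * (Num.sqrt E * Num.sqrt EQ) =
  N ^+ 2 * (K * (C * (Num.sqrt E * Num.sqrt EQ))) by ring.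
rewrite ler_wpM2l ?exprn_ge0//.
rewrite (@le_trans _ _ (G * Bq * (K * h ^+ d)))// ?ler_wpM2l ?mulr_ge0//.
by rewrite mulrCA ler_wpM2l.
Qed.

End face_forms.

(** * Summation over the mesh *)

Section mesh.
Variables (R : realType) (d : nat) (Omega GammaD : set 'rV[R]_d).
Variables (mu : R) (sym : bool) (kV kQ : nat) (sigma c_d zeta c_alpha : R).
Variable (M : sbm R d).
Local Notation N := (d.+1%:R : R).
Local Notation face := ('I_(nelt M) * ('I_d * bool))%type.
Local Notation K := (density_const d sigma).

Hypotheses (d0 : (0 < d)%N) (mu0 : 0 < mu) (s0 : 0 < sigma).
Hypotheses (cd0 : 0 < c_d) (z0 : 0 < zeta) (ca0 : 0 < c_alpha).
Hypotheses (mesh : background_mesh M Omega) (shape : shape_regular M sigma).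
Hypotheses (geom : surrogate_geometry M Omega GammaD) (nitsche : nitsche_penalty M).
Hypotheses (vspace : velocity_space M kV) (qspace : pressure_space M kQ).
Hypotheses (enorm_a : energy_norm M mu sym) (dist : distance_bound M c_d zeta).
Hypothesis (pen : penalty_bound M mu c_alpha).

Lemma hT_ge0 (T : 'I_(nelt M)) : 0 <= hT T.
Proof.
rewrite /hT /diam; set S := [set r | _].
have [S_sup|/sup_out ->//] := pselect (has_sup S).
pose p := ref_map (vtx T) (cube_mid R d).
have pT : cell T p by exists (cube_mid R d) => //; exact: cube_mid_in.
apply: (le_trans (enorm_ge0 (p - p))).
by apply: sup_upper_bound => //; exists p, p.
Qed.

(** At size 0, shape regularity makes the reference map constant along each axis,
    against its injectivity. *)
Lemma hT_gt0 (T : 'I_(nelt M)) : 0 < hT T.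
Proof.
rewrite lt_neqAle hT_ge0 andbT eq_sym; apply/eqP => hT0.
have [inj _ _] := mesh; pose i : 'I_d := Ordinal d0.
have cc := @cube_mid_in R d.
have slope0 : slope (vtx T) (cube_mid R d) i = 0.
  apply/rowP => k; rewrite [RHS]mxE; apply/eqP; rewrite -normr_le0.
  have regT : regular_elt (vtx T) sigma (hT T) by move=> x w xc; exact: shape.
  by have := slope_bound regT i k cc; rewrite hT0 mulr0.
have c01 t : 0 <= t <= 1 -> upd (cube_mid R d) i t \in ref_cube.
  by move=> t01; rewrite inE; exact: ref_cube_upd.
have := inj T (upd (cube_mid R d) i 1) (upd (cube_mid R d) i 0).
rewrite !c01 ?lexx ?ler01// => /(_ isT isT).
move: slope0; rewrite /slope => /eqP; rewrite subr_eq0 => /eqP -> /(_ erefl).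
move=> /rowP/(_ i); rewrite !updE eqxx => /eqP.
by rewrite oner_eq0.
Qed.

Lemma reg_elt (T : 'I_(nelt M)) : regular_elt (vtx T) sigma (hT T).
Proof. by move=> x w xc; exact: shape. Qed.

Lemma clen_gt0 : 0 < clen M. Proof. by have [_ _ _ _ []] := geom. Qed.

Lemma sface_active (F : face) : F \in sfaces M -> F.1 \in active M.
Proof. by have [_ H _ _ _] := geom => /H[]. Qed.

Lemma hhat_ge0 (T : 'I_(nelt M)) : 0 <= hhat T.
Proof. by rewrite divr_ge0 ?hT_ge0// ltW// clen_gt0. Qed.

Lemma hhat_le1 (T : 'I_(nelt M)) : T \in active M -> hhat T <= 1.
Proof.
have [_ _ _ _ [_ H]] := geom => /H hle.
by rewrite ler_pdivrMr ?clen_gt0// mul1r.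
Qed.

Lemma hhat_bdry_le1 : hhat_bdry M <= 1.
Proof. by apply: bigmax_le => [|T /andP[TA _]]; [exact: ler01|exact: hhat_le1]. Qed.

Lemma hhat_bdry_ge0 : 0 <= hhat_bdry M.
Proof. exact: bigmax_ge_id. Qed.

Lemma face_point_in (F : face) (y : d.-1.-tuple R) : face_cube y ->
  face_set F (ref_map (vtx F.1) (face_param F.2.1 F.2.2 y)).
Proof.
move=> cy; exists (face_param F.2.1 F.2.2 y) => //; split.
  exact: face_param_cube.
by rewrite mxE unlift_none.
Qed.

(** A surrogate face lies on the boundary of the surrogate domain, hence not
    in the interior of its element. *)
Lemma hhat_le_bdry (F : face) : F \in sfaces M -> hhat F.1 <= hhat_bdry M.
Proof.
move=> FS; have FA := sface_active FS; apply: le_bigmax_cond; rewrite FA/=.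
apply/asboolP; pose y : d.-1.-tuple R := [tuple 0 | _ < d.-1].
have cy : face_cube y by move=> l; rewrite tnth_mktuple lexx ler01.
pose x := ref_map (vtx F.1) (face_param F.2.1 F.2.2 y).
have xF : face_set F x by exact: face_point_in.
exists x; split; last by exists F.
have [_ H _ _ _] := geom; have [_ /(_ x xF) [_ xint]] := H F FS.
split.
  apply: subset_closure; exists (face_param F.2.1 F.2.2 y) => //.
  exact: face_param_cube.
move=> xi; apply: xint; move: xi; apply: interiorS => z zT.
by exists F.1.
Qed.

Let eps : R := c_d * hhat_bdry M `^ zeta.

Lemma eps_ge0 : 0 <= eps. Proof. by rewrite mulr_ge0 ?powR_ge0// ltW. Qed.

Lemma eps_le : eps <= c_d.
Proof.
have e1 : (1 : R) `^ zeta = 1 by rewrite powR1.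
rewrite -[leRHS]mulr1 ler_pM2l// -[leRHS]e1.
by apply: ge0_ler_powR; rewrite ?nnegrE ?hhat_bdry_ge0 ?hhat_bdry_le1// ltW.
Qed.

Lemma delta_le (F : face) (y : d.-1.-tuple R) i : F \in sfaces M -> face_cube y ->
  `|delta M (ref_map (vtx F.1) (face_param F.2.1 F.2.2 y)) 0 i| <= eps * hT F.1.
Proof.
move=> FS cy; rewrite (le_trans (le_coord_enorm _ _))//.
rewrite (le_trans (dist FS (face_point_in F cy)))//.
rewrite /eps mulrAC ler_wpM2r ?hT_ge0// ler_pM2l//.
by apply: ge0_ler_powR; rewrite ?nnegrE ?hhat_bdry_ge0 ?hhat_ge0 ?hhat_le_bdry// ltW.
Qed.

Lemma tame_delta (F : face) i : F \in sfaces M ->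
  tame (fun y : d.-1.-tuple (measurableTypeR R) =>
    delta M (ref_map (vtx F.1) (face_param F.2.1 F.2.2 y)) 0 i).
Proof.
move=> FS; have [_ _ _ H _] := geom; split; first exact: H.
by exists (eps * hT F.1) => y cy; exact: delta_le.
Qed.

Lemma penalty_itv (F : face) (y : d.-1.-tuple R) : F \in sfaces M -> face_cube y ->
  0 <= penalty M F (ref_map (vtx F.1) (face_param F.2.1 F.2.2 y))
    <= c_alpha * (2 * mu) / hT F.1.
Proof.
move=> FS cy; have xF := face_point_in F cy.
by rewrite (pen FS xF) andbT ltW//; have [H _] := nitsche FS; exact: H.
Qed.

Lemma tame_penalty (F : face) : F \in sfaces M ->
  tame (fun y : d.-1.-tuple (measurableTypeR R) =>
    penalty M F (ref_map (vtx F.1) (face_param F.2.1 F.2.2 y))).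
Proof.
move=> FS; have [_ H] := nitsche FS; split; first exact: H.
exists (c_alpha * (2 * mu) / hT F.1) => y cy.
by have /andP[p0 p1] := penalty_itv FS cy; rewrite ger0_norm.
Qed.

Lemma frob_visc_sym (u v : {ffun 'I_d -> mpoly d R}) x :
  frob (visc_grad sym u x) (vgrad v x) = frob (visc_grad sym v x) (vgrad u x).
Proof.
rewrite /frob /visc_grad; case: sym.
  have E (A B : 'M[R]_d) : \sum_i \sum_j (2^-1 *: (A + A^T)) i j * B i j =
      2^-1 * (\sum_i \sum_j A i j * B i j + \sum_i \sum_j A j i * B i j).
    rewrite -big_split mulr_sumr; apply: eq_bigr => i _.
    rewrite -big_split mulr_sumr; apply: eq_bigr => l _.
    by rewrite !mxE /=; ring.
  rewrite /symgrad !E; congr (_ * (_ + _)).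
    by apply: eq_bigr => i _; apply: eq_bigr => l _; rewrite mulrC.
  rewrite exchange_big/=; apply: eq_bigr => i _; apply: eq_bigr => l _.
  by rewrite mulrC.
by apply: eq_bigr => i _; apply: eq_bigr => l _; rewrite !mxE; ring.
Qed.

Lemma form_a_faces (u v : velocity R d (nelt M)) :
  form_a mu sym u v - form_a mu sym v u =
  \sum_(F in sfaces M)
    (local_a (vtx F.1) F.2.1 F.2.2 (delta M) mu sym (penalty M F) (u F.1) (v F.1)
     - local_a (vtx F.1) F.2.1 F.2.2 (delta M) mu sym (penalty M F) (v F.1) (u F.1)).
Proof.
have E (w w' : velocity R d (nelt M)) : form_a mu sym w w' =
    bulk (fun T x => 2 * mu * frob (visc_grad sym (w T) x) (vgrad (w' T) x)) +
    \sum_(F in sfaces M)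
      local_a (vtx F.1) F.2.1 F.2.2 (delta M) mu sym (penalty M F) (w F.1) (w' F.1).
  by rewrite /form_a /surf /local_a big_split sumrB sumrN /= !addrA.
rewrite !E sumrB opprD addrACA.
suff -> : bulk (fun T x => 2 * mu * frob (visc_grad sym (u T) x) (vgrad (v T) x)) =
    bulk (fun T x => 2 * mu * frob (visc_grad sym (v T) x) (vgrad (u T) x)).
  by rewrite subrr add0r.
apply: eq_bigr => T _; congr (rv_integral _ _); apply/funext => x.
by rewrite frob_visc_sym.
Qed.

Lemma form_b_faces (v : velocity R d (nelt M)) (q : pressure R d (nelt M)) :
  form_b1 v q - form_b2 v q = \sum_(F in sfaces M)
   (face_integral (vtx F.1) F.2.1 F.2.2 (fun n x => dot n (vev (v F.1) x) * pev (q F.1) x) -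
    face_integral (vtx F.1) F.2.1 F.2.2
      (fun n x => dot n (extF (delta M) (v F.1) x) * pev (q F.1) x)).
Proof. by rewrite /form_b1 /form_b2 /surf sumrB opprD addrACA subrr add0r. Qed.

(** Every element has 2d faces. *)
Lemma sum_faces_elts (f : 'I_(nelt M) -> R) : (forall T, 0 <= f T) ->
  \sum_(F in sfaces M) f F.1 <= (d * 2)%:R * \sum_(T in active M) f T.
Proof.
move=> f0.
rewrite (@le_trans _ _ (\sum_(F : face | F.1 \in active M) f F.1))//.
  rewrite [leRHS](bigID (mem (sfaces M)))/= -[leLHS]addr0 lerD ?sumr_ge0//.
  rewrite le_eqVlt; apply/orP; left; apply/eqP; apply: eq_bigl => F.
  by case: (boolP (F \in sfaces M)) => [/sface_active ->|_]; rewrite ?andbF.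
rewrite (eq_bigl (fun F : face => (F.1 \in active M) && true)) => [|F]; last by rewrite andbT.
rewrite -(pair_big_dep (fun T => T \in active M) (fun _ _ => true) (fun T _ => f T))/=.
rewrite mulr_sumr ler_sum// => T _.
by rewrite sumr_const card_prod card_ord card_bool mulr_natl.
Qed.

Lemma sqrt_pair (a c x y m n : R) : 0 < a -> 0 <= c -> 0 <= x -> 0 <= y ->
  Num.sqrt a * x <= Num.sqrt c * m -> Num.sqrt a * y <= Num.sqrt c * n ->
  a * (x * y) <= c * (m * n).
Proof.
move=> a0 c0 x0 y0 xm yn.
have sa := sqr_sqrtr (ltW a0); have sc := sqr_sqrtr c0.
have -> : a * (x * y) = (Num.sqrt a * x) * (Num.sqrt a * y) by rewrite -[in LHS]sa; ring.
have -> : c * (m * n) = (Num.sqrt c * m) * (Num.sqrt c * n) by rewrite -[in LHS]sc; ring.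
by apply: ler_pM => //; apply: mulr_ge0 => //; exact: sqrtr_ge0.
Qed.

Lemma cauchy_sum (I : finType) (P : pred I) (f g : I -> R) :
  (forall i, 0 <= f i) -> (forall i, 0 <= g i) ->
  \sum_(i | P i) Num.sqrt (f i) * Num.sqrt (g i) <=
    Num.sqrt (\sum_(i | P i) f i) * Num.sqrt (\sum_(i | P i) g i).
Proof.
move=> f0 g0; apply: le_of_amgm; rewrite ?sqrtr_ge0// => t t0.
rewrite !sqr_sqrtr ?sumr_ge0// mulr_sumr !mulr_suml -big_split/= mulr_suml.
apply: ler_sum => i _; have := sqr_ge0 (t * Num.sqrt (f i) - Num.sqrt (g i)).
rewrite sqrrB exprMn !sqr_sqrtr// => H.
rewrite -(@ler_pM2l _ (2 * t)) ?mulr_gt0//.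
have -> : 2 * t * ((t * f i + g i / t) / 2) = t ^+ 2 * f i + g i.
  by field; rewrite gt_eqF.
by lra.
Qed.

(** The contribution of the face F to the squared energy norm, up to 2 mu. *)
Definition energy_at (v : velocity R d (nelt M)) (F : face) : R :=
  rv_integral (cell F.1) (visc_sq sym (v F.1)) +
  trace_sq (vtx F.1) F.2.1 F.2.2 (delta M) (v F.1) / hT F.1.

Lemma visc_sq_ge0 w (x : 'rV[R]_d) : 0 <= visc_sq sym w x.
Proof. by rewrite /visc_sq; case: sym; exact: frob_ge0. Qed.

Lemma elt_integral_ge0 (T : 'I_(nelt M)) (f : 'rV[R]_d -> R) : (forall x, 0 <= f x) ->
  0 <= rv_integral (cell T) f.
Proof. by move=> f0; apply: Rintegral_ge0 => t _; exact: f0. Qed.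

Lemma energy_at_ge0 v F : 0 <= energy_at v F.
Proof.
rewrite addr_ge0 ?divr_ge0 ?hT_ge0 ?trace_sq_ge0//.
by apply: elt_integral_ge0 => x; exact: visc_sq_ge0.
Qed.

Lemma norm_a_ge0 v : Vh M v -> 0 <= norm_a M v.
Proof.
by have [_ _ _ _ H] := enorm_a; move=> /H; apply: le_trans; exact: sqrtr_ge0.
Qed.

Lemma sum_energy v : Vh M v ->
  2 * mu * \sum_(F in sfaces M) energy_at v F <= (d * 2).+1%:R * norm_a M v ^+ 2.
Proof.
move=> vV; have na0 := norm_a_ge0 vV; have [_ _ _ H1 H2] := enorm_a.
have mu20 : 0 <= 2 * mu by rewrite mulr_ge0// ltW.
have sqle (a S : R) : 0 <= S -> Num.sqrt S <= a -> S <= a ^+ 2.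
  move=> S0 Sa; rewrite -[leLHS]sqr_sqrtr// lerXn2r// ?nnegrE ?sqrtr_ge0//.
  exact: le_trans Sa.
have vb : 2 * mu * \sum_(T in active M) rv_integral (cell T) (visc_sq sym (v T))
    <= norm_a M v ^+ 2.
  apply: sqle.
    by rewrite mulr_ge0// sumr_ge0// => T _; apply: elt_integral_ge0 => x; exact: visc_sq_ge0.
  rewrite sqrtrM//; apply: le_trans (H1 v vV); apply: ler_wpM2l; first exact: sqrtr_ge0.
  by rewrite /visc_sq; case: sym.
have tb : \sum_(F in sfaces M) 2 * mu *
     (trace_sq (vtx F.1) F.2.1 F.2.2 (delta M) (v F.1) / hT F.1) <= norm_a M v ^+ 2.
  apply: sqle.
    by rewrite sumr_ge0// => F _; rewrite mulr_ge0 ?divr_ge0 ?trace_sq_ge0 ?hT_ge0.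
  apply: le_trans (H2 v vV); rewrite /norm_traceT ler_wsqrtr// /surf.
  rewrite le_eqVlt; apply/orP; left; apply/eqP; apply: eq_bigr => F FS.
  rewrite !face_integralE /trace_sq face_integralE.
  set c := Num.sqrt _; have c2 : c ^+ 2 = 2 * mu / hT F.1.
    by rewrite sqr_sqrtr// divr_ge0 ?hT_ge0.
  rewrite mulrA mulrAC -c2 -cube_intZ.
    congr cube_int; apply/funext => y.
    by rewrite dotZl dotC dotZl expr2; ring.
  apply: tameM; last exact: tame_density.
  by apply: tame_dot => i; apply: tame_extT => l; exact: tame_delta.
rewrite /energy_at big_split/= mulrDr -[(d * 2).+1%:R]natr1 [leRHS]mulrDl mul1r lerD//.
  have f0 T : 0 <= rv_integral (cell T) (visc_sq sym (v T)).
    by apply: elt_integral_ge0 => x; exact: visc_sq_ge0.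
  have H := sum_faces_elts f0; apply: (le_trans (ler_wpM2l mu20 H)).
  rewrite mulrCA; apply: ler_wpM2l => //.
by rewrite mulr_sumr.
Qed.

Variables (Cg eta : R).
Hypothesis (Cg0 : 0 < Cg).
Hypothesis Hgrad : forall V (h eps : R) (j : 'I_d) (s : bool)
    (delta : 'rV[R]_d -> 'rV[R]_d) (v : {ffun 'I_d -> mpoly d R}),
  0 < h -> regular_elt V sigma h -> 0 <= eps -> eps <= c_d -> (sym -> eps <= eta) ->
  (forall i, (msize (v i) <= kV.+1)%N) ->
  (forall i, tame (fun y : d.-1.-tuple (measurableTypeR R) =>
     delta (ref_map V (face_param j s y)) 0 i)) ->
  (forall y i, face_cube y ->
     `|delta (ref_map V (face_param j s y)) 0 i| <= eps * h) ->
  forall x : 'rV[R]_d,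
  (forall i, `|x 0 i - ref_map V (cube_mid R d) 0 i| <= (sigma * d%:R + c_d) * h) ->
  forall i m,
  pev (mderiv m (v i)) x ^+ 2 * h ^+ d
    <= Cg * (rv_integral (elt V) (visc_sq sym v) +
       face_integral V j s (fun _ x => dot (extT delta v x) (extT delta v x)) / h).
Hypothesis eps_eta : sym -> eps <= eta.

(** The largest gradient near F that the local energy permits. *)
Definition grad_at (v : velocity R d (nelt M)) (F : face) : R :=
  Num.sqrt (Cg * energy_at v F / hT F.1 ^+ d).

Lemma hTd_gt0 (T : 'I_(nelt M)) : 0 < hT T ^+ d.
Proof. by rewrite exprn_gt0// hT_gt0. Qed.

Lemma grad_atE v F : grad_at v F ^+ 2 * hT F.1 ^+ d = Cg * energy_at v F.
Proof.
rewrite sqr_sqrtr ?divfK ?gt_eqF ?hTd_gt0//.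
by rewrite divr_ge0 ?(ltW (hTd_gt0 _))// mulr_ge0 ?energy_at_ge0// ltW.
Qed.

Lemma grad_at_ge0 v F : 0 <= grad_at v F. Proof. exact: sqrtr_ge0. Qed.

Lemma grad_bound_at v F : Vh M v -> F \in sfaces M ->
  grad_bound (vtx F.1) F.2.1 F.2.2 (delta M) (v F.1) (grad_at v F).
Proof.
move=> vV FS y t i m cy /andP[t0 t1]; have h0 := hT_gt0 F.1.
rewrite -(@ler_pXn2r _ 2)// ?nnegrE ?grad_at_ge0// real_normK ?num_real//.
rewrite -(ler_pM2r (hTd_gt0 F.1)) grad_atE.
have [_ _ _ vk _] := vspace.
apply: (Hgrad h0 (reg_elt F.1) eps_ge0 eps_le eps_eta).
- by move=> l; exact: vk.
- by move=> l; exact: tame_delta.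
- by move=> z l cz; exact: delta_le.
move=> l; rewrite mxE addrAC (le_trans (ler_normD _ _))// mulrDl lerD//.
  apply: (elt_near_mid l s0 h0 (reg_elt F.1)).
  by exists (face_param F.2.1 F.2.2 y) => //; exact: face_param_cube.
rewrite mxE normrM ger0_norm// -[leRHS]mul1r ler_pM//.
rewrite (le_trans (delta_le l FS cy))// ler_wpM2r ?eps_le//.
exact: ltW.
Qed.

Lemma form_a_bound u v : Vh M u -> Vh M v ->
  `|form_a mu sym u v - form_a mu sym v u| <=
  (2 * N ^+ 3 * K * Cg + 4 * N * c_alpha * Num.sqrt (K * Cg * N)) * (d * 2).+1%:R
   * eps * norm_a M u * norm_a M v.
Proof.
move=> uV vV; rewrite form_a_faces (le_trans (ler_norm_sum _ _ _))//.
set C3 := _ + _.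
have K0 := @density_const_ge0 R d sigma s0.
have C30 : 0 <= C3.
  rewrite addr_ge0// mulr_ge0 ?sqrtr_ge0//.
  - by rewrite mulr_ge0// exprn_ge0.
  - exact: ltW.
  - by rewrite mulr_ge0// ltW.
apply: (@le_trans _ _ (\sum_(F in sfaces M) 2 * mu * eps * C3 *
    (Num.sqrt (energy_at u F) * Num.sqrt (energy_at v F)))).
  apply: ler_sum => F FS; rewrite -[2 * mu * eps * C3 * _]mulrA.
  have I0 w : 0 <= rv_integral (cell F.1) (visc_sq sym (w F.1)).
    by apply: elt_integral_ge0 => x; exact: visc_sq_ge0.
  apply: (local_a_bound s0 (hT_gt0 F.1) (reg_elt F.1) eps_ge0
    (fun i => tame_delta i FS) (fun y i => @delta_le F y i FS) sym mu0 (ltW ca0) (ltW Cg0)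
    (grad_at_ge0 u F) (grad_at_ge0 v F) (grad_bound_at uV FS) (grad_bound_at vV FS)).
  - exact: tame_penalty.
  - by move=> y cy; exact: penalty_itv.
  - by rewrite grad_atE.
  - by rewrite grad_atE.
  - by rewrite lerDr.
  - by rewrite lerDr.
rewrite -mulr_sumr.
have S0 w : 0 <= \sum_(F in sfaces M) energy_at w F.
  by rewrite sumr_ge0// => F _; exact: energy_at_ge0.
have mu20 : 0 < 2 * mu by rewrite mulr_gt0.
have sq w : Vh M w -> Num.sqrt (2 * mu) * Num.sqrt (\sum_(F in sfaces M) energy_at w F)
    <= Num.sqrt (d * 2).+1%:R * norm_a M w.
  move=> wV; rewrite -sqrtrM ?(ltW mu20)// -[norm_a M w]ger0_norm ?norm_a_ge0//.
  by rewrite -sqrtr_sqr -sqrtrM// ler_wsqrtr// sum_energy.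
have := cauchy_sum (mem (sfaces M)) (energy_at_ge0 u) (energy_at_ge0 v).
set A := \sum_(i | _) _ => hA.
apply: (@le_trans _ _ (eps * C3 * ((2 * mu) * (Num.sqrt (\sum_(F in sfaces M) energy_at u F) *
   Num.sqrt (\sum_(F in sfaces M) energy_at v F))))).
  rewrite (_ : 2 * mu * eps * C3 * _ = eps * C3 * (2 * mu * A)); last by rewrite /A; ring.
  apply: ler_wpM2l; first by rewrite mulr_ge0 ?eps_ge0.
  by apply: ler_wpM2l => //; exact: ltW.
have H := sqrt_pair mu20 (ler0n R (d * 2).+1) (sqrtr_ge0 _) (sqrtr_ge0 _) (sq u uV) (sq v vV).
rewrite (_ : C3 * _ * eps * _ * _ = eps * C3 * ((d * 2).+1%:R * (norm_a M u * norm_a M v))); last by ring.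
by rewrite ler_wpM2l// mulr_ge0// eps_ge0.
Qed.

Variable (Cq : R).
Hypothesis Cq0 : 0 < Cq.
Hypothesis Hval : forall V (h w : R) (p P : mpoly d R), 0 < h -> regular_elt V sigma h ->
  0 <= w -> (msize p <= kQ.+1)%N -> (forall x, w * pev p x ^+ 2 <= pev P x) ->
  forall x : 'rV[R]_d,
  (forall i, `|x 0 i - ref_map V (cube_mid R d) 0 i| <= (sigma * d%:R + c_d) * h) ->
  w * pev p x ^+ 2 * h ^+ d <= Cq * rv_integral (elt V) (pev P) /\
  forall l, w * (h * pev (mderiv l p) x) ^+ 2 * h ^+ d
    <= Cq * rv_integral (elt V) (pev P).

Definition pressure_at (q : pressure R d (nelt M)) (T : 'I_(nelt M)) : R :=
  rv_integral (cell T) (fun x => (pev (q T) x / Num.sqrt (2 * mu)) ^+ 2).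

Lemma pressure_at_ge0 q T : 0 <= pressure_at q T.
Proof. by apply: elt_integral_ge0 => x; exact: sqr_ge0. Qed.

Lemma form_b_bound v q : Vh M v -> Qh M q ->
  `|form_b1 v q - form_b2 v q| <=
  N ^+ 2 * K * (Cg + Cq) * (d * 2).+1%:R * eps * norm_a M v * norm_Q mu q.
Proof.
move=> vV qQ; rewrite form_b_faces (le_trans (ler_norm_sum _ _ _))//.
have K0 := @density_const_ge0 R d sigma s0.
have mu20 : 0 < 2 * mu by rewrite mulr_gt0.
set C := Cg + Cq; have C0 : 0 < C by rewrite addr_gt0.
have [_ _ _ qk] := qspace.
have NKC : 0 <= N ^+ 2 * K * C by rewrite mulr_ge0 ?(ltW C0)// mulr_ge0// exprn_ge0.
apply: (@le_trans _ _ (\sum_(F in sfaces M) eps * (N ^+ 2 * K * C) *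
    (Num.sqrt (2 * mu) * (Num.sqrt (energy_at v F) * Num.sqrt (pressure_at q F.1))))).
  apply: ler_sum => F FS; have h0 := hT_gt0 F.1.
  pose EQ := 2 * mu * pressure_at q F.1.
  have EQ0 : 0 <= EQ by rewrite mulr_ge0 ?pressure_at_ge0// ltW.
  pose Bq := Num.sqrt (C * EQ / hT F.1 ^+ d).
  have BqE : Bq ^+ 2 * hT F.1 ^+ d = C * EQ.
    rewrite sqr_sqrtr ?divfK ?gt_eqF ?hTd_gt0//.
    by rewrite divr_ge0 ?(ltW (hTd_gt0 _))// mulr_ge0// ltW.
  have qB (y : d.-1.-tuple R) : face_cube y ->
      `|pev (q F.1) (ref_map (vtx F.1) (face_param F.2.1 F.2.2 y))| <= Bq.
    move=> cy; rewrite -(@ler_pXn2r _ 2)// ?nnegrE ?sqrtr_ge0// real_normK ?num_real//.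
    rewrite -(ler_pM2r (hTd_gt0 F.1)) BqE.
    pose P : mpoly d R := (2 * mu)^-1 *: (q F.1 * q F.1).
    have PE x : pev P x = (2 * mu)^-1 * pev (q F.1) x ^+ 2.
      by rewrite /pev /P mevalZ mevalM.
    have Pge x : (2 * mu)^-1 * pev (q F.1) x ^+ 2 <= pev P x by rewrite PE.
    have inv0 : 0 <= (2 * mu)^-1 by rewrite invr_ge0 ltW.
    have near i : `|ref_map (vtx F.1) (face_param F.2.1 F.2.2 y) 0 i -
        ref_map (vtx F.1) (cube_mid R d) 0 i| <= (sigma * d%:R + c_d) * hT F.1.
      apply: (face_point_near s0 h0 (reg_elt F.1)); first by rewrite lerDl ltW.
      exact: face_param_cube.
    have [+ _] := Hval h0 (reg_elt F.1) inv0 (qk q F.1 qQ) Pge near.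
    have -> : rv_integral (elt (vtx F.1)) (pev P) = pressure_at q F.1.
      congr (rv_integral _ _); apply/funext => x; rewrite PE exprMn exprVn sqr_sqrtr ?(ltW mu20)//.
      by rewrite mulrC.
    rewrite -mulrA mulrC ler_pdivrMr// => /le_trans; apply.
    rewrite /EQ (_ : Cq * _ * _ = Cq * (2 * mu * pressure_at q F.1)); last by ring.
    by rewrite ler_wpM2r// /C lerDr ltW.
  have GE : grad_at v F ^+ 2 * hT F.1 ^+ d <= C * energy_at v F.
    by rewrite grad_atE ler_wpM2r ?energy_at_ge0// /C lerDl ltW.
  have := local_b_bound s0 h0 (reg_elt F.1) eps_ge0 (fun i => tame_delta i FS)
    (fun y i => @delta_le F y i FS) (ltW C0) (grad_at_ge0 v F) (grad_bound_at vV FS)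
    qB (sqrtr_ge0 _) GE _ (EQ := EQ).
  rewrite BqE lexx => /(_ isT) /le_trans; apply.
  rewrite /EQ sqrtrM ?(ltW mu20)// -[leRHS]mulrA.
  by rewrite [Num.sqrt (2 * mu) * (_ * _)]mulrCA.
rewrite -mulr_sumr -mulr_sumr.
have hA := cauchy_sum (mem (sfaces M)) (energy_at_ge0 v) (fun F : face => pressure_at_ge0 q F.1).
set A := \sum_(i | _) _ in hA.
set SE := \sum_(i | _) _ in hA; set SQ := \sum_(i | _) _ in hA.
have SE0 : 0 <= SE by rewrite sumr_ge0// => F _; exact: energy_at_ge0.
have h1 : Num.sqrt (2 * mu) * Num.sqrt SE <= Num.sqrt (d * 2).+1%:R * norm_a M v.
  rewrite -sqrtrM ?(ltW mu20)// -[norm_a M v]ger0_norm ?norm_a_ge0//.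
  by rewrite -sqrtr_sqr -sqrtrM// ler_wsqrtr// sum_energy.
have h2 : Num.sqrt SQ <= Num.sqrt (d * 2).+1%:R * norm_Q mu q.
  rewrite /norm_Q -sqrtrM// ler_wsqrtr// (le_trans (sum_faces_elts (pressure_at_ge0 q)))//.
  rewrite ler_wpM2r ?ler_nat// sumr_ge0// => T _; exact: pressure_at_ge0.
have H : Num.sqrt (2 * mu) * A <= (d * 2).+1%:R * (norm_a M v * norm_Q mu q).
  apply: (@le_trans _ _ (Num.sqrt (2 * mu) * Num.sqrt SE * Num.sqrt SQ)).
    by rewrite -mulrA ler_wpM2l ?sqrtr_ge0.
  have sc := sqr_sqrtr (ler0n R (d * 2).+1).
  rewrite (_ : _ * (_ * norm_Q mu q) = (Num.sqrt (d * 2).+1%:R * norm_a M v) *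
    (Num.sqrt (d * 2).+1%:R * norm_Q mu q)); last by rewrite -[in LHS]sc; ring.
  by apply: ler_pM => //; rewrite ?sqrtr_ge0// mulr_ge0// sqrtr_ge0.
rewrite (_ : N ^+ 2 * K * C * _ * eps * _ * _ = eps * (N ^+ 2 * K * C) *
   ((d * 2).+1%:R * (norm_a M v * norm_Q mu q))); last by ring.
by rewrite ler_wpM2l// mulr_ge0// eps_ge0.
Qed.

End mesh.

Theorem lemma1 (R : realType) (d : nat) (Omega GammaD : set 'rV[R]_d)
    (mu : R) (sym : bool) (kV kQ : nat) (sigma c_d zeta c_alpha : R)
    (I : Type) (M : I -> sbm R d) :
  (d = 2 \/ d = 3)%N ->
  bounded_domain Omega -> GammaD `<=` bdry Omega ->
  0 < mu -> 0 < sigma -> 0 < c_d -> 0 < zeta -> 0 < c_alpha ->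
  (forall i, background_mesh (M i) Omega) ->
  (forall i, shape_regular (M i) sigma) ->
  (forall i, surrogate_geometry (M i) Omega GammaD) ->
  (forall i, nitsche_penalty (M i)) ->
  (forall i, velocity_space (M i) kV) ->
  (forall i, pressure_space (M i) kQ) ->
  (forall i, energy_norm (M i) mu sym) ->
  (forall i, distance_bound (M i) c_d zeta) ->
  (forall i, penalty_bound (M i) mu c_alpha) ->
  exists C h0 : R, [/\ 0 < C, 0 < h0 &
    forall i, (sym -> hhat_bdry (M i) <= h0) ->
      let eps := C * hhat_bdry (M i) `^ zeta in
      (forall u v, Vh (M i) u -> Vh (M i) v ->
        `|form_a mu sym u v - form_a mu sym v u|
          <= eps * norm_a (M i) u * norm_a (M i) v) /\
      (forall v q, Vh (M i) v -> Qh (M i) q ->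
        `|form_b1 v q - form_b2 v q|
          <= eps * norm_a (M i) v * norm_Q mu q)].
Proof.
move=> d23 _ _ mu0 s0 cd0 z0 ca0 mesh shape geom nitsche vspace qspace ena dist pen.
have d0 : (0 < d)%N by case: d23 => ->.
pose ra := sigma * d%:R + c_d.
have sd0 : 0 <= sigma * d%:R by rewrite mulr_ge0// ltW.
have sra : sigma * d%:R <= ra by rewrite lerDl ltW.
have ra0 : 0 <= ra by exact: le_trans sra.
have [Cg [eta [Cg0 eta0 Hg]]] := grad_control sym kV s0 (ltW cd0) sra.
have [Cq Cq0 Hq] := @elt_inverse R d kQ sigma ra s0 ra0.
set N : R := d.+1%:R; set K := density_const d sigma.
have K0 : 0 <= K by exact: density_const_ge0.
pose Ca := (2 * N ^+ 3 * K * Cg + 4 * N * c_alpha * Num.sqrt (K * Cg * N)) * (d * 2).+1%:R.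
pose Cb := N ^+ 2 * K * (Cg + Cq) * (d * 2).+1%:R.
have N0 : 0 <= N by exact: ler0n.
have N30 : 0 <= N ^+ 3 by exact: exprn_ge0.
have N20 : 0 <= N ^+ 2 by exact: exprn_ge0.
have Ca0 : 0 <= Ca.
  rewrite /Ca; clear Ca Cb; clearbody K N.
  apply: mulr_ge0 => //; apply: addr_ge0.
    apply: mulr_ge0; last exact: ltW.
    by apply: mulr_ge0 => //; apply: mulr_ge0.
  apply: mulr_ge0; last exact: sqrtr_ge0.
  by apply: mulr_ge0; [apply: mulr_ge0|exact: ltW].
have Cb0 : 0 <= Cb.
  rewrite /Cb; clear Ca Cb Ca0; clearbody K N.
  by apply: mulr_ge0 => //; apply: mulr_ge0; [exact: mulr_ge0|rewrite addr_ge0// ltW].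
(* below this threshold the relative distance c_d hhat^zeta is at most eta *)
exists ((1 + Ca + Cb) * c_d), ((eta / c_d) `^ zeta^-1); split.
- by rewrite mulr_gt0// -addrA ltr_wpDr ?addr_ge0.
- by rewrite powR_gt0// divr_gt0.
move=> i hle eps.
have H0 : 0 <= hhat_bdry (M i) by exact: hhat_bdry_ge0.
have eps_eta : sym -> c_d * hhat_bdry (M i) `^ zeta <= eta.
  move=> /hle {}hle; rewrite mulrC -ler_pdivlMr//.
  apply: (@le_trans _ _ (((eta / c_d) `^ zeta^-1) `^ zeta)).
    by apply: ge0_ler_powR; rewrite ?nnegrE ?powR_ge0// ltW.
  by rewrite -powRrM mulVf ?gt_eqF// powRr1// divr_ge0// ltW.
have epsE x : 0 <= x -> x <= Ca + Cb ->
    x * (c_d * hhat_bdry (M i) `^ zeta) <= eps.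
  move=> x0 xC; rewrite /eps -mulrA ler_wpM2r ?mulr_ge0 ?powR_ge0 ?(ltW cd0)//.
  by rewrite (le_trans xC)// -addrA lerDr.
have na0 v : Vh (M i) v -> 0 <= norm_a (M i) v by move=> vV; exact: (norm_a_ge0 (ena i) vV).
split=> [u v uV vV|v q vV qQ].
  have := form_a_bound d0 mu0 s0 cd0 z0 ca0 (mesh i) (shape i) (geom i) (nitsche i)
    (vspace i) (ena i) (dist i) (pen i) Cg0 Hg eps_eta uV vV.
  move=> /le_trans; apply; rewrite ler_wpM2r ?na0// ler_wpM2r ?na0//.
  by apply: (epsE Ca) => //; rewrite lerDl.
have := form_b_bound d0 mu0 s0 cd0 z0 (mesh i) (shape i) (geom i)
  (vspace i) (qspace i) (ena i) (dist i) Cg0 Hg eps_eta Cq0 Hq vV qQ.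
move=> /le_trans; apply; rewrite ler_wpM2r ?sqrtr_ge0// ler_wpM2r ?na0//.
by apply: (epsE Cb) => //; rewrite lerDr.
Qed.
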